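(* Let $n\ge1$ and let $\varphi\in H^\infty(\mathbb{D}^n)$ be nonzero. If $I_{H^\infty(\mathbb{D}^n)}(\varphi)$ is an $M$-ideal in $H^\infty(\mathbb{D}^n)$, then $$\ker T_\varphi^*=\{0\}.$$
   Context: $\mathbb{D}$ is the open unit disc in $\mathbb{C}$, $\mathbb{T}$ the unit circle, $\mu$ normalized Lebesgue measure on $\mathbb{T}^n$. $H^\infty(\mathbb{D}^n)$ is the Banach algebra of bounded holomorphic functions on $\mathbb{D}^n$ with the supremum norm, and $H^2(\mathbb{D}^n)$ is the Hardy space of holomorphic $f$ on $\mathbb{D}^n$ with $\|f\|_2=\left(\sup_{0<r<1}\int_{\mathbb{T}^n}|f(rz)|^2\,d\mu(z)\right)^{1/2}<\infty$ (a Hilbert space). $T_\varphi$ is the Toeplitz operator on $H^2(\mathbb{D}^n)$ given by $T_\varphi f=\varphi f$, and $T_\varphi^*$ is its Hilbert space adjoint. $I_{H^\infty(\mathbb{D}^n)}(\varphi)$ is the closed principal ideal generated by $\varphi$: the norm closure in $H^\infty(\mathbb{D}^n)$ of $\{\varphi g: g\in H^\infty(\mathbb{D}^n)\}$. $M$-ideal: a closed subspace $C$ of a complex Banach space $X$ is an $M$-ideal in $X$ if there is a bounded linear projection $P:X^*\to X^*$ ($P^2=P$) with $\operatorname{ran}P=C^\perp=\{x^*\in X^*: x^*|_C\equiv0\}$ and $\|Px^*\|+\|(I-P)x^*\|=\|x^*\|$ for all $x^*\in X^*$. *)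

(* Defs.v *)
From HB Require Import structures.
From mathcomp Require Import all_boot all_order all_algebra.
From mathcomp Require Import complex ring.
From mathcomp Require Import all_classical all_reals all_analysis measurable_realfun.

Set Implicit Arguments.
Unset Strict Implicit.
Unset Printing Implicit Defensive.

Import Order.TTheory GRing.Theory Num.Theory.
Import numFieldNormedType.Exports.
Import Normc.

Local Open Scope classical_set_scope.
Local Open Scope ring_scope.
Local Open Scope complex_scope.


Section modulus.
Variable R : realType.
Implicit Types z w : R[i].

Lemma normcEC z : `|z| = (normc z)%:C.
Proof. case: z => a b. rewrite normc_def /=. by []. Qed.

Lemma normc_ge0 z : 0 <= normc z.
Proof. by rewrite -lecR -normcEC normr_ge0. Qed.

Lemma normc_le z w : `|z| <= `|w| -> normc z <= normc w.
Proof. by rewrite !normcEC lecR. Qed.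

End modulus.

Section dual_space.
Context {R : realType} (X : normedModType R[i]).

Definition bounded_functional : {pred X -> R[i]^o} :=
  fun f : X -> R[i]^o => `[< linear f /\ continuous f >].

Lemma bounded_functional_submod : submod_closed bounded_functional.
Proof.
split=> [|a f g].
  apply/asboolP; split=> [b x y|x]; last exact: cvg_cst.
  by rewrite /= scaler0 addr0.
move=> /asboolP[lf cf] /asboolP[lg cg]; apply/asboolP; split=> [b x y|x].
  have fE := lf b x y; have gE := lg b x y.
  by rewrite !fctE in fE gE *; rewrite fE gE !scalerDr !scalerA addrACA [a * b]mulrC.
by apply: cvgD; [apply: cvgZr; exact: cf|exact: cg].
Qed.

HB.instance Definition _ :=
  GRing.isSubmodClosed.Build R[i] (X -> R[i]^o) bounded_functional
    bounded_functional_submod.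

Record dual := Dual {
  dual_fun :> X -> R[i]^o ;
  dualP : dual_fun \in bounded_functional }.

HB.instance Definition _ := [isSub of dual for dual_fun].
HB.instance Definition _ := [Choice of dual by <:].
HB.instance Definition _ := [SubChoice_isSubLmodule of dual by <:].

Implicit Types f g : dual.

Lemma dual_linear f : linear f.
Proof. by have /asboolP[] := dualP f. Qed.

Lemma dual_continuous f : continuous f.
Proof. by have /asboolP[] := dualP f. Qed.

HB.instance Definition _ f :=
  GRing.isLinear.Build R[i] X R[i]^o _ f (@dual_linear f).

Definition dual_norm f : R := sup [set normc (f x) | x in [set x | `|x| <= 1]].

Lemma dual_has_sup f : has_sup [set normc (f x) | x in [set x | `|x| <= 1]].
Proof.
split; first by exists (normc (f 0)), 0 => //=; rewrite normr0.
have /linear_bounded_continuous/bounded_funP/(_ 1)[M fM] := @dual_continuous f.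
exists (complex.Re M) => _ [x /= x1 <-].
by have := fM x x1; rewrite normcEC lecE => /andP[].
Qed.

Lemma dual_norm_ub f x : `|x| <= 1 -> normc (f x) <= dual_norm f.
Proof.
by move=> x1; apply: sup_upper_bound; [exact: dual_has_sup|exists x].
Qed.

Lemma dual_norm_le f M : (forall x, `|x| <= 1 -> normc (f x) <= M) ->
  dual_norm f <= M.
Proof.
move=> fM; apply: ge_sup; first by have [] := dual_has_sup f.
by move=> _ [x x1 <-]; exact: fM.
Qed.

Lemma dual_normD f g :
  (dual_norm (f + g))%:C <= (dual_norm f)%:C + (dual_norm g)%:C.
Proof.
rewrite -rmorphD lecR; apply: dual_norm_le => x x1.
by rewrite (le_trans (le_normcD _ _))// lerD// dual_norm_ub.
Qed.

Lemma dual_normZ (a : R[i]) f :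
  (dual_norm (a *: f))%:C = `|a| * (dual_norm f)%:C.
Proof.
rewrite normcEC -rmorphM; congr (_%:C).
have le b h : dual_norm (b *: h) <= normc b * dual_norm h.
  apply: dual_norm_le => x x1; rewrite [_ x]/(b * h x) normcM.
  by rewrite ler_wpM2l ?normc_ge0// dual_norm_ub.
apply/eqP; rewrite eq_le le /=.
have [->|a0] := eqVneq a 0.
  rewrite normc0 mul0r scale0r.
  have := @dual_norm_ub 0 0; rewrite normr0 => /(_ ler01); apply: le_trans.
  exact: normc_ge0.
have na0 : 0 < normc a.
  by rewrite lt_neqAle normc_ge0 andbT eq_sym; apply: contra a0 => /eqP/eq0_normc ->.
rewrite -ler_pdivlMl// -normcV (le_trans _ (le _ _))//.
by rewrite scalerA mulVf// scale1r.
Qed.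

Lemma dual_norm_eq0 f : (dual_norm f)%:C = 0 -> f = 0.
Proof.
move=> /complexI f0; apply/val_inj/funext => x /=.
have [->|x0] := eqVneq x 0; first by rewrite linear0.
have x1 : `| `|x|^-1 *: x| <= 1.
  by rewrite normrZ normrV ?unitfE ?normr_eq0// normr_id mulVf ?normr_eq0.
have := dual_norm_ub f x1; rewrite f0 => fx.
have /eq0_normc/eqP : normc (f (`|x|^-1 *: x)) = 0.
  by apply/eqP; rewrite eq_le fx normc_ge0.
by rewrite linearZ /= scaler_eq0 invr_eq0 normr_eq0 (negbTE x0) => /eqP.
Qed.

HB.instance Definition _ := Lmodule_isNormed.Build R[i] dual
  dual_normD dual_normZ dual_norm_eq0.

End dual_space.

Section M_ideal.
Context {R : realType} {X : normedModType R[i]}.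
Implicit Types C : set X.

Definition closed_subspace C :=
  closed C /\ C 0 /\ (forall (a : R[i]) x y, C x -> C y -> C (a *: x + y)).

Definition annihilator C : set (dual X) :=
  [set f | forall x, C x -> f x = 0].

Definition M_ideal C := closed_subspace C /\
  exists P : {linear dual X -> dual X},
    [/\ continuous P,
        forall f, P (P f) = P f,
        range P = annihilator C &
        forall f, `|P f| + `|f - P f| = `|f|].

End M_ideal.

Section polydisc.
Context {R : realType} {n : nat}.

Definition polydisc : set 'rV[R[i]]_n := [set z | forall i, `|z ord0 i| < 1].

(* A function on the polydisc is represented by its extension by 0 to C^n, so
   that equality of functions is equality on the polydisc. *)
Definition holomorphic (f : 'rV[R[i]]_n -> R[i]^o) :=
  (forall z : 'rV[R[i]]_n : normedModType R[i], polydisc z -> differentiable f z) /\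
  (forall z, ~ polydisc z -> f z = 0).

Lemma holomorphic0 : holomorphic 0.
Proof. by split=> // z _; exact: differentiable_cst. Qed.

Lemma holomorphicDZ (a : R[i]) f g :
  holomorphic f -> holomorphic g -> holomorphic (a *: f + g).
Proof.
move=> [df f0] [dg g0]; split=> z zD.
  by apply: differentiableD; [apply: differentiableZ; exact: df|exact: dg].
by rewrite !fctE f0// g0// scaler0 addr0.
Qed.

Lemma holomorphicM f g : holomorphic f -> holomorphic g ->
  holomorphic (fun z => f z * g z).
Proof.
move=> [df f0] [dg g0]; split=> z zD; last by rewrite f0// mul0r.
by apply: differentiableM; [exact: df|exact: dg].
Qed.

End polydisc.

Section Hinf.
Context (R : realType) (n : nat).
Implicit Types (z : 'rV[R[i]]_n).

Definition bounded_holomorphic : {pred 'rV[R[i]]_n -> R[i]^o} :=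
  fun f => `[< holomorphic f /\ exists M : R, forall z, normc (f z) <= M >].

Lemma bounded_holomorphic_submod : submod_closed bounded_holomorphic.
Proof.
split=> [|a f g].
  by apply/asboolP; split; [exact: holomorphic0|exists 0 => z; rewrite normc0].
move=> /asboolP[hf [M fM]] /asboolP[hg [N gN]]; apply/asboolP.
split; first exact: holomorphicDZ.
exists (normc a * M + N) => z; rewrite (le_trans (le_normcD _ _))// lerD//.
by rewrite normcM ler_wpM2l// normc_ge0.
Qed.

HB.instance Definition _ :=
  GRing.isSubmodClosed.Build R[i] ('rV[R[i]]_n -> R[i]^o) bounded_holomorphic
    bounded_holomorphic_submod.

Record Hinf := MkHinf {
  Hinf_fun :> 'rV[R[i]]_n -> R[i]^o ;
  HinfP : Hinf_fun \in bounded_holomorphic }.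

HB.instance Definition _ := [isSub of Hinf for Hinf_fun].
HB.instance Definition _ := [Choice of Hinf by <:].
HB.instance Definition _ := [SubChoice_isSubLmodule of Hinf by <:].

Implicit Types f g : Hinf.

Lemma Hinf_holomorphic f : holomorphic f.
Proof. by have /asboolP[] := HinfP f. Qed.

Definition Hinf_norm f : R := sup [set normc (f z) | z in polydisc].

Lemma polydisc0 : polydisc (0 : 'rV[R[i]]_n).
Proof. by move=> i; rewrite mxE normr0. Qed.

Lemma Hinf_has_sup f : has_sup [set normc (f z) | z in polydisc].
Proof.
split; first by exists (normc (f 0)), 0 => //; exact: polydisc0.
by have /asboolP[_ [M fM]] := HinfP f; exists M => _ [z _ <-].
Qed.

Lemma Hinf_norm_ub f z : normc (f z) <= Hinf_norm f.
Proof.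
have ub w : polydisc w -> normc (f w) <= Hinf_norm f.
  by move=> wD; apply: sup_upper_bound; [exact: Hinf_has_sup|exists w].
have [/ub//|zD] := pselect (polydisc z).
have [_ ->//] := Hinf_holomorphic f; rewrite normc0.
by rewrite (le_trans _ (ub _ polydisc0))// normc_ge0.
Qed.

Lemma Hinf_norm_le f M : (forall z, normc (f z) <= M) -> Hinf_norm f <= M.
Proof.
move=> fM; apply: ge_sup; first by have [] := Hinf_has_sup f.
by move=> _ [z _ <-].
Qed.

Lemma Hinf_normD f g :
  (Hinf_norm (f + g))%:C <= (Hinf_norm f)%:C + (Hinf_norm g)%:C.
Proof.
rewrite -rmorphD lecR; apply: Hinf_norm_le => z.
by rewrite (le_trans (le_normcD _ _))// lerD// Hinf_norm_ub.
Qed.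

Lemma Hinf_normZ (a : R[i]) f :
  (Hinf_norm (a *: f))%:C = `|a| * (Hinf_norm f)%:C.
Proof.
rewrite normcEC -rmorphM; congr (_%:C).
have le b h : Hinf_norm (b *: h) <= normc b * Hinf_norm h.
  apply: Hinf_norm_le => z; rewrite [_ z]/(b * h z) normcM.
  by rewrite ler_wpM2l ?normc_ge0// Hinf_norm_ub.
apply/eqP; rewrite eq_le le /=.
have [->|a0] := eqVneq a 0.
  rewrite normc0 mul0r scale0r.
  by rewrite (le_trans _ (Hinf_norm_ub 0 0))// normc_ge0.
have na0 : 0 < normc a.
  by rewrite lt_neqAle normc_ge0 andbT eq_sym; apply: contra a0 => /eqP/eq0_normc ->.
rewrite -ler_pdivlMl// -normcV (le_trans _ (le _ _))//.
by rewrite scalerA mulVf// scale1r.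
Qed.

Lemma Hinf_norm_eq0 f : (Hinf_norm f)%:C = 0 -> f = 0.
Proof.
move=> /complexI f0; apply/val_inj/funext => z /=; apply: eq0_normc.
by apply/eqP; rewrite eq_le normc_ge0 andbT -f0 Hinf_norm_ub.
Qed.

HB.instance Definition _ := Lmodule_isNormed.Build R[i] Hinf
  Hinf_normD Hinf_normZ Hinf_norm_eq0.

Lemma Hinf_mul_subproof f g :
  (fun z => f z * g z : R[i]^o) \in bounded_holomorphic.
Proof.
apply/asboolP; split; first by apply: holomorphicM; exact: Hinf_holomorphic.
exists (Hinf_norm f * Hinf_norm g) => z.
by rewrite normcM ler_pM ?normc_ge0 ?Hinf_norm_ub.
Qed.

Definition Hinf_mul f g : Hinf := MkHinf (Hinf_mul_subproof f g).

Definition principal_ideal f : set Hinf := closure (range (Hinf_mul f)).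

End Hinf.

Section torus.
Context {R : realType}.

Lemma two_pi_gt0 : (0 : R) < 2 * pi.
Proof. by rewrite mulr_gt0// pi_gt0. Qed.

Section step.
Context (n : nat) (P : probability (n.-tuple (measurableTypeR R)) R).

Definition cons_angle (p : measurableTypeR R * n.-tuple (measurableTypeR R)) :
  n.+1.-tuple (measurableTypeR R) := [tuple of p.1 :: p.2].

Lemma measurable_cons_angle : measurable_fun setT cons_angle.
Proof. exact: (measurable_cons measurable_fst measurable_snd). Qed.

HB.instance Definition _ := isMeasurableFun.Build _ _ _ _ cons_angle
  measurable_cons_angle.

Definition angle_product := (uniform_prob two_pi_gt0 \x P)%E.

HB.instance Definition _ := Measure.on angle_product.

Lemma angle_product_setT : angle_product setT = 1%E.
Proof.
rewrite /angle_product -[X in _ X = _]setXTT product_measure1E//.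
by rewrite [X in (X * _)%E]probability_setT [X in (_ * X)%E]probability_setT mule1.
Qed.

HB.instance Definition _ := Measure_isProbability.Build _ _ _ angle_product
  angle_product_setT.

End step.

(* Normalized Lebesgue measure on the torus T^n, in the coordinates
   (e^(i t_1), ..., e^(i t_n)) with t in [0, 2 pi]^n. *)
Fixpoint torus_measure n : probability (n.-tuple (measurableTypeR R)) R :=
  match n with
  | 0 => dirac [tuple]
  | m.+1 => distribution (angle_product (torus_measure m)) (@cons_angle m)
  end.

Definition torus_point n (r : R) (t : n.-tuple (measurableTypeR R)) :
    'rV[R[i]]_n :=
  \row_i (r%:C * (cos (tnth t i) +i* sin (tnth t i))).

End torus.

Section torus_measurability.
Context {R : realType} (n : nat).
Notation angles := (n.-tuple (measurableTypeR R)).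

Let grid (k : nat) (x : R) : R := (Num.floor (x * k.+1%:R))%:~R / k.+1%:R.

Let grid_cvg x : grid ^~ x @ \oo --> x.
Proof.
apply/cvgrPdist_le => e e0; near=> k.
have k0 : (0 : R) < k.+1%:R by [].
have -> : x - grid k x = (x * k.+1%:R - (Num.floor (x * k.+1%:R))%:~R) / k.+1%:R.
  by rewrite mulrBl mulfK ?gt_eqF.
have /andP[l u] := floor_itv (x * k.+1%:R).
rewrite ger0_norm ?divr_ge0 ?subr_ge0// ler_pdivrMr//.
apply: (@le_trans _ _ 1).
  by rewrite lerBlDl ltW// -[1]/(1%:~R) -intrD.
rewrite -ler_pdivrMr// div1r ltW//.
by near: k; exact: (near_infty_natSinv_lt (PosNum e0)).
Unshelve. all: by end_near. Qed.

Let gridt k (t : angles) : angles :=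
  map_tuple (grid k : measurableTypeR R -> measurableTypeR R) t.

Let measurable_grid (F : angles -> R) k :
  measurable_fun setT (fun t => F (gridt k t)).
Proof.
move=> _ Y mY; rewrite setTI.
pose fl (t : angles) : n.-tuple int :=
  map_tuple (fun x : measurableTypeR R => Num.floor ((x : R) * k.+1%:R)) t.
pose G (m : n.-tuple int) := F (map_tuple (fun i : int => i%:~R / k.+1%:R : measurableTypeR R) m).
have -> : (fun t => F (gridt k t)) @^-1` Y =
    \bigcup_(m in G @^-1` Y) [set t | fl t = m].
  have FE t : F (gridt k t) = G (fl t).
    by congr F; apply: eq_from_tnth => i; rewrite !tnth_map.
  apply/seteqP; split=> [t /= Yt|t [m /= Ym tm]] /=; last by rewrite FE tm.
  by exists (fl t) => //=; rewrite -FE.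
rewrite bigcup_mkcond; apply: countable_bigcupT_measurable => [//|m].
case: ifPn => // _.
have -> : [set t | fl t = m] = \bigcap_(i in [set: 'I_n])
    ((fun t : angles => tnth t i) @^-1`
      [set` `[(tnth m i)%:~R / k.+1%:R, (tnth m i + 1)%:~R / k.+1%:R[ ]).
  have k0 : (0 : R) < k.+1%:R by [].
  apply/seteqP; split=> [t /= <- i _|t /= tm].
    rewrite /= tnth_map in_itv/= ler_pdivrMr// ltr_pdivlMr//; exact: floor_itv.
  apply: eq_from_tnth => i; rewrite tnth_map; apply: floor_def.
  by have := tm i I; rewrite /= in_itv/= ler_pdivrMr// ltr_pdivlMr.
apply: fin_bigcap_measurable => // i _.
rewrite -[X in measurable X]setTI; exact: measurable_tnth.
Qed.

Lemma measurable_seq_continuous (F : angles -> R) :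
  (forall (s : nat -> angles) t,
    (forall i, tnth (s k) i @[k --> \oo] --> tnth t i) ->
    F (s k) @[k --> \oo] --> F t) ->
  measurable_fun setT F.
Proof.
move=> cF; apply: measurable_realfun.measurable_fun_cvg (measurable_grid F) _ => t _.
apply: cF => i; under eq_fun do rewrite tnth_map.
exact: grid_cvg.
Qed.

End torus_measurability.

Section H2.
Context (R : realType) (n : nat).
Notation angles := (n.-tuple (measurableTypeR R)).
Implicit Types (h : 'rV[R[i]]_n -> R[i]^o) (r : R).

Lemma normc_le_ReIm (z : R[i]) : normc z <= `|complex.Re z| + `|complex.Im z|.
Proof.
case: z => a b /=; rewrite -[leRHS]ger0_norm ?addr_ge0// -sqrtr_sqr ler_sqrt ?sqr_ge0//.
by rewrite sqrrD !real_normK ?num_real// lerD2r lerDl mulrn_wge0// mulr_ge0.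
Qed.

Lemma normc_dist (a b : R[i]) : `|normc a - normc b| <= normc (a - b).
Proof.
have le x y : normc x - normc y <= normc (x - y).
  by rewrite lerBlDr; have := le_normcD (x - y) y; rewrite subrK.
by rewrite ler_norml le andbT -[normc a - normc b]opprB lerN2 -[normc (a - b)]normcN [- (a - b)]opprB le.
Qed.

Lemma sqr_addr_le (a b : R) : (a + b) ^+ 2 <= 2 * (a ^+ 2 + b ^+ 2).
Proof.
rewrite -subr_ge0; have -> : 2 * (a ^+ 2 + b ^+ 2) - (a + b) ^+ 2 = (a - b) ^+ 2.
  by ring.
exact: sqr_ge0.
Qed.

Lemma torus_point_in_polydisc r (t : angles) : 0 < r < 1 ->
  polydisc (torus_point r t).
Proof.
move=> /andP[r0 r1] i; rewrite mxE normrM !normcEC -rmorphM -(rmorph1 (real_complex R)) ltcR.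
by rewrite /= cos2Dsin2 sqrtr1 mulr1 expr0n/= addr0 sqrtr_sqr gtr0_norm.
Qed.

Lemma cvg_torus_point r (s : nat -> angles) (t : angles) :
  (forall i, tnth (s k) i @[k --> \oo] --> tnth t i) ->
  (torus_point r (s k) : 'rV[R[i]]_n : normedModType R[i]) @[k --> \oo]
    --> (torus_point r t : 'rV[R[i]]_n : normedModType R[i]).
Proof.
move=> st; apply/cvg_ballP => e e0.
have re0 : 0 < complex.Re e by move: e0; rewrite ltcE => /andP[].
have eE : e = (complex.Re e)%:C.
  by move: e0; rewrite ltcE => /andP[/eqP ie _]; case: e ie {re0} => a b /= ->.
pose d := complex.Re e / 2 / (`|r| + 1).
have r0 : 0 < `|r| + 1 by rewrite ltr_wpDl.
have d0 : 0 < d by rewrite !divr_gt0.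
have close (u : R -> R) : continuous u ->
    \forall k \near \oo, forall i, `|u (tnth t i) - u (tnth (s k) i)| < d.
  move=> cu; apply: filter_forall => i.
  have : u (tnth (s k) i) @[k --> \oo] --> u (tnth t i).
    by apply: continuous_cvg (st i); exact: cu.
  by move/cvgrPdist_lt => /(_ d d0).
near=> k; split=> // j i; rewrite -ball_normE /ball_ /= !mxE -mulrBr.
rewrite normcEC eE ltcR normcM (le_lt_trans (ler_wpM2l (normc_ge0 _) (normc_le_ReIm _)))//.
rewrite [X in X * _]/= expr0n/= addr0 sqrtr_sqr.
have -> : complex.Re e = (`|r| + 1) * (d + d).
  by rewrite /d -mulrDl -splitr mulrC divfK ?gt_eqF.
apply: (@le_lt_trans _ _ ((`|r| + 1) * (`|cos (tnth t i) - cos (tnth (s k) i)| + `|sin (tnth t i) - sin (tnth (s k) i)|))).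
  by rewrite ler_wpM2r ?addr_ge0// lerDl.
rewrite ltr_pM2l// ltrD//.
  by move: i; near: k; apply: close; exact: continuous_cos.
by move: i; near: k; apply: close; exact: continuous_sin.
Unshelve. all: by end_near. Qed.

Lemma measurable_torus h r : holomorphic h -> 0 < r < 1 ->
  measurable_fun setT (fun t : angles => normc (h (torus_point r t)) ^+ 2).
Proof.
move=> [dh _] r01; apply: measurable_seq_continuous => s t st.
have ht : h (torus_point r (s k)) @[k --> \oo] --> h (torus_point r t).
  apply: continuous_cvg (cvg_torus_point st).
  by apply: differentiable_continuous; apply: dh; exact: torus_point_in_polydisc.
have nt : normc (h (torus_point r (s k))) @[k --> \oo] --> normc (h (torus_point r t)).
  apply/cvgrPdist_le => e e0.
  have e0' : 0 < e%:C by rewrite -(rmorph0 (real_complex R)) ltcR.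
  move/cvgrPdist_le : ht => /(_ _ e0'); apply: filterS => k.
  rewrite normcEC lecR; apply: le_trans.
  exact: normc_dist.
by rewrite expr2; under eq_fun do rewrite expr2; exact: cvgM.
Qed.

Local Open Scope ereal_scope.

Definition circular_mean h r : \bar R :=
  \int[torus_measure n]_t (normc (h (torus_point r t)) ^+ 2)%:E.

Definition H2_sup h : \bar R :=
  ereal_sup [set circular_mean h r | r in [set r | (0 < r < 1)%R]].

Definition hardy2 : {pred 'rV[R[i]]_n -> R[i]^o} :=
  fun h => `[< holomorphic h /\ H2_sup h < +oo >].

Lemma circular_mean_ge0 h r : 0 <= circular_mean h r.
Proof. by apply: integral_ge0 => t _; rewrite lee_fin sqr_ge0. Qed.

Lemma circular_mean0 r : circular_mean (0%R : 'rV[R[i]]_n -> R[i]^o) r = 0.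
Proof.
by apply: integral0_eq => t _; rewrite normc0 expr0n.
Qed.

Lemma circular_meanM f g r (M : R) : holomorphic f -> holomorphic g -> (0 < r < 1)%R ->
  (forall z, (normc (f z) <= M)%R) ->
  circular_mean (fun z => f z * g z)%R r <= (M ^+ 2)%:E * circular_mean g r.
Proof.
move=> hf hg r01 fM; rewrite /circular_mean -ge0_integralZl//; last 3 first.
- by apply/measurable_EFinP; exact: measurable_torus.
- by move=> t _; rewrite lee_fin sqr_ge0.
- by rewrite lee_fin sqr_ge0.
apply: ge0_le_integral => //.
- by move=> t _; rewrite lee_fin sqr_ge0.
- by apply/measurable_EFinP; exact: (measurable_torus (holomorphicM hf hg) r01).
- by apply: measurable_funeM; apply/measurable_EFinP; exact: measurable_torus.
move=> t _; rewrite -EFinM lee_fin normcM exprMn ler_wpM2r ?sqr_ge0//.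
by rewrite lerXn2r ?nnegrE ?normc_ge0// (le_trans _ (fM 0%R))// normc_ge0.
Qed.

Lemma circular_meanD f g r : holomorphic f -> holomorphic g -> (0 < r < 1)%R ->
  circular_mean (f + g)%R r <= 2%:E * (circular_mean f r + circular_mean g r).
Proof.
move=> hf hg r01; have mf := measurable_torus hf r01; have mg := measurable_torus hg r01.
rewrite /circular_mean -ge0_integralD//; last 4 first.
- by move=> t _; rewrite lee_fin sqr_ge0.
- exact/measurable_EFinP.
- by move=> t _; rewrite lee_fin sqr_ge0.
- exact/measurable_EFinP.
rewrite -ge0_integralZl//; last 2 first.
- by apply: emeasurable_funD; exact/measurable_EFinP.
- by move=> t _; rewrite -EFinD lee_fin addr_ge0// sqr_ge0.
apply: ge0_le_integral => //.
- by move=> t _; rewrite lee_fin sqr_ge0.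
- apply/measurable_EFinP; apply: (measurable_torus _ r01).
  by rewrite -[f]scale1r; exact: holomorphicDZ.
- by apply: measurable_funeM; apply: emeasurable_funD; exact/measurable_EFinP.
move=> t _; rewrite -EFinD -EFinM lee_fin.
apply: (@le_trans _ _ ((normc (f (torus_point r t)) + normc (g (torus_point r t))) ^+ 2)%R).
  by rewrite lerXn2r ?nnegrE ?addr_ge0 ?normc_ge0// le_normcD.
exact: sqr_addr_le.
Qed.

Lemma hardy2M f g (M : R) : holomorphic f -> (forall z, (normc (f z) <= M)%R) ->
  g \in hardy2 -> (fun z => f z * g z)%R \in hardy2.
Proof.
move=> hf fM /asboolP[hg gfin]; apply/asboolP; split; first exact: holomorphicM.
apply: (@le_lt_trans _ _ ((M ^+ 2)%:E * H2_sup g)).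
  apply: ge_ereal_sup => _ [r r01 <-].
  apply: le_trans (circular_meanM hf hg r01 fM) _.
  by rewrite lee_wpmul2l ?lee_fin ?sqr_ge0//; apply: ereal_sup_ubound; exists r.
by rewrite lte_mul_pinfty// lee_fin sqr_ge0.
Qed.

Lemma hardy2_submod : submod_closed hardy2.
Proof.
split=> [|a f g].
  apply/asboolP; split; first exact: holomorphic0.
  apply: (@le_lt_trans _ _ 0); last exact: ltry.
  by apply: ge_ereal_sup => _ [r r01 <-]; rewrite circular_mean0.
move=> /asboolP[hf ffin] /asboolP[hg gfin]; apply/asboolP.
have haf : holomorphic (a *: f).
  by rewrite -[_ *: _]addr0; apply: holomorphicDZ => //; exact: holomorphic0.
split; first exact: holomorphicDZ.
apply: (@le_lt_trans _ _
    (2%:E * ((normc a ^+ 2)%:E * H2_sup f + H2_sup g))).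
  apply: ge_ereal_sup => _ [r r01 <-].
  apply: le_trans (circular_meanD haf hg r01) _.
  rewrite lee_wpmul2l// leeD//; last by apply: ereal_sup_ubound; exists r.
  apply: (@le_trans _ _ ((normc a ^+ 2)%:E * circular_mean f r)).
    rewrite /circular_mean -ge0_integralZl//; last 3 first.
    - by apply/measurable_EFinP; exact: measurable_torus.
    - by move=> t _; rewrite lee_fin sqr_ge0.
    - by rewrite lee_fin sqr_ge0.
    rewrite le_eqVlt; apply/orP; left; apply/eqP; apply: eq_integral => t _.
    by rewrite [(a *: f)%R _]/(a * f _)%R normcM exprMn EFinM.
  by rewrite lee_wpmul2l ?lee_fin ?sqr_ge0//; apply: ereal_sup_ubound; exists r.
by rewrite lte_mul_pinfty// lte_add_pinfty// lte_mul_pinfty// lee_fin sqr_ge0.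
Qed.

HB.instance Definition _ :=
  GRing.isSubmodClosed.Build R[i] ('rV[R[i]]_n -> R[i]^o) hardy2 hardy2_submod.

Record H2 := MkH2 {
  H2_fun :> 'rV[R[i]]_n -> R[i]^o ;
  H2P : H2_fun \in hardy2 }.

HB.instance Definition _ := [isSub of H2 for H2_fun].
HB.instance Definition _ := [Choice of H2 by <:].
HB.instance Definition _ := [SubChoice_isSubLmodule of H2 by <:].

Implicit Types (f g : H2).

Local Open Scope ring_scope.

Definition H2_norm f : R := Num.sqrt (fine (H2_sup f)).

(* The inner product inducing the norm (polarization identity), linear in the
   first argument. *)
Definition H2_dot f g : R[i] :=
  4^-1 * \sum_(k < 4) 'i ^+ k * ((H2_norm (f + 'i ^+ k *: g)) ^+ 2)%:C.

(* For a bounded operator T on the Hilbert space H2, exactly one S satisfies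
   the defining identity (Riesz), so the default value T is never used. *)
Definition adjoint (T : H2 -> H2) : H2 -> H2 :=
  xget T [set S | forall f g, H2_dot (T f) g = H2_dot f (S g)].

Lemma toeplitz_subproof (phi : Hinf R n) f :
  (fun z => phi z * f z : R[i]^o)%R \in hardy2.
Proof.
apply: (@hardy2M _ _ (Hinf_norm phi)); last exact: H2P.
  exact: Hinf_holomorphic.
exact: Hinf_norm_ub.
Qed.

Definition toeplitz (phi : Hinf R n) f : H2 := MkH2 (toeplitz_subproof phi f).

End H2.

(* Main.v *)
(* By the Hahn-Banach theorem on X x X with the maximum norm, an M-ideal J of X
   has the two-ball property: if x, psi are in the unit ball and psi is in J, then
   some y in J satisfies |x + psi - y| <= 1 + e and |x - psi - y| <= 1 + e.  For
   J the ideal of phi, x = 1 and psi proportional to phi, the values of y lie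
   (almost) in the disc of centre and radius 1, and away from 0 at a given z0 with
   phi(z0) <> 0.  Then y / (y + eta) is almost a contraction, and approximating y
   by multiples of phi gives k = phi u with |k| <= 1 + d and |1 - k(z0)| <= d.

   Since |1 - F| <= 1 + d forces |F|^2 <= 2 Re F + 3 d, the mean value property
   makes 1 - k small in mean square when z0 is the centre of the torus of
   integration.  The reproducing formula of the Szego kernel then shows that k is
   close to 1 at other points, so phi has no zero in the polydisc; and, with
   z0 = 0, every bounded holomorphic p is the limit in H^2 of the functions
   phi u p.  Hence g orthogonal to the range of T_phi satisfies
   |p + g| = |p - g| for all these p.  Taking for p large multiples of g(a) S_a,
   with S_a the Szego kernel at a <> 0, forces g(a) = 0.

   The inner product is given by polarization and the adjoint by choice, so the
   parallelogram identity and Riesz' theorem are not used: if no adjoint exists,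
   the junk value of [adjoint] is T_phi itself, which is injective as phi has no
   zero. *)
Require Import Defs.
From mathcomp Require Import all_boot all_order all_algebra.
From mathcomp Require Import complex ring lra.
From mathcomp Require Import all_classical all_reals all_analysis.
From mathcomp Require Import measurable_realfun.
Import Order.TTheory GRing.Theory Num.Theory numFieldNormedType.Exports.
Import Normc.

Set Implicit Arguments.
Unset Strict Implicit.
Unset Printing Implicit Defensive.

Local Open Scope classical_set_scope.
Local Open Scope ring_scope.
Local Open Scope complex_scope.

(** Holomorphy is mere differentiability at each point, so Cauchy's formula rests on Goursat's
    bisection. It is run on the parameter rectangle of a homotopy that contracts a circle to a
    point, for a real closed form; only real parts of integrals ever occur. On the torus the
    variables are then treated one at a time.

    The obstacle in the last step is that the norm of H^2 is a supremum over radii. The cross term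
    between p and g is known at each radius, but the suprema for p + g and for p - g might be
    approached at different radii. A large factor in front of S_a forces both towards radius 1,
    because S_a(r^2 a) increases strictly with r when a <> 0. The value g(0) is recovered
    separately, from a mean over a torus on which g is already known to vanish. *)

Lemma real_complexD (R : realType) (a b : R) : (a + b)%:C = a%:C + b%:C.
Proof. exact: rmorphD. Qed.

Lemma real_complexM (R : realType) (a b : R) : (a * b)%:C = a%:C * b%:C.
Proof. exact: rmorphM. Qed.

Lemma normcR_ge0 (R : realType) (t : R) : 0 <= t -> normc t%:C = t.
Proof. by move=> t0; rewrite /= expr0n/= addr0 sqrtr_sqr ger0_norm. Qed.

(** Used to align the phases of the values of functionals before a seminorm bound is applied. *)
Lemma normc_rotate (R : realType) (z : R[i]) :
  exists2 c, normc c = 1 & c * z = (normc z)%:C.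
Proof.
have [->|z0] := eqVneq z 0; first by exists 1; rewrite ?normc1// normc0 mulr0.
have n0 : 0 < normc z by rewrite -ltcR -normcEC normr_gt0.
exists (z^-1 * (normc z)%:C); last by rewrite mulrAC mulVf// mul1r.
by rewrite normcM normcV normcR_ge0 ?ltW// mulVf// gt_eqF.
Qed.

(** * The complex Hahn-Banach theorem, through minimal sublinear functionals *)

Section hahn_banach.
Context {R : realType} {V : lmodType R[i]}.
Implicit Types (q p : V -> R) (x y a : V).

(** [V] is regarded as a real space. The inequality for positive [t] is enough: rescaling by [t^-1]
    gives the converse, see [sublinearZ]. *)
Definition sublinear q :=
  (forall x y, q (x + y) <= q x + q y) /\
  (forall (t : R) x, 0 < t -> q (t%:C *: x) <= t * q x).

Lemma sublinearZ q (t : R) x : sublinear q -> 0 < t ->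
  q (t%:C *: x) = t * q x.
Proof.
move=> [_ qZ] t0; apply/eqP; rewrite eq_le qZ//=.
have := qZ t^-1 (t%:C *: x); rewrite invr_gt0 => /(_ t0).
rewrite scalerA -rmorphM mulVf ?gt_eqF// scale1r => h.
by rewrite -ler_pdivlMl.
Qed.

Lemma sublinear0 q : sublinear q -> q 0 = 0.
Proof.
move=> sq; have := @sublinearZ q 2 0 sq; rewrite scaler0 => /(_ (ltr0Sn _ _)).
by lra.
Qed.

Lemma sublinear_opp q x : sublinear q -> - q (- x) <= q x.
Proof.
by move=> sq; have := sq.1 x (- x); rewrite subrr sublinear0//; lra.
Qed.

(** Built to be a sublinear minorant of [q] whose value at [- a] is at most [- q a]. *)
Definition shift_inf q a x : R :=
  inf [set q (x + t%:C *: a) - t * q a | t in [set t : R | 0 <= t]].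

Section shift_inf.
Variables (q : V -> R) (sq : sublinear q) (a : V).

Let sublinearZ0 (t : R) x : 0 <= t -> q (t%:C *: x) = t * q x.
Proof.
rewrite le_eqVlt => /predU1P[<-|]; last exact: sublinearZ.
by rewrite scale0r sublinear0// mul0r.
Qed.

Lemma shift_inf_le x (t : R) : 0 <= t ->
  shift_inf q a x <= q (x + t%:C *: a) - t * q a.
Proof.
move=> t0; apply: ge_inf; last by exists t.
(* Lower bound: [u * q a], the value at [u] times [a], is at most [q (x + u%:C *: a) + q (- x)]. *)
exists (- q (- x)) => _ [u /= u0 <-].
have := sq.1 (x + u%:C *: a) (- x).
by rewrite addrAC subrr add0r sublinearZ0//; lra.
Qed.

Lemma le_shift_inf x (m : R) :
  (forall t : R, 0 <= t -> m <= q (x + t%:C *: a) - t * q a) ->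
  m <= shift_inf q a x.
Proof.
move=> h; apply: lb_le_inf.
  by exists (q (x + 0%:C *: a) - 0 * q a); exists 0 => //=.
by move=> _ [t /= t0 <-]; exact: h.
Qed.

Lemma shift_inf_sublinear : sublinear (shift_inf q a).
Proof.
split=> [x y|t x t0].
  rewrite -lerBlDr; apply: le_shift_inf => t t0.
  rewrite lerBlDr -lerBlDl; apply: le_shift_inf => u u0.
  have := @shift_inf_le (x + y) (t + u) (addr_ge0 t0 u0).
  have := sq.1 (x + t%:C *: a) (y + u%:C *: a).
  by rewrite rmorphD scalerDl addrACA; lra.
rewrite -ler_pdivrMl//; apply: le_shift_inf => u u0.
rewrite ler_pdivrMl//.
apply: (le_trans (@shift_inf_le (t%:C *: x) (t * u) _)).
  by rewrite mulr_ge0// ltW.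
rewrite rmorphM -scalerA -scalerDr sublinearZ//; lra.
Qed.

Lemma shift_inf_ub x : shift_inf q a x <= q x.
Proof.
by have := @shift_inf_le x 0 (lexx _); rewrite scale0r addr0; lra.
Qed.

Lemma shift_infN : shift_inf q a (- a) <= - q a.
Proof.
have := @shift_inf_le (- a) 1 ler01.
by rewrite scale1r addNr sublinear0//; lra.
Qed.

End shift_inf.

(** Zorn's lemma for the reversed pointwise order. A nonempty chain is bounded by its pointwise
    infimum, which is finite because every member is at least [- p (- x)] at [x]. *)
Lemma minimal_sublinear p : sublinear p ->
  exists m, [/\ sublinear m, forall x, m x <= p x &
    forall q, sublinear q -> (forall x, q x <= m x) -> q = m].
Proof.
move=> sp.
pose T := {q : V -> R | sublinear q /\ forall x, q x <= p x}.
pose le (q r : T) := `[< forall x, sval r x <= sval q x >].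
have [||||m mmax] := @Zorn T le.
- by move=> q; apply/asboolP.
- move=> q r s /asboolP qr /asboolP rs; apply/asboolP => x.
  exact: le_trans (rs x) (qr x).
- move=> [q sq] [r sr] /asboolP/= qr /asboolP/= rq.
  apply/eq_exist/funext => x; apply/eqP; rewrite eq_le.
  by have := qr x; have := rq x => /= -> ->.
- move=> A Atot; have [A0|/set0P[q0 Aq0]] := eqVneq A set0; last first.
    pose I x := [set sval q x | q in A].
    have lb x : has_lbound (I x).
      exists (- p (- x)) => _ [q Aq <-].
      have [sq qp] := svalP q; have := sublinear_opp x sq; have := qp (- x); lra.
    have ne x : I x !=set0 by exists (sval q0 x), q0.
    pose r x := inf (I x).
    have rle x (q : T) : A q -> r x <= sval q x by move=> Aq; apply: ge_inf => //; exists q.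
    have sr : sublinear r.
      split=> [x y|t x t0].
        rewrite -lerBlDr; apply: lb_le_inf => // _ [q Aq <-].
        rewrite lerBlDr -lerBlDl; apply: lb_le_inf => // _ [s As <-].
        rewrite lerBlDr.
        (* Of the two members used at [x] and at [y], the smaller one is good at both points, and
           its subadditivity concludes. *)
        have [/asboolP qs|/asboolP qs] := Atot q s Aq As.
          apply: (le_trans (rle _ s As)).
          apply: (le_trans ((svalP s).1.1 _ _)); have := qs x; lra.
        apply: (le_trans (rle _ q Aq)).
        apply: (le_trans ((svalP q).1.1 _ _)); have := qs y; lra.
      rewrite -ler_pdivrMl//; apply: lb_le_inf => // _ [q Aq <-].
      rewrite ler_pdivrMl//; apply: (le_trans (rle _ q Aq)).
      exact: (svalP q).1.2.
    have rp x : r x <= p x.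
      exact: le_trans (rle _ q0 Aq0) ((svalP q0).2 x).
    exists (exist _ r (conj sr rp)) => q Aq; apply/asboolP => x /=; exact: rle.
  by exists (exist _ p (conj sp (fun x => lexx (p x)))) => q; rewrite A0.
have [sm mp] := svalP m.
exists (sval m); split => // q sq qm.
have qp x : q x <= p x by exact: le_trans (qm x) (mp x).
apply: (congr1 sval (mmax (exist _ q (conj sq qp)) _)).
exact/asboolP.
Qed.

(* A minimal sublinear functional is additive: it coincides with its own
   [shift_inf], hence is odd. *)
Lemma real_hahn_banach p (v0 : V) : sublinear p ->
  exists m : V -> R, [/\ forall x y, m (x + y) = m x + m y,
    forall (t : R) x, m (t%:C *: x) = t * m x,
    forall x, m x <= p x & m v0 = p v0].
Proof.
(* Starting below [shift_inf p v0] rather than [p] gives [m (- v0) <= - p v0], which forces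
   [m v0 = p v0]. *)
move=> sp; have [m [sm mp mmin]] := minimal_sublinear (shift_inf_sublinear sp v0).
have mN x : m (- x) = - m x.
  have mE : shift_inf m x = m.
    by apply: mmin; [exact: shift_inf_sublinear|move=> y; exact: shift_inf_ub].
  have := shift_infN sm x; rewrite mE; have := sublinear_opp x sm; lra.
have mD x y : m (x + y) = m x + m y.
  have := sm.1 x y; have := sm.1 (- x) (- y); rewrite -opprD !mN; lra.
exists m; split=> // [t x|x|].
- have [t0|t0|->] := ltgtP t 0; last by rewrite scale0r sublinear0// mul0r.
    rewrite -[t]opprK rmorphN scaleNr mN sublinearZ ?oppr_gt0//; lra.
  exact: sublinearZ.
- by apply: le_trans (mp x) _; exact: shift_inf_ub.
- apply/eqP; rewrite eq_le (le_trans (mp v0) (shift_inf_ub sp _ _))/=.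
  have := mp (- v0); have := shift_infN sp v0; rewrite mN; lra.
Qed.

Lemma hahn_banach p (v0 : V) :
  (forall x y, p (x + y) <= p x + p y) ->
  (forall c x, p (c *: x) = normc c * p x) ->
  exists f : V -> R[i], [/\ forall (c : R[i]) x y, f (c *: x + y) = c * f x + f y,
    forall x, normc (f x) <= p x & p v0 <= normc (f v0)].
Proof.
move=> pD pZ.
have sp : sublinear p by split=> // t x t0; rewrite pZ normcR_ge0// ltW.
have [m [mD mZ mp m0]] := real_hahn_banach v0 sp.
(* The only complex-linear functional with real part [m]. *)
pose f x := (m x) +i* (- m ('i%C *: x)).
have fD x y : f (x + y) = f x + f y.
  by rewrite /f scalerDr !mD opprD.
have fZ c x : f (c *: x) = c * f x.
  case: c => a b; rewrite /f.
  have -> : (a +i* b) *: x = a%:C *: x + b%:C *: ('i%C *: x).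
    by rewrite scalerA -scalerDl; congr (_ *: _); simpc.
  have -> : 'i%C *: (a%:C *: x + b%:C *: ('i%C *: x)) =
      a%:C *: ('i%C *: x) + (- b)%:C *: x.
    by rewrite scalerDr !scalerA; congr (_ *: _ + _ *: _); simpc; rewrite ?mulr0 ?mul0r ?oppr0.
  by rewrite !mD !mZ; simpc; congr (_ +i* _); ring.
have nfp x : normc (f x) <= p x.
  (* After the rotation the value is real, so [normc (f x)] is [m (c *: x)], at most
     [p (c *: x) = p x]. *)
  have [c c1 cfx] := normc_rotate (f x).
  by have := mp (c *: x); rewrite pZ c1 mul1r -[m _]/(complex.Re (f (c *: x))) fZ cfx.
exists f; split => // [c x y|]; first by rewrite fD fZ.
rewrite -m0; apply: (le_trans _ (_ : `|m v0| <= _)); first exact: ler_norm.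
by rewrite -[leLHS]sqrtr_sqr /= ler_sqrt ?addr_ge0 ?sqr_ge0// lerDl sqr_ge0.
Qed.

End hahn_banach.

(** * The two-ball property of M-ideals *)

Section two_ball.
Context {R : realType} {X : normedModType R[i]}.
Implicit Types (x y z : X) (C : set X).

(** The norm of a module over [R[i]] takes its values in [R[i]]; this is the same number in [R]. *)
Definition rnorm x : R := complex.Re `|x|.

Lemma rnormE x : `|x| = (rnorm x)%:C.
Proof. by rewrite /rnorm; have := normr_ge0 x; rewrite lecE => /andP[/eqP]; case: `|x| => a b /= ->. Qed.

Lemma rnorm_ge0 x : 0 <= rnorm x.
Proof. by rewrite -lecR -rnormE normr_ge0. Qed.

Lemma rnormD x y : rnorm (x + y) <= rnorm x + rnorm y.
Proof. by rewrite -lecR real_complexD -!rnormE ler_normD. Qed.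

Lemma rnormZ (c : R[i]) x : rnorm (c *: x) = normc c * rnorm x.
Proof. by apply: complexI; rewrite real_complexM -normcEC -!rnormE normrZ. Qed.

Lemma rnorm0 : rnorm 0 = 0.
Proof. by rewrite /rnorm normr0. Qed.

Lemma bounded_functionalP (f : X -> R[i]^o) (M : R) :
  (forall (c : R[i]) x y, f (c *: x + y) = c * f x + f y) ->
  (forall x, normc (f x) <= M * rnorm x) -> f \in @bounded_functional R X.
Proof.
move=> flin fM; apply/asboolP; split => // x.
have fB y : f x - f y = f (x - y).
  by rewrite [x - y]addrC -(scaleN1r y) flin mulN1r addrC.
apply/cvgrPdist_lt => e e0.
have M0 : 0 < ((`|M| + 1)%:C : R[i]) by rewrite ltcR ltr_wpDl.
near=> y; rewrite fB.
apply: (@le_lt_trans _ _ ((`|M| + 1)%:C * `|x - y|)).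
  rewrite rnormE -rmorphM normcEC lecR (le_trans (fM _))// ler_wpM2r ?rnorm_ge0//.
  by rewrite (le_trans (ler_norm _))// lerDl.
rewrite -ltr_pdivlMl//; near: y.
by apply: cvgr_dist_lt; [exact: cvg_id|rewrite mulr_gt0 ?invr_gt0].
Unshelve. all: by end_near. Qed.

(** The quotient seminorm of [X * X], with the maximum norm, by the diagonal copy of [C]. *)
Definition diag_dist C (v : X * X) : R :=
  inf [set Num.max (rnorm (v.1 - z)) (rnorm (v.2 - z)) | z in C].

Section diag_dist.
Variables (C : set X) (hC : closed_subspace C).

Let C0 : C 0. Proof. by case: hC => _ []. Qed.
Let CZD (a : R[i]) x y : C x -> C y -> C (a *: x + y).
Proof. by case: hC => _ [_]; exact. Qed.

Let has_lb v :
  has_lbound [set Num.max (rnorm (v.1 - z)) (rnorm (v.2 - z)) | z in C].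
Proof. by exists 0 => _ [z _ <-]; rewrite le_max rnorm_ge0. Qed.

Let ne (v : X * X) :
  [set Num.max (rnorm (v.1 - z)) (rnorm (v.2 - z)) | z in C] !=set0.
Proof. by exists (Num.max (rnorm (v.1 - 0)) (rnorm (v.2 - 0))), 0. Qed.

Lemma diag_dist_le v z : C z ->
  diag_dist C v <= Num.max (rnorm (v.1 - z)) (rnorm (v.2 - z)).
Proof. by move=> Cz; apply: ge_inf; [exact: has_lb|exists z]. Qed.

Lemma diag_dist_ge0 v : 0 <= diag_dist C v.
Proof.
by apply: lb_le_inf => [|_ [z _ <-]]; [exact: ne|rewrite le_max rnorm_ge0].
Qed.

Lemma diag_distD v w : diag_dist C (v + w) <= diag_dist C v + diag_dist C w.
Proof.
rewrite -lerBlDr; apply: lb_le_inf => [|_ [y Cy <-]]; first exact: ne.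
rewrite lerBlDr -lerBlDl; apply: lb_le_inf => [|_ [z Cz <-]]; first exact: ne.
rewrite lerBlDl; have Cyz : C (y + z) by rewrite -[y]scale1r; exact: CZD.
apply: (le_trans (diag_dist_le _ Cyz)).
rewrite ge_max; apply/andP; split.
  have -> : (v + w).1 - (y + z) = (v.1 - y) + (w.1 - z) by rewrite opprD addrACA.
  by apply: (le_trans (rnormD _ _)); apply: lerD; rewrite le_max lexx.
have -> : (v + w).2 - (y + z) = (v.2 - y) + (w.2 - z) by rewrite opprD addrACA.
by apply: (le_trans (rnormD _ _)); apply: lerD; rewrite le_max lexx orbT.
Qed.

Lemma diag_distZ (c : R[i]) v : diag_dist C (c *: v) = normc c * diag_dist C v.
Proof.
have le (b : R[i]) w : b != 0 -> diag_dist C (b *: w) <= normc b * diag_dist C w.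
  move=> b0; have nb0 : 0 < normc b by rewrite -ltcR -normcEC normr_gt0.
  rewrite -ler_pdivrMl//; apply: lb_le_inf => [|_ [z Cz <-]]; first exact: ne.
  have Cbz : C (b *: z) by rewrite -[_ *: z]addr0; exact: CZD.
  rewrite ler_pdivrMl// (le_trans (diag_dist_le _ Cbz))//=.
  by rewrite -!scalerBr !rnormZ ge_max !ler_pM2l// !le_max !lexx orbT.
have [->|c0] := eqVneq c 0.
  rewrite scale0r normc0 mul0r; apply/eqP; rewrite eq_le diag_dist_ge0 andbT.
  by have := diag_dist_le 0 C0; rewrite /= !subr0 !rnorm0 maxxx.
apply/eqP; rewrite eq_le le//=.
have nc0 : 0 < normc c by rewrite -ltcR -normcEC normr_gt0.
rewrite -ler_pdivlMl// -normcV.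
by rewrite -[in leLHS](scale1r v) -(mulVf c0) -scalerA le// invr_eq0.
Qed.

End diag_dist.

(** A functional [f] with components [f1], [f2] norms [(x + y, x - y)] for [diag_dist]. Since it
    vanishes on the diagonal copy of [C], [f1 + f2] is in the range of [P], so [x] is seen only by
    [P f1 + P f2]; since [y] is in [C], it is seen only by [f1 - P f1] and [f2 - P f2]. The norms of
    these four parts add up to those of [f1] and [f2], whose sum is at most 1. Hence the distance is
    at most 1. *)
Lemma M_ideal_two_ball C x y (e : R) : M_ideal C -> C y ->
  rnorm x <= 1 -> rnorm y <= 1 -> 0 < e ->
  exists2 z, C z & rnorm (x + y - z) <= 1 + e /\ rnorm (x - y - z) <= 1 + e.
Proof.
move=> [hC [P [_ PP rP PL]]] Cy x1 y1 e0.
have [f [flin fp fv0]] := hahn_banach (x + y, x - y) (diag_distD hC) (diag_distZ hC).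
have C0 : C 0 by case: hC => _ [].
have f00 : f (0, 0) = 0.
  by apply: eq0_normc; apply/eqP; rewrite eq_le normc_ge0 (le_trans (fp _))//
    (le_trans (diag_dist_le _ C0))//= !subr0 !rnorm0 maxxx.
pose g1 x := f (x, 0); pose g2 x := f (0, x).
have g1lin (c : R[i]) u v : g1 (c *: u + v) = c * g1 u + g1 v.
  by rewrite /g1 -flin; congr f; congr pair; rewrite /= scaler0 addr0.
have g2lin (c : R[i]) u v : g2 (c *: u + v) = c * g2 u + g2 v.
  by rewrite /g2 -flin; congr f; congr pair; rewrite /= scaler0 addr0.
have fE u v : f (u, v) = g1 u + g2 v.
  by rewrite -[g1 u]mul1r -flin scale1r; congr f; congr pair; rewrite /= ?add0r ?addr0.
have g1M u : normc (g1 u) <= 1 * rnorm u.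
  rewrite mul1r (le_trans (fp _))// (le_trans (diag_dist_le _ C0))//=.
  by rewrite !subr0 rnorm0 ge_max lexx rnorm_ge0.
have g2M u : normc (g2 u) <= 1 * rnorm u.
  rewrite mul1r (le_trans (fp _))// (le_trans (diag_dist_le _ C0))//=.
  by rewrite !subr0 rnorm0 ge_max lexx rnorm_ge0.
pose f1 : dual X := Dual (bounded_functionalP g1lin g1M).
pose f2 : dual X := Dual (bounded_functionalP g2lin g2M).
(* The dual of the maximum norm is the sum of the norms: rotating [u] and [v] makes both values
   nonnegative. *)
have f12 u v : `|u| <= 1 -> `|v| <= 1 -> normc (f1 u) + normc (f2 v) <= 1.
  move=> u1 v1.
  have [a a1 au] := normc_rotate (g1 u); have [b b1 bv] := normc_rotate (g2 v).
  have -> : normc (f1 u) + normc (f2 v) = normc (f (a *: u, b *: v)).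
    rewrite fE -[a *: u]addr0 -[b *: v]addr0 g1lin g2lin au bv.
    by rewrite /g1 /g2 f00 !addr0 -rmorphD normcR_ge0// addr_ge0// normc_ge0.
  rewrite (le_trans (fp _))// (le_trans (diag_dist_le _ C0))//= !subr0 !rnormZ.
  by rewrite a1 b1 !mul1r ge_max -!lecR -!rnormE u1.
have df12 : dual_norm f1 + dual_norm f2 <= 1.
  rewrite -lerBrDl; apply: dual_norm_le => v v1; rewrite lerBrDl -lerBrDr.
  by apply: dual_norm_le => u u1; rewrite lerBrDr; exact: f12.
have ann : annihilator C (f1 + f2).
  move=> z Cz; have -> : (f1 + f2) z = f (z, z) by rewrite fE.
  apply: eq0_normc; apply/eqP; rewrite eq_le normc_ge0 (le_trans (fp _))//.
  by rewrite (le_trans (diag_dist_le _ Cz))//= !subrr !rnorm0 maxxx.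
have Pann g : annihilator C (P g) by rewrite -rP; exists g.
have Pf : P f1 + P f2 = f1 + f2.
  by move: ann; rewrite -rP -linearD => -[g _ <-]; rewrite PP.
have PL' g : dual_norm (P g) + dual_norm (g - P g) = dual_norm g.
  by apply: complexI; rewrite real_complexD; exact: PL.
have val : f (x + y, x - y) = (P f1) x + (P f2) x + (f1 - P f1) y - (f2 - P f2) y.
  have -> : P f1 x + P f2 x = g1 x + g2 x by rewrite -[LHS]/((P f1 + P f2) x) Pf.
  have -> : (f1 - P f1) y = g1 y - P f1 y by [].
  have -> : (f2 - P f2) y = g2 y - P f2 y by [].
  rewrite fE !Pann// -[x in g1 (x + y)]scale1r g1lin -scaleN1r addrC.
  by rewrite [in g2 _]addrC g2lin; ring.
have v1 : normc (f (x + y, x - y)) <= 1.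
  have ub (h : dual X) u : rnorm u <= 1 -> normc (h u) <= dual_norm h.
    by move=> u1; apply: dual_norm_ub; rewrite rnormE lecR.
  apply: le_trans df12; rewrite val -(PL' f1) -(PL' f2).
  apply: (le_trans (le_normcD _ _)); rewrite normcN.
  have h := le_normcD (P f1 x + P f2 x) ((f1 - P f1) y).
  have h' := le_normcD (P f1 x) (P f2 x).
  have := ub (P f1) x x1; have := ub (P f2) x x1.
  have := ub (f1 - P f1) y y1; have := ub (f2 - P f2) y y1.
  lra.
have := le_trans fv0 v1 => p1.
have lt1e : diag_dist C (x + y, x - y) < 1 + e by lra.
have /inf_lt : [set Num.max (rnorm ((x + y, x - y).1 - z)) (rnorm ((x + y, x - y).2 - z)) | z in C] !=set0.
  by exists (Num.max (rnorm (x + y - 0)) (rnorm (x - y - 0))), 0.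
move=> /(_ _ lt1e)[_ [z Cz <-]]; rewrite gt_max => /andP[/ltW z1 /ltW z2].
by exists z.
Qed.

End two_ball.

(** * Integrals over real segments *)

Section interval_integral.
Context {R : realType}.
Notation mu := (@lebesgue_measure R).
Implicit Types (f g : R -> R) (a b c k e : R).

Definition seg f a b : R := \int[mu]_(x in `[a, b]) f x.

Lemma eq_seg f g a b : (forall x, f x = g x) -> seg f a b = seg g a b.
Proof. by move=> /funext ->. Qed.

Definition seg_integrable f a b := mu.-integrable `[a, b] (EFin \o f).

Lemma seg_integrable_continuous f a b :
  (forall x, a <= x <= b -> forall e, 0 < e -> exists2 d, 0 < d &
    forall y, a <= y <= b -> `|y - x| < d -> `|f y - f x| <= e) ->
  seg_integrable f a b.
Proof.
move=> cf; apply: continuous_compact_integrable; first exact: segment_compact.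
apply/subspace_continuousP => x /=; rewrite in_itv/= => xab.
apply/cvgrPdist_le => e e0; have [d d0 fd] := cf x xab e e0.
rewrite near_withinE; near=> y => yab.
rewrite distrC; apply: fd; first by move: yab; rewrite /= in_itv.
by rewrite distrC; near: y; apply: cvgr_dist_lt => //; exact: cvg_id.
Unshelve. all: by end_near. Qed.

Lemma seg_integrableS f a b c d : seg_integrable f a b -> a <= c -> d <= b ->
  seg_integrable f c d.
Proof.
move=> fi ac db; apply: integrableS fi => //.
by apply: subset_itvScc.
Qed.

Lemma segD f a b c : seg_integrable f a b -> a <= c -> c <= b ->
  seg f a b = seg f a c + seg f c b.
Proof.
move=> fi ac cb; have := Rintegral_itvB (x := c) fi; rewrite !bnd_simp => /(_ ac cb).
rewrite Rintegral_itv_obnd_cbnd; first by rewrite /seg => <-; rewrite addrC subrK.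
by apply: integrableS fi => //; apply: subset_itv; rewrite bnd_simp.
Qed.

Lemma seg_cst k a b : a <= b -> seg (cst k) a b = k * (b - a).
Proof.
move=> ab; rewrite /seg Rintegral_cst//; congr (_ * _).
rewrite [X in fine X]lebesgue_measure_itv/= lte_fin.
by case: ltgtP ab => // -> _; rewrite subrr.
Qed.

Lemma segB f g a b : seg_integrable f a b -> seg_integrable g a b ->
  seg (fun x => f x - g x) a b = seg f a b - seg g a b.
Proof. by move=> fi gi; rewrite /seg RintegralB. Qed.

Lemma seg_near_cst f a b k e : a <= b -> seg_integrable f a b ->
  (forall x, a <= x <= b -> `|f x - k| <= e) ->
  `|seg f a b - k * (b - a)| <= e * (b - a).
Proof.
move=> ab fi fk.
have ki : forall k', seg_integrable (cst k') a b.
  by move=> k'; apply: seg_integrable_continuous => x _ e0 e00; exists 1 => // *; rewrite /= subrr normr0 ltW.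
rewrite -!seg_cst// -segB//.
have di : seg_integrable (fun x => f x - cst k x) a b.
  by apply: (integrableB _ fi (ki k)); exact: measurable_itv.
rewrite (le_trans (le_normr_Rintegral _ _))//.
by apply: le_Rintegral => //; [exact: integrable_norm|exact: ki].
Qed.

End interval_integral.

(** * Goursat's bisection for closed forms on a rectangle *)

Section closed_form.
Context {R : realType}.

(* The common length bound makes the intervals [x_n, x_n + h_n] nested. *)
Lemma nested_intervals (x h : nat -> R) :
  (forall n, 0 <= h n) -> (forall n, x n <= x n.+1) ->
  (forall n, x n.+1 + h n.+1 <= x n + h n) ->
  exists l, forall n, x n <= l <= x n + h n.
Proof.
move=> h0 xn hn.
have xm m n : (m <= n)%N -> x m <= x n.
  by move=> mn; apply: (homo_leq (r := fun a b => a <= b) lexx le_trans xn).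
have hm m n : (m <= n)%N -> x n + h n <= x m + h m.
  by move=> mn; apply: (homo_leq (f := fun n => x n + h n) (r := fun a b => b <= a) lexx (fun _ _ _ ab ba => le_trans ba ab) hn).
have xh m n : x m <= x n + h n.
  have [mn|nm] := leqP m n; first by rewrite (le_trans (xm _ _ mn))// lerDl.
  by rewrite (le_trans _ (hm _ _ (ltnW nm)))// lerDl.
exists (sup (range x)) => n; apply/andP; split.
  by apply: sup_upper_bound; [split; [exists (x 0), 0|exists (x 0 + h 0) => _ [m _ <-]]|exists n].
by apply: ge_sup; [exists (x 0), 0|move=> _ [m _ <-]].
Qed.

Variables (P Q : R -> R -> R) (x0 x1 t0 t1 : R).
Hypothesis (x01 : x0 <= x1) (t01 : t0 <= t1).

(* [P dx + Q dt] is closed in the weak sense: [P] and [Q] are differentiable on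
   the rectangle, with the same coefficient [b] for dP/dt and dQ/dx, but their
   partial derivatives need not be continuous. *)
Definition closed_form := forall x t, x0 <= x <= x1 -> t0 <= t <= t1 ->
  exists a b c, forall e, 0 < e -> exists2 d, 0 < d &
  forall x' t', x0 <= x' <= x1 -> t0 <= t' <= t1 ->
    `|x' - x| < d -> `|t' - t| < d ->
    `|P x' t' - P x t - (a * (x' - x) + b * (t' - t))|
      <= e * (`|x' - x| + `|t' - t|) /\
    `|Q x' t' - Q x t - (b * (x' - x) + c * (t' - t))|
      <= e * (`|x' - x| + `|t' - t|).

Hypothesis closedPQ : closed_form.

Let lin_cvg (F : R -> R -> R) x t a b d y u :
  0 < d -> `|F y u - F x t - (a * (y - x) + b * (u - t))| <=
    1 * (`|y - x| + `|u - t|) ->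
  `|y - x| < d -> `|u - t| < d ->
  `|F y u - F x t| <= d * (2 + `|a| + `|b|).
Proof.
move=> d0 F1 yx ut.
have -> : F y u - F x t = (F y u - F x t - (a * (y - x) + b * (u - t))) +
   (a * (y - x) + b * (u - t)) by rewrite subrK.
apply: (le_trans (ler_normD _ _)).
have h1 : `|a * (y - x) + b * (u - t)| <= `|a| * d + `|b| * d.
  apply: (le_trans (ler_normD _ _)); rewrite !normrM.
  by apply: lerD; apply: ler_wpM2l => //; exact: ltW.
lra.
Qed.

Let ctsPQ x t e : x0 <= x <= x1 -> t0 <= t <= t1 -> 0 < e -> exists2 d, 0 < d &
  forall x' t', x0 <= x' <= x1 -> t0 <= t' <= t1 ->
    `|x' - x| < d -> `|t' - t| < d ->
    `|P x' t' - P x t| <= e /\ `|Q x' t' - Q x t| <= e.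
Proof.
move=> xI tI e0; have [a [b [c /(_ 1 ltr01)[d d0 h]]]] := closedPQ xI tI.
pose C := 2 + `|a| + `|b| + `|c|.
have C0 : 0 < C by rewrite /C; have := normr_ge0 a; have := normr_ge0 b; have := normr_ge0 c; lra.
pose d' := Num.min d (e / C).
have d'0 : 0 < d' by rewrite lt_min d0 divr_gt0.
have d'd : d' <= d by rewrite ge_min lexx.
have d'e : d' * C <= e by rewrite -ler_pdivlMr// ge_min lexx orbT.
exists d' => // x' t' x'I t'I xx tt.
have [hP hQ] : _ /\ _ := h x' t' x'I t'I (lt_le_trans xx d'd) (lt_le_trans tt d'd).
have := lin_cvg d'0 hP xx tt; have := lin_cvg d'0 hQ xx tt.
have : 0 <= d' * `|a| by rewrite mulr_ge0// ltW.
have : 0 <= d' * `|c| by rewrite mulr_ge0// ltW.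
move: d'e; rewrite /C; split; lra.
Qed.

Let intP t : t0 <= t <= t1 -> seg_integrable (P ^~ t) x0 x1.
Proof.
move=> tI; apply: seg_integrable_continuous => x xI e e0.
have [d d0 h] := ctsPQ xI tI e0; exists d => // y yI yx.
by have [] := h y t yI tI yx; rewrite ?subrr ?normr0.
Qed.

Let intQ x : x0 <= x <= x1 -> seg_integrable (Q x) t0 t1.
Proof.
move=> xI; apply: seg_integrable_continuous => t tI e e0.
have [d d0 h] := ctsPQ xI tI e0; exists d => // u uI ut.
by have [] := h x u xI uI _ ut; rewrite ?subrr ?normr0.
Qed.

(** The integral of [P dx + Q dt] counterclockwise around the rectangle with sides [[x, y]] and
    [[t, u]]. *)
Let bdry x y t u : R := seg (Q y) t u - seg (Q x) t u -
  (seg (P ^~ u) x y - seg (P ^~ t) x y).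

Let bdryDx x m y t u : x0 <= x -> x <= m -> m <= y -> y <= x1 ->
  t0 <= t -> t <= u -> u <= t1 -> bdry x y t u = bdry x m t u + bdry m y t u.
Proof.
move=> xx xm my yx tt tu ut; rewrite /bdry.
have iu : seg_integrable (P ^~ u) x y.
  by apply: seg_integrableS (intP _) xx yx; rewrite ut (le_trans tt).
have it : seg_integrable (P ^~ t) x y.
  by apply: seg_integrableS (intP _) xx yx; rewrite tt (le_trans tu).
by rewrite (segD iu xm my) (segD it xm my); ring.
Qed.

Let bdryDt x y t m u : x0 <= x -> x <= y -> y <= x1 ->
  t0 <= t -> t <= m -> m <= u -> u <= t1 -> bdry x y t u = bdry x y t m + bdry x y m u.
Proof.
move=> xx xy yx tt tm mu ut; rewrite /bdry.
have iy : seg_integrable (Q y) t u.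
  by apply: seg_integrableS (intQ _) tt ut; rewrite yx (le_trans xx).
have ix : seg_integrable (Q x) t u.
  by apply: seg_integrableS (intQ _) tt ut; rewrite xx (le_trans xy).
by rewrite (segD iy tm mu) (segD ix tm mu); ring.
Qed.

Let H := x1 - x0.
Let K := t1 - t0.
Let h n := H / 2 ^+ n.
Let k n := K / 2 ^+ n.

Let h_ge0 n : 0 <= h n. Proof. by rewrite divr_ge0 ?exprn_ge0 ?subr_ge0. Qed.
Let k_ge0 n : 0 <= k n. Proof. by rewrite divr_ge0 ?exprn_ge0 ?subr_ge0. Qed.
Let hS n : h n = h n.+1 + h n.+1.
Proof. by rewrite /h exprS; field; rewrite expf_neq0. Qed.
Let kS n : k n = k n.+1 + k n.+1.
Proof. by rewrite /k exprS; field; rewrite expf_neq0. Qed.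

Let large (E : R) n (p : R * R) := [/\ x0 <= p.1, p.1 + h n <= x1,
  t0 <= p.2, p.2 + k n <= t1 &
  E / 4 ^+ n <= `|bdry p.1 (p.1 + h n) p.2 (p.2 + k n)|].

(** The boundary integral is additive over the four quarters, so one of them carries at least a
    quarter of its modulus. *)
Let large_step E n p : large E n p ->
  exists p', [/\ large E n.+1 p', p.1 <= p'.1, p'.1 + h n.+1 <= p.1 + h n,
    p.2 <= p'.2 & p'.2 + k n.+1 <= p.2 + k n].
Proof.
case: p => x t [/= xx hx tt kt].
have := h_ge0 n.+1; have := k_ge0 n.+1; rewrite (hS n) (kS n) in hx kt *.
rewrite -[E / 4 ^+ n](_ : 4 * (E / 4 ^+ n.+1) = _); last first.
  by rewrite exprS; field; rewrite expf_neq0.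
move EE : (E / 4 ^+ n.+1) => E'.
move hhE : (h n.+1) hx => hh hx; move kkE : (k n.+1) kt => kk kt k0 h0.
rewrite (bdryDx (m := x + hh)); [|lra..].
rewrite (bdryDt (m := t + kk)); [|lra..].
rewrite [in X in _ + X](bdryDt (m := t + kk)); [|lra..].
move=> hE.
have : E' <= `|bdry x (x + hh) t (t + kk)| \/
       E' <= `|bdry x (x + hh) (t + kk) (t + (kk + kk))| \/
       E' <= `|bdry (x + hh) (x + (hh + hh)) t (t + kk)| \/
       E' <= `|bdry (x + hh) (x + (hh + hh)) (t + kk) (t + (kk + kk))|.
  apply: contrapT => /not_orP[/negP + /not_orP[/negP + /not_orP[/negP + /negP]]].
  rewrite -!ltNge => l1 l2 l3 l4.
  move: hE; apply/negP; rewrite -ltNge.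
  apply: (le_lt_trans (ler_normD _ _)).
  have := ler_normD (bdry x (x + hh) t (t + kk)) (bdry x (x + hh) (t + kk) (t + (kk + kk))).
  have := ler_normD (bdry (x + hh) (x + (hh + hh)) t (t + kk)) (bdry (x + hh) (x + (hh + hh)) (t + kk) (t + (kk + kk))).
  lra.
case=> [|[|[|]]] hE'; [exists (x, t)|exists (x, t + kk)|exists (x + hh, t)|exists (x + hh, t + kk)];
  rewrite /large /= hhE kkE; split=> /=; (lra || (split; try lra; rewrite EE; by rewrite -?[_ + hh + hh]addrA -?[_ + kk + kk]addrA)).
Qed.

(** The nested rectangles shrink to a point. There the linear parts of [P] and [Q] contribute
    nothing, because their mixed coefficients agree, and the remainders contribute [o(4^-n)], which
    is incompatible with the lower bound [E / 4 ^+ n]. *)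
Lemma closed_form_boundary : bdry x0 x1 t0 t1 = 0.
Proof.
apply/eqP; rewrite -normr_le0 leNgt; apply/negP => E0.
set E := `|_| in E0.
have L0 : large E 0 (x0, t0).
  rewrite /large /h /k expr0 !divr1 /= /H /K !(addrC x0) !(addrC t0) !subrK.
  by split.
(* The depth [n] is stored with the corner, so that dependent choice runs inside a single type. *)
have [f [f0 fS]] : exists f : nat -> {np : nat * (R * R) | large E np.1 np.2},
    sval (f 0) = (0%N, (x0, t0)) /\ forall n, let p := sval (f n) in
      let p' := sval (f n.+1) in [/\ p'.1 = p.1.+1, p.2.1 <= p'.2.1,
      p'.2.1 + h p'.1 <= p.2.1 + h p.1, p.2.2 <= p'.2.2 &
      p'.2.2 + k p'.1 <= p.2.2 + k p.1].
  have := @dependent_choice {np : nat * (R * R) | large E np.1 np.2} (fun q q' =>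
     let p := sval q in let p' := sval q' in [/\ p'.1 = p.1.+1, p.2.1 <= p'.2.1,
      p'.2.1 + h p'.1 <= p.2.1 + h p.1, p.2.2 <= p'.2.2 &
      p'.2.2 + k p'.1 <= p.2.2 + k p.1]).
  move=> /(_ _ (exist _ (0%N, (x0, t0)) L0))[|f [f0 fS]]; last by exists f; rewrite f0.
  move=> [[n p] /= Lp]; apply: cid; have [p' [Lp' p1 p2 p3 p4]] := large_step Lp.
  by exists (exist _ (n.+1, p') Lp').
have fn n : (sval (f n)).1 = n.
  by elim: n => [|n IH]; [rewrite f0|have [-> _ _ _ _] := fS n; rewrite IH].
pose X n := (sval (f n)).2.1; pose T n := (sval (f n)).2.2.
have L n : large E n (X n, T n).
  by have := svalP (f n); rewrite fn -surjective_pairing.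
have [x xP] : exists x, forall n, X n <= x <= X n + h n.
  by apply: nested_intervals => // n; have [_] := fS n; rewrite !fn.
have [t tP] : exists t, forall n, T n <= t <= T n + k n.
  by apply: nested_intervals => // n; have [_] := fS n; rewrite !fn.
have H0 : 0 <= H by rewrite subr_ge0.
have K0 : 0 <= K by rewrite subr_ge0.
have xI : x0 <= x <= x1.
  by have [/= a1 a2 _ _ _] := L 0; have /andP[b1 b2] := xP 0; rewrite (le_trans a1)// (le_trans b2).
have tI : t0 <= t <= t1.
  by have [/= _ _ a1 a2 _] := L 0; have /andP[b1 b2] := tP 0; rewrite (le_trans a1)// (le_trans b2).
(* The final estimate is [E <= 2 * e * (H + K) ^+ 2]; the right-hand side is [e * (D - 1)], which is
   less than [e * D = E / 2]. *)
pose D := 2 * (H + K) ^+ 2 + 1.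
have D0 : 0 < D by rewrite ltr_wpDl// mulr_ge0// sqr_ge0.
pose e := E / (2 * D).
have e0 : 0 < e by rewrite divr_gt0// mulr_gt0.
have [a [b [c /(_ e e0)[d d0 hd]]]] := closedPQ xI tI.
have hk0' : 0 <= H + K by rewrite addr_ge0// subr_ge0.
have dk0 : 0 < d / (H + K + 1) by rewrite divr_gt0// ltr_wpDl.
have [n] : exists n, 1 / 2 ^+ n < d / (H + K + 1).
  by have [n _ hn] := near_infty_natSinv_expn_lt (PosNum dk0); exists n; exact: (hn n (leqnn n)).
rewrite ltr_pdivlMr ?ltr_wpDl// => n1.
have pn0 : 0 < 1 / 2 ^+ n :> R by rewrite divr_gt0// exprn_gt0.
have hd1 : h n < d.
  apply: le_lt_trans n1; rewrite /h mulrC mul1r ler_pM2l ?invr_gt0 ?exprn_gt0//.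
  by have := K0; lra.
have kd1 : k n < d.
  apply: le_lt_trans n1; rewrite /k mulrC mul1r ler_pM2l ?invr_gt0 ?exprn_gt0//.
  by have := H0; lra.
have [/= a1 a2 a3 a4 hE] := L n.
have /andP[xl xr] := xP n; have /andP[tl tr] := tP n.
have hn0 := h_ge0 n; have kn0 := k_ge0 n.
have dx y : X n <= y <= X n + h n -> `|y - x| <= h n.
  by move=> /andP[y1 y2]; rewrite ler_norml; clear -xl xr tl tr y1 y2; lra.
have dt y : T n <= y <= T n + k n -> `|y - t| <= k n.
  by move=> /andP[y1 y2]; rewrite ler_norml; clear -xl xr tl tr y1 y2; lra.
have iQ y : x0 <= y <= x1 -> seg_integrable (Q y) (T n) (T n + k n).
  by move=> yI; apply: seg_integrableS (intQ yI) _ _.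
have iP y : t0 <= y <= t1 -> seg_integrable (P ^~ y) (X n) (X n + h n).
  by move=> yI; apply: seg_integrableS (intP yI) _ _.
have hX : X n <= X n + h n by rewrite lerDl.
have hT : T n <= T n + k n by rewrite lerDl.
have XI0 : x0 <= X n <= x1 by rewrite a1 (le_trans hX).
have XI1 : x0 <= X n + h n <= x1 by rewrite (le_trans a1 hX).
have TI0 : t0 <= T n <= t1 by rewrite a3 (le_trans hT).
have TI1 : t0 <= T n + k n <= t1 by rewrite (le_trans a3 hT).
have dX0 : `|X n - x| <= h n by apply: dx; rewrite lexx.
have dX1 : `|X n + h n - x| <= h n by apply: dx; rewrite lexx hX.
have dT0 : `|T n - t| <= k n by apply: dt; rewrite lexx.
have dT1 : `|T n + k n - t| <= k n by apply: dt; rewrite lexx hT.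
(* Each opposite pair of sides is compared with the linearisation at [(x, t)], with error
   [e * (h n + k n)] per side. The main terms of [est1] and [est2] are both [b * h n * k n] and
   cancel. *)
pose eta := e * (h n + k n) *+ 2.
have est1 : `|seg (fun s => Q (X n + h n) s - Q (X n) s) (T n) (T n + k n)
    - b * h n * k n| <= eta * k n.
  have := @seg_near_cst R (fun s => Q (X n + h n) s - Q (X n) s) (T n) (T n + k n) (b * h n) eta.
  rewrite [T n + k n - T n]addrC addKr; apply; first by rewrite lerDl.
    apply: (integrableB _ (iQ _ XI1) (iQ _ XI0)); exact: measurable_itv.
  move=> s sI; have sI' : t0 <= s <= t1.
    by have /andP[s1 s2] := sI; rewrite (le_trans a3 s1) (le_trans s2).
  have [_ q1] := hd (X n + h n) s XI1 sI' (le_lt_trans dX1 hd1) (le_lt_trans (dt _ sI) kd1).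
  have [_ q2] := hd (X n) s XI0 sI' (le_lt_trans dX0 hd1) (le_lt_trans (dt _ sI) kd1).
  have -> : Q (X n + h n) s - Q (X n) s - b * h n =
    (Q (X n + h n) s - Q x t - (b * (X n + h n - x) + c * (s - t))) -
    (Q (X n) s - Q x t - (b * (X n - x) + c * (s - t))) by ring.
  apply: (le_trans (ler_normB _ _)); rewrite /eta mulr2n; apply: lerD.
    apply: (le_trans q1); rewrite ler_pM2l//; apply: lerD; [by []|exact: dt].
  apply: (le_trans q2); rewrite ler_pM2l//; apply: lerD; [by []|exact: dt].
have est2 : `|seg (fun s => P s (T n + k n) - P s (T n)) (X n) (X n + h n)
    - b * k n * h n| <= eta * h n.
  have := @seg_near_cst R (fun s => P s (T n + k n) - P s (T n)) (X n) (X n + h n) (b * k n) eta.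
  rewrite [X n + h n - X n]addrC addKr; apply; first by rewrite lerDl.
    apply: (integrableB _ (iP _ TI1) (iP _ TI0)); exact: measurable_itv.
  move=> s sI; have sI' : x0 <= s <= x1.
    by have /andP[s1 s2] := sI; rewrite (le_trans a1 s1) (le_trans s2).
  have [p1 _] := hd s (T n + k n) sI' TI1 (le_lt_trans (dx _ sI) hd1) (le_lt_trans dT1 kd1).
  have [p2 _] := hd s (T n) sI' TI0 (le_lt_trans (dx _ sI) hd1) (le_lt_trans dT0 kd1).
  have -> : P s (T n + k n) - P s (T n) - b * k n =
    (P s (T n + k n) - P x t - (a * (s - x) + b * (T n + k n - t))) -
    (P s (T n) - P x t - (a * (s - x) + b * (T n - t))) by ring.
  apply: (le_trans (ler_normB _ _)); rewrite /eta mulr2n; apply: lerD.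
    apply: (le_trans p1); rewrite ler_pM2l//; apply: lerD; [exact: dx|by []].
  apply: (le_trans p2); rewrite ler_pM2l//; apply: lerD; [exact: dx|by []].
move: hE; rewrite /bdry -segB; [|exact: iQ..].
rewrite -segB; [|exact: iP..].
move: est1 est2.
set S1 := seg _ _ _; set S2 := seg _ _ _ => est1 est2 hE.
have : E / 4 ^+ n <= eta * (h n + k n).
  apply: (le_trans hE).
  have -> : S1 - S2 = (S1 - b * h n * k n) - (S2 - b * k n * h n) by ring.
  by apply: (le_trans (ler_normB _ _)); lra.
have -> : eta * (h n + k n) = (2 * e * (H + K) ^+ 2) / 4 ^+ n.
  rewrite /eta /h /k -[4]/((2 * 2)%:R) natrM exprMn; field.
  by rewrite expf_neq0.
rewrite ler_pM2r ?invr_gt0 ?exprn_gt0//.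
have : e * (2 * D) = E by rewrite /e divfK// gt_eqF// mulr_gt0.
by rewrite /D; move: e0 E0; lra.
Qed.

End closed_form.

(** * Limits and differentiability of complex-valued functions *)

Section complex_limits.
Context {R : realType}.
Notation C := (R[i]^o).

Lemma real_complex_gt0 (e : R) : 0 < e -> 0 < e%:C.
Proof. by rewrite ltcR. Qed.

Lemma complex_gt0 (e : R[i]) : 0 < e -> exists2 d : R, 0 < d & e = d%:C.
Proof. by case: e => a b; rewrite ltcE /= => /andP[/eqP -> a0]; exists a. Qed.

Context {T : Type} {F : set_system T} {FF : Filter F}.

Lemma cvg_normcP (f : T -> C) (l : C) :
  (f x @[x --> F] --> l) <-> forall e : R, 0 < e -> \forall x \near F, normc (f x - l) <= e.
Proof.
split=> [fl e e0|h].
  move/cvgrPdist_le : fl => /(_ _ (real_complex_gt0 e0)); apply: filterS => x.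
  by rewrite distrC normcEC lecR.
apply/cvgrPdist_le => e /complex_gt0[d d0 ->]; apply: filterS (h _ d0) => x.
by rewrite distrC normcEC lecR.
Qed.

Lemma cvg_real_complex (f : T -> R) (l : R) :
  f x @[x --> F] --> l -> ((f x)%:C : C) @[x --> F] --> (l%:C : C).
Proof.
move=> fl; apply/cvg_normcP => e e0.
move/cvgrPdist_le : fl => /(_ _ e0); apply: filterS => x.
by rewrite -rmorphB distrC [normc _]/= expr0n/= addr0 sqrtr_sqr.
Qed.

Lemma cvg_cpx (f g : T -> R) (a b : R) :
  f x @[x --> F] --> a -> g x @[x --> F] --> b ->
  (f x +i* g x : C) @[x --> F] --> (a +i* b : C).
Proof.
move=> fa gb.
have E (u v : R) : u +i* v = u%:C + v%:C * 'i%C by simpc.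
rewrite E; under eq_fun do rewrite E.
by apply: cvgD; [|apply: cvgM; [|exact: cvg_cst]]; exact: cvg_real_complex.
Qed.

Lemma ReD (y z : R[i]) : complex.Re (y + z) = complex.Re y + complex.Re z.
Proof. by case: y; case: z. Qed.

Lemma ReN (y : R[i]) : complex.Re (- y) = - complex.Re y.
Proof. by case: y. Qed.

Lemma ReMr (y : R[i]) (a : R) : complex.Re (y * a%:C) = complex.Re y * a.
Proof. by case: y => yr yi; simpc. Qed.

Lemma normr_Re_le (z : R[i]) : `|complex.Re z| <= normc z.
Proof. by case: z => a b /=; rewrite -[leLHS]sqrtr_sqr ler_sqrt ?addr_ge0 ?sqr_ge0// lerDl sqr_ge0. Qed.

Lemma normr_Im_le (z : R[i]) : `|complex.Im z| <= normc z.
Proof. by case: z => a b /=; rewrite -[leLHS]sqrtr_sqr ler_sqrt ?addr_ge0 ?sqr_ge0// lerDr sqr_ge0. Qed.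

End complex_limits.

(** The difference quotient, completed at 0 by the derivative: the punctured limit becomes a full
    one. *)
Lemma derivable_slope (K : numFieldType) (V : normedModType K) (f : V -> K^o) z v :
  derivable f z v -> exists2 chi : K^o -> K^o,
    (forall h, f (h *: v + z) - f z = chi h * h) & chi h @[h --> (0 : K^o)] --> 'D_v f z.
Proof.
move=> df; pose q (h : K^o) : K^o := h^-1 *: (f (h *: v + z) - f z).
have qD : q h @[h --> 0^'] --> 'D_v f z by exact: df.
exists (fun h => if h == 0 then 'D_v f z else q h).
  move=> h; have [->|h0] := eqVneq h 0; first by rewrite scale0r add0r subrr mulr0.
  by rewrite /q -[_ *: (_ - _)]/(_ * _) mulrAC mulVf// mul1r.
apply/(@cvgrPdist_le K K^o K^o (nbhs (0 : K^o)) _) => e e0.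
move/cvgrPdist_le : qD => /(_ e e0) qD.
have {}qD : \forall h \near (0 : K^o), h != 0 -> `|'D_v f z - q h| <= e by exact: qD.
near=> h; have [_|h0] := eqVneq h 0; first by rewrite subrr normr0 ltW.
by move: h0; near: h.
Unshelve. all: by end_near. Qed.

Section real_differentiability.
Context {R : realType}.
Notation C := (R[i]^o).
Implicit Types (A B D w v : C) (f : C -> C) (F G : R * R -> C) (p : R * R).

(* Caratheodory's form of real differentiability of a complex-valued function of
   two real variables, with partial derivatives [A] and [B]. *)
Definition rdiff F p (A B : C) := exists phi psi : R * R -> C,
  [/\ \forall q \near p, F q - F p = phi q * (q.1 - p.1)%:C + psi q * (q.2 - p.2)%:C,
      phi q @[q --> p] --> A & psi q @[q --> p] --> B].

Lemma rdiff_cvg F p A B : rdiff F p A B -> F q @[q --> p] --> F p.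
Proof.
move=> [phi [psi [Fq fA fB]]].
have c1 : ((q.1 - p.1)%:C : C) @[q --> p] --> ((p.1 - p.1)%:C : C).
  by apply: cvg_real_complex; apply: cvgB; [exact: cvg_fst|exact: cvg_cst].
have c2 : ((q.2 - p.2)%:C : C) @[q --> p] --> ((p.2 - p.2)%:C : C).
  by apply: cvg_real_complex; apply: cvgB; [exact: cvg_snd|exact: cvg_cst].
have := cvgD (cvg_cst (F p)) (cvgD (cvgM fA c1) (cvgM fB c2)).
rewrite !subrr !mulr0 !addr0 => h.
have e : {near p, (fun q => F p + (phi q * (q.1 - p.1)%:C + psi q * (q.2 - p.2)%:C)) =1 F}.
  near=> q.
  have <- : F q - F p = phi q * (q.1 - p.1)%:C + psi q * (q.2 - p.2)%:C by near: q.
  by rewrite addrC subrK.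
apply: cvg_trans (near_eq_cvg e) _; exact: h.
Unshelve. all: by end_near. Qed.

Lemma rdiff_cst c p : rdiff (cst c) p 0 0.
Proof.
exists (cst 0), (cst 0); split; [|exact: cvg_cst|exact: cvg_cst].
by near=> q; rewrite subrr !mul0r addr0.
Unshelve. all: by end_near. Qed.

Lemma rdiff_fst p : rdiff (fun q => q.1%:C : C) p 1 0.
Proof.
exists (cst 1), (cst 0); split; [|exact: cvg_cst|exact: cvg_cst].
by near=> q; rewrite mul1r mul0r addr0 rmorphB.
Unshelve. all: by end_near. Qed.

Lemma rdiffD F G p A B A' B' : rdiff F p A B -> rdiff G p A' B' ->
  rdiff (fun q => F q + G q) p (A + A') (B + B').
Proof.
move=> [f [g [Fq fA gB]]] [f' [g' [Gq fA' gB']]].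
exists (fun q => f q + f' q), (fun q => g q + g' q).
split; [|exact: cvgD fA fA'|exact: cvgD gB gB'].
near=> q; rewrite opprD addrACA.
have -> : F q - F p = f q * (q.1 - p.1)%:C + g q * (q.2 - p.2)%:C by near: q.
have -> : G q - G p = f' q * (q.1 - p.1)%:C + g' q * (q.2 - p.2)%:C by near: q.
ring.
Unshelve. all: by end_near. Qed.

Lemma rdiffM F G p A B A' B' : rdiff F p A B -> rdiff G p A' B' ->
  rdiff (fun q => F q * G q) p (A * G p + F p * A') (B * G p + F p * B').
Proof.
move=> dF dG; have Fp := rdiff_cvg dF; have Gp := rdiff_cvg dG.
move: dF dG => [f [g [Fq fA gB]]] [f' [g' [Gq fA' gB']]].
exists (fun q => f q * G q + F p * f' q), (fun q => g q * G q + F p * g' q).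
split; last 2 first.
- exact: (cvgD (cvgM fA Gp) (cvgM (cvg_cst (F p)) fA')).
- exact: (cvgD (cvgM gB Gp) (cvgM (cvg_cst (F p)) gB')).
near=> q.
have -> : F q * G q - F p * G p = (F q - F p) * G q + F p * (G q - G p) by ring.
have -> : F q - F p = f q * (q.1 - p.1)%:C + g q * (q.2 - p.2)%:C by near: q.
have -> : G q - G p = f' q * (q.1 - p.1)%:C + g' q * (q.2 - p.2)%:C by near: q.
ring.
Unshelve. all: by end_near. Qed.

(** In Caratheodory's form the chain rule [rdiff_comp] is a substitution, with no division by an
    increment that may vanish. *)
Definition cdiff f w D := exists chi : C -> C,
  (\forall v \near w, f v - f w = chi v * (v - w)) /\ chi v @[v --> w] --> D.

Lemma rdiff_comp f F p A B D : cdiff f (F p) D -> rdiff F p A B ->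
  rdiff (fun q => f (F q)) p (D * A) (D * B).
Proof.
move=> [chi [fq chiD]] dF; have Fp := rdiff_cvg dF.
move: dF => [g [h [Fq gA hB]]].
exists (fun q => chi (F q) * g q), (fun q => chi (F q) * h q).
have chiF : chi (F q) @[q --> p] --> D by exact: cvg_comp Fp chiD.
split; [|exact: cvgM chiF gA|exact: cvgM chiF hB].
have fq' : \forall q \near p, f (F q) - f (F p) = chi (F q) * (F q - F p) by exact: Fp fq.
near=> q.
have -> : f (F q) - f (F p) = chi (F q) * (F q - F p) by near: q.
have -> : F q - F p = g q * (q.1 - p.1)%:C + h q * (q.2 - p.2)%:C by near: q.
ring.
Unshelve. all: by end_near. Qed.

Lemma near_normc_sub w (d : R) : 0 < d -> \forall v \near w, normc (v - w) <= d.
Proof. by move=> d0; have /cvg_normcP := (@cvg_id _ (nbhs w)); exact. Qed.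

Lemma cdiff_inv w : w != 0 -> cdiff (fun v => v^-1) w (- (w * w)^-1).
Proof.
move=> w0; have n0 : 0 < normc w by rewrite -ltcR -normcEC normr_gt0.
have low v : normc (v - w) <= normc w / 2 -> normc w / 2 <= normc v.
  move=> vw; have := le_normcD v (w - v); rewrite -[w - v]opprB normcN opprB addrC subrK.
  move: vw; lra.
have nz v : normc w / 2 <= normc v -> v != 0.
  by move=> h; apply/eqP => v0; move: h; rewrite v0 normc0; move: n0; lra.
exists (fun v => - (v * w)^-1); split.
  near=> v; have v0 : v != 0.
    by apply: nz; apply: low; near: v; apply: near_normc_sub; rewrite divr_gt0.
  by field; rewrite w0 v0.
apply/(@cvg_normcP R C (nbhs w) _) => e e0; near=> v.
have vw : normc w / 2 <= normc v.
  by apply: low; near: v; apply: near_normc_sub; rewrite divr_gt0.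
have v0 := nz _ vw.
have -> : - (v * w)^-1 - - (w * w)^-1 = (v - w) * (v * w * w)^-1.
  by field; rewrite w0 v0.
rewrite normcM normcV !normcM ler_pdivrMr; last by rewrite !mulr_gt0// (lt_le_trans _ vw)// divr_gt0.
apply: (@le_trans _ _ (e * (normc w / 2 * normc w * normc w))); last first.
  by rewrite ler_pM2l// ler_pM2r// ler_pM2r.
by near: v; apply: near_normc_sub; rewrite !mulr_gt0.
Unshelve. all: by end_near. Qed.

Lemma cdiff_continuous f w D : cdiff f w D -> f v @[v --> w] --> f w.
Proof.
move=> [chi [fE chiD]]; pose M := normc D + 1.
have M0 : 0 < M by rewrite ltr_wpDl// normc_ge0.
apply/(@cvg_normcP R C (nbhs w) _) => e e0.
move/cvg_normcP : chiD => /(_ 1 ltr01) chi1.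
near=> v; have -> : f v - f w = chi v * (v - w) by near: v.
rewrite normcM (@le_trans _ _ (M * normc (v - w)))//.
  rewrite ler_wpM2r ?normc_ge0// /M.
  rewrite -[chi v](subrK D) addrC (le_trans (le_normcD _ _))// lerD2l.
  by near: v.
by rewrite -ler_pdivlMl//; near: v; apply: near_normc_sub; rewrite mulr_gt0 ?invr_gt0.
Unshelve. all: by end_near. Qed.

Definition expi (t : R) : C := cos t +i* sin t.

Lemma rdiff_expi p : rdiff (fun q => expi q.2) p 0 ('i%C * expi p.2).
Proof.
have slope (f : R -> R^o) (l : R^o) : is_derive p.2 1 f l -> exists2 chi : R -> R,
    (forall u, f u - f p.2 = chi u * (u - p.2)) & chi q.2 @[q --> p] --> l.
  move=> fD; have [chi chiE chiD] := derivable_slope (ex_derive (is_derive := fD)).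
  exists (fun u => chi (u - p.2)).
    by move=> u; rewrite -chiE scaler1 subrK.
  rewrite -(derive_val (is_derive := fD)); apply: cvg_comp chiD.
  by rewrite -(subrr p.2); apply: cvgB; [exact: cvg_snd|exact: cvg_cst].
have [c cE cD] := slope _ _ (is_derive_cos p.2).
have [s sE sD] := slope _ _ (is_derive_sin p.2).
exists (cst 0), (fun q => c q.2 +i* s q.2); split; [|exact: cvg_cst|].
  near=> q; rewrite mul0r add0r /expi.
  have -> : (cos q.2 +i* sin q.2) - (cos p.2 +i* sin p.2) =
     (cos q.2 - cos p.2) +i* (sin q.2 - sin p.2) by simpc.
  by rewrite cE sE; simpc.
have -> : 'i%C * expi p.2 = (- sin p.2) +i* cos p.2 by rewrite /expi; simpc.
exact: cvg_cpx.
Unshelve. all: by end_near. Qed.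

(** Back to the epsilon-delta form in which [closed_form] is stated. *)
Lemma rdiff_bound F p A B : rdiff F p A B -> forall e : R, 0 < e ->
  exists2 d : R, 0 < d & forall x t, `|x - p.1| < d -> `|t - p.2| < d ->
  normc (F (x, t) - F p - (A * (x - p.1)%:C + B * (t - p.2)%:C)) <=
    e * (`|x - p.1| + `|t - p.2|).
Proof.
move=> [f [g [Fq /cvg_normcP fA /cvg_normcP gB]]] e e0.
have : \forall q \near p, normc (F q - F p - (A * (q.1 - p.1)%:C + B * (q.2 - p.2)%:C)) <=
    e * (`|q.1 - p.1| + `|q.2 - p.2|).
  near=> q.
  have -> : F q - F p = f q * (q.1 - p.1)%:C + g q * (q.2 - p.2)%:C by near: q.
  have -> : f q * (q.1 - p.1)%:C + g q * (q.2 - p.2)%:C - (A * (q.1 - p.1)%:C + B * (q.2 - p.2)%:C)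
    = (f q - A) * (q.1 - p.1)%:C + (g q - B) * (q.2 - p.2)%:C by ring.
  have nR (x : R) : normc x%:C = `|x| by rewrite /= expr0n/= addr0 sqrtr_sqr.
  apply: (le_trans (le_normcD _ _)); rewrite !normcM !nR mulrDr.
  by apply: lerD; apply: ler_wpM2r => //; near: q; [exact: fA|exact: gB].
move=> /nbhs_ballP[d /= d0 h]; exists d => // x t xd td.
by apply: (h (x, t)); split; rewrite /ball/= distrC.
Unshelve. all: by end_near. Qed.

End real_differentiability.

(** * Cauchy's formula by contracting a circle to a point *)

Section cauchy.
Context {R : realType}.
Notation C := (R[i]^o).
Implicit Types (f : C -> C) (b : C) (r s t : R).

Lemma expi0 : expi (0 : R) = 1.
Proof. by rewrite /expi cos0 sin0. Qed.

Lemma expi2pi : expi (2 * pi : R) = 1.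
Proof. by rewrite /expi mulr_natl cos2pi sin2pi. Qed.

Lemma normc_expi t : normc (expi t) = 1.
Proof. by rewrite /= cos2Dsin2 sqrtr1. Qed.

Section homotopy.
Variables (f : C -> C) (r : R) (b : C).
Hypotheses (r0 : 0 < r) (br : normc b < r).
Hypothesis df : forall w, normc w <= r -> exists D, cdiff f w D.

Let w t : C := r%:C * expi t.
Let u t : C := w t - b.
Let gam s t : C := b + s%:C * u t.
(** On the circle the derivative of [w] is ['i * w], so [cauchy_kernel t dt] is [dw / (w - b)]
    divided by ['i]. *)
Definition cauchy_kernel t : C := w t / u t.

Lemma normc_w t : normc (w t) = r.
Proof. by rewrite normcM normc_expi mulr1 normcR_ge0 ?ltW. Qed.

Lemma u_ge t : r - normc b <= normc (u t).
Proof. by have := le_normcD (u t) b; rewrite subrK normc_w lerBlDr. Qed.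

Lemma u_neq0 t : u t != 0.
Proof.
apply/eqP => u0; have := u_ge t; rewrite u0 normc0 leNgt subr_gt0 br//.
Qed.

Lemma normc_gam s t : 0 <= s <= 1 -> normc (gam s t) <= r.
Proof.
move=> /andP[s0 s1].
have -> : gam s t = (1 - s)%:C * b + s%:C * w t by rewrite /gam /u rmorphB; ring.
apply: (le_trans (le_normcD _ _)); rewrite normcM [normc (s%:C * _)]normcM normc_w !normcR_ge0 ?subr_ge0//.
have : (1 - s) * normc b <= (1 - s) * r by rewrite ler_wpM2l ?subr_ge0// ltW.
lra.
Qed.

Lemma rdiff_u p : rdiff (fun q => u q.2) p 0 (r%:C * ('i%C * expi p.2)).
Proof.
have h := rdiffD (rdiffM (rdiff_cst (r%:C : C) p) (rdiff_expi p)) (rdiff_cst (- b) p).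
move: h; rewrite /= !mul0r !mulr0 !addr0 add0r => h.
exact: h.
Qed.

Lemma rdiff_gam p : rdiff (fun q => gam q.1 q.2) p (u p.2)
   (p.1%:C * (r%:C * ('i%C * expi p.2))).
Proof.
have h := rdiffD (rdiff_cst b p) (rdiffM (rdiff_fst p) (rdiff_u p)).
move: h; rewrite /= !mul0r !mulr0 !addr0 !add0r mul1r => h.
exact: h.
Qed.

Lemma rdiff_kernel p : exists B, rdiff (fun q => cauchy_kernel q.2) p 0 B.
Proof.
have dw : rdiff (fun q : R * R => w q.2) p 0 (r%:C * ('i%C * expi p.2)).
  by have := rdiffM (rdiff_cst (r%:C : C) p) (rdiff_expi p); rewrite !mul0r !mulr0 !add0r.
have := rdiffM dw (rdiff_comp (cdiff_inv (u_neq0 p.2)) (rdiff_u p)).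
by rewrite mulr0 mul0r mulr0 addr0; eexists; eassumption.
Qed.

(* The pull-back of [f(z) dz / (i (z - b))] by the homotopy [gam] from the
   circle to the point [b]; up to a factor, [ds/s + w'/u dt]. *)
Lemma homotopy_closed s0 : 0 < s0 -> closed_form
  (fun s t => complex.Im (f (gam s t)) / s)
  (fun s t => complex.Re (f (gam s t) * cauchy_kernel t)) s0 1 0 (2 * pi).
Proof.
move=> s00 s t /andP[s0s s1] tI; have sp : 0 < s by exact: lt_le_trans s0s.
have [D fD] : exists D, cdiff f (gam s t) D.
  by apply: df; apply: normc_gam; rewrite s1 ltW.
pose p := (s, t).
have dfg := rdiff_comp fD (rdiff_gam p).
have [Bk dk] := rdiff_kernel p.
have dQ := rdiffM dfg dk.
have sC0 : (s%:C : C) != 0 by rewrite -(rmorph0 (real_complex R)) (inj_eq (@complexI R)) gt_eqF.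
have dP := rdiffM (rdiffM (rdiff_cst (- 'i%C) p) dfg) (rdiff_comp (cdiff_inv sC0) (rdiff_fst p)).
move: dP; rewrite /= => dP.
set P1 := (X in rdiff _ _ X _) in dP; set P2 := (X in rdiff _ _ _ X) in dP.
set Q1 := (X in rdiff _ _ X _) in dQ; set Q2 := (X in rdiff _ _ _ X) in dQ.
(* Both mixed partial derivatives equal [D * w t]. *)
have PQ : P2 = Q1.
  have ii : ('i%C : C) * 'i%C = -1 by exact: sqr_i.
  have ut := u_neq0 t.
  rewrite /P2 /Q1 /= !mul0r !mulr0 !addr0 add0r /cauchy_kernel.
  have -> : - 'i%C * (D * (s%:C * (r%:C * ('i%C * expi t)))) =
      - ('i%C * 'i%C) * (s%:C * (D * w t)) :> C by rewrite /w; ring.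
  rewrite ii opprK mul1r mulrAC mulfV// mul1r.
  by rewrite -mulrA; congr (_ * _); rewrite mulrCA mulfV// mulr1.
exists (complex.Re P1), (complex.Re P2), (complex.Re Q2) => e e0.
have [d1 d10 h1] := rdiff_bound dP e0; have [d2 d20 h2] := rdiff_bound dQ e0.
exists (Num.min d1 d2); first by rewrite lt_min d10.
move=> x' t' _ _; rewrite !lt_min => /andP[x1 x2] /andP[t1 t2]; split.
  apply: le_trans (h1 x' t' x1 t1); apply: le_trans (normr_Re_le _).
  rewrite le_eqVlt; apply/orP; left; apply/eqP; congr `|_|.
  have ReIm (z : C) (a : R) : complex.Re (- 'i%C * z * (a%:C)^-1) = complex.Im z / a.
    have -> : (a%:C)^-1 = (a^-1)%:C by rewrite fmorphV.
    by case: z => zr zi; simpc.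
  by rewrite !(ReD, ReN, ReMr, ReIm).
rewrite PQ.
apply: le_trans (h2 x' t' x2 t2); apply: le_trans (normr_Re_le _).
rewrite le_eqVlt; apply/orP; left; apply/eqP; congr `|_|.
by rewrite !(ReD, ReN, ReMr).
Qed.

(** The sides [t = 0] and [t = 2 * pi] cancel because [gam] is periodic in [t]; the sides [s = 1]
    and [s = s0] remain. *)
Lemma homotopy_integral s0 : 0 < s0 -> s0 <= 1 ->
  seg (fun t => complex.Re (f (w t) * cauchy_kernel t)) 0 (2 * pi) =
  seg (fun t => complex.Re (f (gam s0 t) * cauchy_kernel t)) 0 (2 * pi).
Proof.
move=> s00 s01.
have bd := closed_form_boundary s01 (ltW (two_pi_gt0 : 0 < 2 * pi)) (homotopy_closed s00).
have gam2pi s : gam s (2 * pi) = gam s 0 by rewrite /gam /u /w expi2pi expi0.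
have gam1 t : gam 1 t = w t by rewrite /gam mul1r /u addrC subrK.
move: bd; rewrite [seg (fun s => complex.Im (f (gam s (2 * pi))) / s) _ _](@eq_seg _ _
  (fun s => complex.Im (f (gam s 0)) / s)); last by move=> s; rewrite gam2pi.
rewrite subrr subr0 => /eqP; rewrite subr_eq0 => /eqP <-.
by apply: eq_seg => t; rewrite gam1.
Qed.

Lemma kernel_bound t : normc (cauchy_kernel t) <= r / (r - normc b).
Proof.
have rb : 0 < r - normc b by rewrite subr_gt0.
rewrite /cauchy_kernel normcM normc_w normcV ler_pM2l// lef_pV2 ?posrE ?u_ge//.
exact: lt_le_trans rb (u_ge t).
Qed.

Lemma seg_kernel_integrable (g : C -> C) s : 0 <= s <= 1 -> 
   (forall w, normc w <= r -> exists D, cdiff g w D) ->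
  seg_integrable (fun t => complex.Re (g (gam s t) * cauchy_kernel t)) 0 (2 * pi).
Proof.
move=> sI dg; apply: seg_integrable_continuous => t _ e e0.
have [D fD] := dg _ (normc_gam t sI).
have [Bk dk] := rdiff_kernel (s, t).
have dQ := rdiff_cvg (rdiffM (rdiff_comp (F := fun q => gam q.1 q.2) (p := (s, t)) fD (rdiff_gam (s, t))) dk).
move/cvg_normcP : dQ => /(_ e e0) /nbhs_ballP[d /= d0 h]; exists d => // t' _ tt.
have : ball (s, t) d (s, t') by split; [exact: ballxx|rewrite /ball/= distrC].
move=> /h/=; apply: le_trans; apply: le_trans (normr_Re_le _).
rewrite le_eqVlt; apply/orP; left; apply/eqP; congr `|_|.
by rewrite ReD ReN.
Qed.

(* Let [s -> 0] in [homotopy_integral]. *)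
Lemma cauchy_homotopy : seg (fun t => complex.Re (f (w t) * cauchy_kernel t)) 0 (2 * pi) =
  seg (fun t => complex.Re (f b * cauchy_kernel t)) 0 (2 * pi).
Proof.
have rb : 0 < r - normc b by rewrite subr_gt0.
have pi0 : 0 < 2 * pi :> R := two_pi_gt0.
have bD : normc b <= r by exact: ltW.
apply/eqP; rewrite -subr_eq0 -normr_le0; apply/ler_addgt0Pl => e e0; rewrite addr0.
pose K := r / (r - normc b); have K0 : 0 < K by rewrite divr_gt0.
have [D fD] := df bD.
(* The kernel is bounded by [K] and the segment has length [2 * pi]. *)
pose e' := e / (2 * pi) / K; have e'0 : 0 < e' by rewrite !divr_gt0.
have fb : \forall v \near b, normc (f v - f b) <= e'.
  by move/cvg_normcP : (cdiff_continuous fD); apply.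
move: fb => /nbhs_ballP[eC /= /complex_gt0[d d0 ->] fb].
(* As [u t] has modulus at most [2 * r], the point [gam s t] stays within [d / 2] of [b]. *)
pose s := Num.min 1 (d / (4 * r)).
have s0 : 0 < s by rewrite lt_min ltr01 divr_gt0// mulr_gt0.
have s1 : s <= 1 by rewrite ge_min lexx.
have near_gam t : normc (f (gam s t) - f b) <= e'.
  apply: fb; rewrite -ball_normE /= normcEC ltcR /gam opprD addNKr normcN normcM.
  rewrite normcR_ge0 ?ltW//.
  apply: (@le_lt_trans _ _ (d / (4 * r) * (2 * r))).
    apply: ler_pM; [exact: ltW|exact: normc_ge0|by rewrite ge_min lexx orbT|].
    apply: (le_trans (le_normcD (w t) (- b))); rewrite normcN normc_w.
    by rewrite mulr_natl mulr2n lerD2l.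
  have -> : d / (4 * r) * (2 * r) = d / 2 by field; rewrite gt_eqF.
  lra.
have s01 : 0 <= s <= 1 by rewrite s1 ltW.
have i0 : 0 <= (0:R) <= 1 by rewrite lexx ler01.
rewrite (homotopy_integral s0 s1).
have ib : seg_integrable (fun t => complex.Re (f b * cauchy_kernel t)) 0 (2 * pi).
  have := seg_kernel_integrable i0 df; rewrite /gam.
  by under eq_fun do rewrite mul0r addr0.
rewrite -segB//; last exact: seg_kernel_integrable.
have isb : seg_integrable (fun t => complex.Re (f (gam s t) * cauchy_kernel t) -
    complex.Re (f b * cauchy_kernel t)) 0 (2 * pi).
  by apply: (integrableB _ (seg_kernel_integrable s01 df) ib); exact: measurable_itv.
have := seg_near_cst (k := 0) (e := e / (2 * pi)) (ltW pi0) isb.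
rewrite mul0r subr0 [_ * (_ - _)](_ : _ = e); last by rewrite subr0 divfK// gt_eqF.
apply=> t _; rewrite subr0.
have -> : complex.Re (f (gam s t) * cauchy_kernel t) - complex.Re (f b * cauchy_kernel t) =
  complex.Re ((f (gam s t) - f b) * cauchy_kernel t).
  by rewrite mulrBl ReD ReN.
apply: (le_trans (normr_Re_le _)); rewrite normcM.
have -> : e / (2 * pi) = e' * K by rewrite /e' divfK// gt_eqF.
by apply: ler_pM; rewrite ?normc_ge0//; exact: kernel_bound.
Qed.

End homotopy.
End cauchy.

(** * The one-variable Szego formula and means over angles *)

Section cauchy_formula.
Context {R : realType}.
Notation C := (R[i]^o).
Implicit Types (f : C -> C) (a b c v w : C) (r s t : R).

Lemma conjc_mul (x y : R[i]) : conjc (x * y) = conjc x * conjc y.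
Proof. exact: rmorphM. Qed.

Lemma conjc_sub (x y : R[i]) : conjc (x - y) = conjc x - conjc y.
Proof. exact: rmorphB. Qed.

Definition circ r t : C := r%:C * expi t.

Lemma one_sub_neq0 d w : normc (d * w) < 1 -> 1 - d * w != 0.
Proof.
move=> dw; apply/eqP => /eqP; rewrite subr_eq0 => /eqP e.
by move: dw; rewrite -e normc1 ltxx.
Qed.

Lemma cdiff_inv_affine c d w : 1 - d * w != 0 ->
  exists D, cdiff (fun v => c * (1 - d * v)^-1) w D.
Proof.
move=> nz; have [chi [chiE chiD]] := cdiff_inv nz.
move: chiD; set E := - (_)^-1 => chiD.
have d0 : 0 < normc d + 1 by rewrite ltr_wpDl// normc_ge0.
have aff : (1 - d * v : C) @[v --> w] --> (1 - d * w : C).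
  apply/(@cvg_normcP R C (nbhs w) _) => e e0; near=> v.
  have -> : 1 - d * v - (1 - d * w) = - (d * (v - w)) by ring.
  rewrite normcN normcM.
  apply: (@le_trans _ _ ((normc d + 1) * normc (v - w))).
    by rewrite ler_wpM2r ?normc_ge0// lerDl.
  rewrite mulrC -ler_pdivlMr//; near: v; apply: near_normc_sub.
  exact: divr_gt0.
exists (c * (E * - d)), (fun v => c * (chi (1 - d * v) * - d)); split.
  have h : \forall v \near w, (1 - d * v)^-1 - (1 - d * w)^-1 =
      chi (1 - d * v) * (1 - d * v - (1 - d * w)) by exact: (aff _ chiE).
  near=> v; rewrite -mulrBr.
  have -> : (1 - d * v)^-1 - (1 - d * w)^-1 =
      chi (1 - d * v) * (1 - d * v - (1 - d * w)) by near: v.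
  ring.
have chi2 : chi (1 - d * v) @[v --> w] --> E by move=> A /chiD /aff.
exact: (cvgM (cvg_cst c) (cvgM chi2 (cvg_cst (- d)))).
Unshelve. all: by end_near. Qed.

Lemma mean_value f r : 0 < r -> (forall w, normc w <= r -> exists D, cdiff f w D) ->
  seg (fun t => complex.Re (f (circ r t))) 0 (2 * pi) = 2 * pi * complex.Re (f 0).
Proof.
move=> r0 df; have b0 : normc (0 : C) < r by rewrite normc0.
have w0 t : (circ r t) != 0.
  by rewrite -[circ r t]subr0; exact: (u_neq0 r0 b0).
have K1 t : cauchy_kernel r 0 t = 1 by rewrite /cauchy_kernel subr0 divff; [|exact: w0].
have := cauchy_homotopy r0 b0 df.
rewrite (@eq_seg _ _ (fun t => complex.Re (f (circ r t)))); last first.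
  by move=> t; rewrite K1 mulr1.
rewrite [RHS](@eq_seg _ _ (cst (complex.Re (f 0)))); last first.
  by move=> t; rewrite K1 mulr1.
by move=> ->; rewrite seg_cst ?(ltW two_pi_gt0)// subr0 mulrC.
Qed.

(* On the circle [|w| = r] the kernel [1 / (1 - a conj w)] is the Cauchy kernel
   [w / (w - r^2 a)]. *)
Lemma cauchy_formula f r a : 0 < r < 1 -> normc a <= 1 ->
  (forall w, normc w <= r -> exists D, cdiff f w D) ->
  seg (fun t => complex.Re (f (circ r t) * (1 - a * conjc (circ r t))^-1)) 0 (2 * pi)
   = 2 * pi * complex.Re (f ((r ^+ 2)%:C * a)).
Proof.
move=> /andP[r0 r1] a1 df; set b := _ * a.
have br : normc b < r.
  rewrite normcM normcR_ge0 ?sqr_ge0// expr2 -mulrA -[ltRHS]mulr1 ltr_pM2l//.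
  apply: le_lt_trans r1; rewrite -[leRHS]mulr1 ler_pM2l//.
have circ_conj t : circ r t * conjc (circ r t) = (r%:C * r%:C : C).
  apply/eqP; rewrite /circ /expi eq_complex /=; apply/andP; split; apply/eqP; last by ring.
  transitivity (r * r * (cos t ^+ 2 + sin t ^+ 2)); first by ring.
  by rewrite cos2Dsin2; ring.
have KE t : cauchy_kernel r b t = (1 - a * conjc (circ r t))^-1.
  have un := u_neq0 r0 br t.
  have wn : (circ r t) != 0.
    by rewrite -[circ r t]subr0; apply: (u_neq0 r0 _); rewrite normc0.
  rewrite /cauchy_kernel -[LHS]invrK; congr (_^-1).
  rewrite invfM invrK mulrBr mulVf//; congr (1 - _).
  have -> : b = a * (circ r t) * conjc (circ r t).
    by rewrite -mulrA circ_conj /b [(r ^+ 2)%:C]real_complexM mulrC.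
  rewrite -/(circ r t); move: wn; set z := conjc _; generalize (circ r t) => w wn; field; exact: wn.
rewrite (@eq_seg _ _ (fun t => complex.Re (f (circ r t) * cauchy_kernel r b t))); last first.
  by move=> t; rewrite KE.
rewrite (cauchy_homotopy r0 br df).
have rw w : normc w <= r -> normc (conjc a * w) < 1.
  move=> wr; rewrite normcM (_ : normc (conjc a) = normc a); last by case: (a) => x y /=; rewrite sqrrN.
  apply: le_lt_trans r1.
  rewrite -[leRHS]mul1r; apply: ler_pM; rewrite ?normc_ge0//.
(* On the circle the kernel is the conjugate of [(1 - conjc a * w)^-1], so the remaining integrand
   is the real part of the holomorphic [g], to which [mean_value] applies. *)
pose g v : C := conjc (f b) * (1 - conjc a * v)^-1.
have dg w : normc w <= r -> exists D, cdiff g w D.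
  by move=> wr; apply: cdiff_inv_affine; apply: one_sub_neq0; exact: rw.
have := mean_value r0 dg; rewrite /g mulr0 subr0 invr1 mulr1.
have -> : complex.Re (conjc (f b)) = complex.Re (f b) by case: (f b).
move=> <-; apply: eq_seg => t; rewrite KE.
have Re_conj (z : C) : complex.Re z = complex.Re (conjc z) by case: z.
rewrite [RHS]Re_conj; congr complex.Re.
rewrite (conjc_mul (conjc (f b))) conjcK; congr (_ * _).
transitivity ((conjc (1 - conjc a * circ r t))^-1 : C); last exact/esym/conjc_inv.
by congr (_^-1); rewrite conjc_sub (conjc_mul (conjc a)) conjc1 conjcK.
Qed.

Lemma uniform_mean (F : R -> R) (M : R) : (forall t, `|F t| <= M) -> continuous F ->
  (\int[uniform_prob (@two_pi_gt0 R)]_t (F t)%:E = ((2 * pi)^-1 * seg F 0 (2 * pi))%:E)%E.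
Proof.
move=> FM cF; have pi0 : 0 < 2 * pi :> R := two_pi_gt0.
have mF : measurable_fun setT F by exact: continuous_measurable_fun.
have FM0 t : 0 <= F t + M by have := FM t; rewrite ler_norml; lra.
have iF : (uniform_prob (@two_pi_gt0 R)).-integrable setT (EFin \o F).
  apply: measurable_bounded_integrable => //.
    by rewrite (le_lt_trans (probability_le1 _ _))// ltry.
  exists M; split; first exact: num_real.
  by move=> x Mx y _ /=; rewrite (le_trans (FM y))// ltW.
have iM : (uniform_prob (@two_pi_gt0 R)).-integrable setT (EFin \o (cst M : R -> R)).
  exact: finite_measure_integrable_cst.
(* The shift by [M] makes the integrand nonnegative, as [integral_uniform] requires. *)
have -> : (\int[uniform_prob (@two_pi_gt0 R)]_t (F t)%:E =
  \int[uniform_prob (@two_pi_gt0 R)]_t (F t + M)%:E - M%:E)%E.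
  under [in RHS]eq_integral do rewrite EFinD.
  rewrite integralD//= integral_cst// [X in (_ * X)%E]probability_setT mule1.
  by rewrite addeK.
rewrite integral_uniform//; last first.
  by apply/measurable_EFinP; exact: (measurable_funD mF (measurable_cst M)).
have iF' : seg_integrable F 0 (2 * pi).
  by apply: continuous_compact_integrable; [exact: segment_compact|exact: continuous_subspaceT].
have iM' : seg_integrable (cst M) 0 (2 * pi).
  by apply: continuous_compact_integrable; [exact: segment_compact|apply: continuous_subspaceT => x; exact: cvg_cst].
have -> : (\int[lebesgue_measure]_(x in `[0%R, (2 * pi)%R]) (F x + M)%:E =
  (seg F 0 (2 * pi) + M * (2 * pi))%:E)%E.
  under eq_integral do rewrite EFinD.
  have sM := seg_cst M (ltW pi0); rewrite subr0 in sM.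
  rewrite integralD//= -sM EFinD /seg /Rintegral !fineK//; exact: integrable_fin_num.
rewrite -EFinM -EFinB subr0; congr (_%:E).
rewrite mulrDr mulrCA mulVf ?gt_eqF// mulr1 addrK//.
Qed.

End cauchy_formula.

(** * Slices and local bounds of functions on the polydisc *)

Section slices.
Context {R : realType}.
Notation C := (R[i]^o).

Lemma differentiable_slice n (f : 'rV[R[i]]_n -> C) (z v : 'rV[R[i]]_n) :
  differentiable f (z : 'rV[R[i]]_n : normedModType R[i]) ->
  exists D, cdiff (fun l : C => f (z + l *: v)) 0 D.
Proof.
move=> /(@diff_derivable _ _ _ _ _ v) /derivable_slope[chi chiE chiD].
exists ('D_v f z), chi; split; last exact: chiD.
by near=> l; rewrite scale0r addr0 subr0 [z + _]addrC chiE.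
Unshelve. all: by end_near. Qed.

Lemma cdiff_shift (f : C -> C) w : (exists D, cdiff (fun l => f (w + l)) 0 D) ->
  exists D, cdiff f w D.
Proof.
move=> [D [chi [fE chiD]]]; exists D, (fun v => chi (v - w)).
have sh : (v - w : C) @[v --> w] --> (0 : C).
  apply/(@cvg_normcP R C (nbhs w) _) => e e0; near=> v.
  by rewrite subr0; near: v; exact: near_normc_sub.
split; last by move=> A /chiD /sh.
have h : \forall v \near w, f (w + (v - w)) - f (w + 0) = chi (v - w) * (v - w - 0).
  exact: (sh _ fE).
near=> v.
have : f (w + (v - w)) - f (w + 0) = chi (v - w) * (v - w - 0) by near: v.
by rewrite addr0 subr0 [w + _]addrC subrK.
Unshelve. all: by end_near. Qed.

Lemma compact_disc (r : R) : compact [set w : C | normc w <= r].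
Proof.
pose K : set (R^o * R^o) := `[- r, r]%classic `*` `[- r, r]%classic.
have cK : compact K by apply: compact_setX; exact: segment_compact.
pose g (p : R^o * R^o) : C := p.1 +i* p.2.
have cg : continuous g.
  by move=> p; apply: (cvg_cpx (f := fun p : R^o * R^o => p.1) (g := fun p : R^o * R^o => p.2));
    [exact: cvg_fst|exact: cvg_snd].
have cgK : compact (g @` K).
  by apply: continuous_compact => //; apply: continuous_subspaceT.
have -> : [set w : C | normc w <= r] = (g @` K) `&` [set w : C | normc w <= r].
  apply/seteqP; split=> w //= => [wr|[]//]; split=> //.
  case: w wr => x y xyr; exists (x, y) => //.
  have xr := le_trans (normr_Re_le (x +i* y)) xyr.
  have yr := le_trans (normr_Im_le (x +i* y)) xyr.
  by split; rewrite /= in_itv/= -ler_norml.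
apply: compact_closedI => //.
rewrite (_ : [set w : C | normc w <= r] = (fun w : C => normc w) @^-1` [set x | x <= r])//.
apply: preimage_closed; last exact: closed_le.
move=> w _; apply/(@cvgrPdist_le R R^o C (nbhs w) _) => e e0; near=> v.
rewrite (le_trans (normc_dist _ _))// -opprB normcN.
by near: v; exact: near_normc_sub.
Unshelve. all: by end_near. Qed.

Lemma bounded_on_polydisc n (f : 'rV[R[i]]_n -> C) (r : R) : r < 1 ->
  (forall z : 'rV[R[i]]_n : normedModType R[i], polydisc z -> differentiable f z) ->
  exists M, forall z : 'rV[R[i]]_n, (forall i, normc (z ord0 i) <= r) -> normc (f z) <= M.
Proof.
move=> r1 df.
pose K : set 'rV[C]_n := [set z | forall i, normc (z ord0 i) <= r].
have cK : compact K.
  by apply: (@rV_compact C n (fun=> [set w : C | normc w <= r])) => i; exact: compact_disc.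
pose g : 'rV[C]_n -> R^o := fun z => normc (f z).
have cg : {within K, continuous g}.
  apply: continuous_in_subspaceT => z; rewrite inE => zK.
  have zP : polydisc (z : 'rV[R[i]]_n).
    by move=> i; rewrite normcEC -(rmorph1 (real_complex R)) ltcR (le_lt_trans (zK i)).
  have fz := differentiable_continuous (df z zP).
  have fz' : f y @[y --> z] --> f z by exact: fz.
  apply/(@cvgrPdist_le R R^o _ (nbhs z) _) => e e0.
  move/cvg_normcP : fz' => /(_ e e0); apply: filterS => y.
  by apply: le_trans; rewrite distrC; exact: normc_dist.
have := continuous_compact cg cK.
move=> /compact_bounded[M [_ hM]]; exists (M + 1) => z zK.
have := hM (M + 1); rewrite ltrDl ltr01 => /(_ isT (normc (f z))).
by move=> h; have /= := h (ex_intro2 _ _ z zK erefl); rewrite ger0_norm ?normc_ge0.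
Qed.

End slices.

(** * The reproducing formula on the torus *)

Section torus_formula.
Context {R : realType}.
Notation C := (R[i]^o).
Notation angles n := (n.-tuple (measurableTypeR R)).

(** The form of continuity from which [measurable_seq_continuous] derives measurability. *)
Definition seq_continuous n (F : angles n -> C) := forall (s : nat -> angles n) t,
  (forall i, tnth (s k) i @[k --> \oo] --> tnth t i) -> F (s k) @[k --> \oo] --> F t.

Definition polydisc_le n (r : R) : set 'rV[R[i]]_n := [set z | forall i, normc (z ord0 i) <= r].

(* Holomorphy on the closed polydisc of radius [r], in a form that is inherited
   when one variable is frozen. *)
Definition line_holomorphic n (r : R) (f : 'rV[R[i]]_n -> C) :=
  [/\ forall z v, polydisc_le r z -> exists D, cdiff (fun l : C => f (z + l *: v)) 0 D,
      exists M, forall z, polydisc_le r z -> normc (f z) <= M &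
      seq_continuous (fun t => f (torus_point r t))].

Lemma holomorphic_line n (r : R) (f : 'rV[R[i]]_n -> C) : 0 < r < 1 ->
  (forall z : 'rV[R[i]]_n : normedModType R[i], polydisc z -> differentiable f z) ->
  line_holomorphic r f.
Proof.
move=> r01 df; have /andP[r0 r1] := r01; split.
- move=> z v zr; apply: differentiable_slice; apply: df => i.
  by rewrite normcEC -(rmorph1 (real_complex R)) ltcR (le_lt_trans (zr i)).
- exact: bounded_on_polydisc.
- move=> s t st; have := cvg_torus_point (r := r) st; apply: continuous_cvg.
  by apply: differentiable_continuous; apply: df; exact: torus_point_in_polydisc.
Qed.

Definition szego n (a z : 'rV[R[i]]_n) : C :=
  \prod_i (1 - conjc (a ord0 i) * z ord0 i)^-1.

Definition cons_row n (w : C) (z : 'rV[R[i]]_n) : 'rV[R[i]]_n.+1 :=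
  \row_i (if unlift ord0 i is Some j then z ord0 j else w).

Lemma cons_row_torus n (r t0 : R) (t : angles n) :
  cons_row (circ r t0) (torus_point r t) = torus_point r [tuple of t0 :: t].
Proof.
apply/rowP => i; rewrite !mxE; case: unliftP => [j ->|->]; last by [].
by rewrite !mxE tnthS.
Qed.

Lemma szego_cons n a0 (a : 'rV[R[i]]_n) w z :
  szego (cons_row a0 a) (cons_row w z) = (1 - conjc a0 * w)^-1 * szego a z.
Proof.
rewrite /szego big_ord_recl !mxE unlift_none; congr (_ * _).
by apply: eq_bigr => i _; rewrite !mxE liftK.
Qed.

Lemma cons_rowDZ n w u (z v : 'rV[R[i]]_n) (l : C) :
  cons_row (w + l * u) (z + l *: v) = cons_row w z + l *: cons_row u v.
Proof. by apply/rowP => i; rewrite !mxE; case: unliftP => [j _|_]; rewrite ?mxE. Qed.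

Lemma polydisc_le_cons n (r : R) w (z : 'rV[R[i]]_n) : normc w <= r -> polydisc_le r z ->
  polydisc_le r (cons_row w z).
Proof. by move=> wr zr i; rewrite !mxE; case: unliftP => [j _|_]. Qed.

Lemma normc_circ (r t : R) : 0 < r -> normc (circ r t) = r.
Proof. by move=> r0; rewrite normcM normc_expi mulr1 normcR_ge0 ?ltW. Qed.

(** The factor [c] is meant for the first factor of the conjugate Szego kernel, a constant once the
    first angle is fixed. *)
Lemma line_holomorphic_cons n (r : R) (f : 'rV[R[i]]_n.+1 -> C) (c : C) (t0 : R) :
  0 < r -> line_holomorphic r f ->
  line_holomorphic r (fun z => f (cons_row (circ r t0) z) * c).
Proof.
move=> r0 [fd [M fM] fc]; have tr : normc (circ r t0) <= r by rewrite normc_circ.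
split=> [z v zr||s t st].
- have [D [chi [fE chiD]]] := fd (cons_row (circ r t0) z) (cons_row 0 v) (polydisc_le_cons tr zr).
  exists (D * c), (fun l => chi l * c); split; last exact: (cvgM chiD (cvg_cst c)).
  near=> l; have lE m : cons_row (circ r t0) (z + m *: v) =
      cons_row (circ r t0) z + m *: cons_row 0 v by rewrite -cons_rowDZ mulr0 addr0.
  rewrite !lE -mulrBl mulrAC; congr (_ * _).
  by near: l.
- exists (M * normc c) => z zr; rewrite normcM ler_wpM2r ?normc_ge0//.
  by apply: fM; exact: polydisc_le_cons.
- rewrite cons_row_torus; under eq_fun do rewrite cons_row_torus.
  apply: (cvgM _ (cvg_cst c)); apply: fc => i.
  case: (unliftP ord0 i) => [j ->|->]; last exact: cvg_cst.
  by rewrite tnthS; under eq_fun do rewrite tnthS; exact: st.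
Unshelve. all: by end_near. Qed.

End torus_formula.

Section torus_integral.
Context {R : realType}.
Notation C := (R[i]^o).
Notation angles n := (n.-tuple (measurableTypeR R)).

Lemma normc_conj (z : R[i]) : normc (conjc z) = normc z.
Proof. by case: z => x y /=; rewrite sqrrN. Qed.

Lemma cvg_Re {T : Type} {F : set_system T} {FF : Filter F} (f : T -> C) (l : C) :
  f x @[x --> F] --> l -> complex.Re (f x) @[x --> F] --> complex.Re l.
Proof.
move=> /cvg_normcP fl; apply/cvgrPdist_le => e e0; apply: filterS (fl _ e0) => x.
by apply: le_trans; rewrite distrC -ReN -ReD; exact: normr_Re_le.
Qed.

Lemma cvg_conjc {T : Type} {F : set_system T} {FF : Filter F} (f : T -> C) (l : C) :
  f x @[x --> F] --> l -> (conjc (f x) : C) @[x --> F] --> (conjc l : C).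
Proof.
move=> /cvg_normcP fl; apply/cvg_normcP => e e0; apply: filterS (fl _ e0) => x.
by apply: le_trans; rewrite -conjc_sub normc_conj.
Qed.

Lemma szego_differentiable n (a z : 'rV[R[i]]_n) : (forall i, normc (a ord0 i) <= 1) ->
  polydisc z -> differentiable (szego a : _ -> C) (z : 'rV[R[i]]_n : normedModType R[i]).
Proof.
move=> a1 zP; rewrite /szego.
elim: (index_enum _) => [|j s IH].
  under eq_fun do rewrite big_nil; exact: differentiable_cst.
under eq_fun do rewrite big_cons.
apply: (@differentiableM _ _ (fun z : 'rV[R[i]]_n => (1 - conjc (a ord0 j) * z ord0 j)^-1 : C) _ _ _ IH).
apply: differentiableV.
  apply: differentiableB; first exact: differentiable_cst.
  by apply: differentiableM; [exact: differentiable_cst|exact: differentiable_coord].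
apply: one_sub_neq0; rewrite normcM normc_conj.
have zj : normc (z ord0 j) < 1.
  by have := zP j; rewrite normcEC -(rmorph1 (real_complex R)) ltcR.
by apply: le_lt_trans zj; rewrite ler_piMl ?normc_ge0.
Qed.

Lemma seq_continuousM n (F G : angles n -> C) : seq_continuous F -> seq_continuous G ->
  seq_continuous (fun t => F t * G t).
Proof. by move=> cF cG s t st; exact: (cvgM (cF s t st) (cG s t st)). Qed.

Lemma torus_integrable n (F : angles n -> C) M : seq_continuous F ->
  (forall t, normc (F t) <= M) ->
  (torus_measure n).-integrable setT (fun t => (complex.Re (F t))%:E).
Proof.
move=> cF FM.
have mF : measurable_fun setT (fun t : angles n => complex.Re (F t)).
  by apply: measurable_seq_continuous => s t st; apply: cvg_Re; exact: cF.
apply: (measurable_bounded_integrable (f := fun t => complex.Re (F t))) => //.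
  by rewrite (le_lt_trans (probability_le1 _ _))// ltry.
exists M; split; first exact: num_real.
by move=> x Mx y _ /=; rewrite (le_trans (normr_Re_le _))// (le_trans (FM y))// ltW.
Qed.

(** Fubini's theorem for the product that defines [torus_measure n.+1]. *)
Lemma torus_integral_cons n (G : angles n.+1 -> \bar R) :
  measurable_fun setT G -> (torus_measure n.+1).-integrable setT G ->
  (\int[torus_measure n.+1]_t G t = \int[uniform_prob (@two_pi_gt0 R)]_x
     \int[torus_measure n]_t G [tuple of x :: t])%E.
Proof.
move=> mG iG.
have mGc : measurable_fun setT (G \o @cons_angle R n).
  by apply: measurableT_comp => //; exact: measurable_cons_angle.
have iGc : (angle_product (torus_measure n)).-integrable setT (G \o @cons_angle R n).
  apply/integrableP; split => //; move/integrableP : iG => [_].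
  by rewrite /= ge0_integral_pushforward//; exact: measurableT_comp.
rewrite [LHS]/= integral_distribution//.
by rewrite -(integral12_prod_meas1 iGc).
Qed.

(** Induction on [n]: the induction hypothesis integrates over the other angles with the first one
    fixed, and [cauchy_formula] then treats the first variable. Both factors are taken on radius
    [r], whence the value at [r ^+ 2] times [a]. *)
Lemma torus_szego n (f : 'rV[R[i]]_n -> C) (a : 'rV[R[i]]_n) (r : R) : 0 < r < 1 ->
  (forall i, normc (a ord0 i) <= 1) -> line_holomorphic r f ->
  (\int[torus_measure n]_t (complex.Re
     (f (torus_point r t) * conjc (szego a (torus_point r t))))%:E =
   (complex.Re (f ((r ^+ 2)%:C *: a)))%:E)%E.
Proof.
move=> r01; have /andP[r0 r1] := r01.
elim: n => [|n IH] in f a *; move=> a1 fh.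
  have E (t : angles 0) : (complex.Re (f (torus_point r t) * conjc (szego a (torus_point r t))))%:E =
      (complex.Re (f ((r ^+ 2)%:C *: a)))%:E.
    rewrite /szego big_ord0 conjc1 mulr1; congr (complex.Re (f _))%:E.
    by apply/rowP => -[].
  under eq_integral do rewrite E.
  by rewrite integral_cst// [X in (_ * X)%E]probability_setT mule1.
pose a' := \row_j a ord0 (lift ord0 j).
have aE : a = cons_row (a ord0 ord0) a'.
  by apply/rowP => i; rewrite !mxE; case: unliftP => [j ->|->]; rewrite ?mxE.
have a'1 i : normc (a' ord0 i) <= 1 by rewrite mxE.
have [fd [M fM] fc] := fh.
have [_ [N sN] sc] := holomorphic_line (f := szego a) r01
  (fun z zP => szego_differentiable a1 zP).
pose F t := f (torus_point r t) * conjc (szego a (torus_point r t)) : C.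
have sc' : seq_continuous (fun t => conjc (szego a (torus_point r t)) : C).
  by move=> s t st; apply: cvg_conjc; exact: sc.
have cF : seq_continuous F := seq_continuousM fc sc'.
have tr (t : angles n.+1) : polydisc_le r (torus_point r t).
  by move=> i; rewrite mxE -[_ * _]/(circ r _) normc_circ.
have FM t : normc (F t) <= M * N.
  by rewrite normcM normc_conj; apply: ler_pM; rewrite ?normc_ge0//; [exact: fM|exact: sN].
have iF := torus_integrable cF FM.
rewrite torus_integral_cons//; last by have /integrableP[] := iF.
pose z' := (r ^+ 2)%:C *: a'.
have z'r : polydisc_le r z'.
  move=> i; rewrite !mxE normcM normcR_ge0 ?sqr_ge0//.
  apply: (@le_trans _ _ (r ^+ 2 * 1)); first by rewrite ler_wpM2l ?sqr_ge0.
  by rewrite mulr1 expr2 ler_piMl// ltW.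
pose h (w : C) : C := f (cons_row w z').
have inner x : (\int[torus_measure n]_t (complex.Re (f (torus_point r [tuple of x :: t]) *
     conjc (szego a (torus_point r [tuple of x :: t]))))%:E =
   (complex.Re (h (circ r x) * (1 - a ord0 ord0 * conjc (circ r x))^-1))%:E)%E.
  have -> : (1 - a ord0 ord0 * conjc (circ r x))^-1 = conjc (1 - conjc (a ord0 ord0) * circ r x)^-1 :> C.
    transitivity ((conjc (1 - conjc (a ord0 ord0) * circ r x))^-1 : C); last exact/esym/conjc_inv.
    by congr (_^-1); rewrite conjc_sub (conjc_mul (conjc (a ord0 ord0))) conjc1 conjcK.
  rewrite -(IH _ a' a'1 (line_holomorphic_cons _ _ r0 fh)).
  apply: eq_integral => t _; rewrite -cons_row_torus; congr (complex.Re _)%:E.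
  by rewrite [in LHS]aE szego_cons conjc_mul mulrA.
under eq_integral do rewrite inner.
have dh w : normc w <= r -> exists D, cdiff h w D.
  move=> wr; apply: cdiff_shift.
  have [D fD] := fd (cons_row w z') (cons_row 1 0) (polydisc_le_cons wr z'r).
  exists D; rewrite (_ : (fun l => h (w + l)) = (fun l => f (cons_row w z' + l *: cons_row 1 0)))//.
  by apply/funext => l; rewrite -cons_rowDZ mulr1 scaler0 addr0.
have circ1 x : normc (conjc (a ord0 ord0) * circ r x) < 1.
  rewrite normcM normc_conj normc_circ//; apply: le_lt_trans r1.
  by rewrite ler_piMl// ltW.
have circ_cvg x : circ r y @[y --> x] --> circ r x.
  apply: (cvgM (cvg_cst (r%:C : C))); apply: cvg_cpx; [exact: continuous_cos|exact: continuous_sin].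
pose k (v : C) : C := 1 * (1 - conjc (a ord0 ord0) * v)^-1.
have kE x : (1 - a ord0 ord0 * conjc (circ r x))^-1 = conjc (k (circ r x)) :> C.
  rewrite /k mul1r.
  transitivity ((conjc (1 - conjc (a ord0 ord0) * circ r x))^-1 : C); last exact/esym/conjc_inv.
  by congr (_^-1); rewrite conjc_sub (conjc_mul (conjc (a ord0 ord0))) conjc1 conjcK.
have kM x : normc (k (circ r x)) <= (1 - r)^-1.
  rewrite /k mul1r normcV lef_pV2 ?posrE ?subr_gt0//; last first.
    by rewrite -ltcR -normcEC normr_gt0 one_sub_neq0.
  have := le_normcD (1 - conjc (a ord0 ord0) * circ r x) (conjc (a ord0 ord0) * circ r x).
  rewrite subrK normc1 normcM normc_conj normc_circ//.
  have : normc (a ord0 ord0) * r <= r by rewrite ler_piMl// ltW.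
  lra.
pose G x := complex.Re (h (circ r x) * (1 - a ord0 ord0 * conjc (circ r x))^-1).
have GM x : `|G x| <= M * (1 - r)^-1.
  rewrite (le_trans (normr_Re_le _))// normcM kE normc_conj.
  apply: ler_pM; rewrite ?normc_ge0//; apply: fM; apply: polydisc_le_cons => //.
  by rewrite normc_circ.
have cG : continuous G.
  move=> x; have [D hD] := dh (circ r x) ltac:(by rewrite normc_circ).
  have [D' kD] := cdiff_inv_affine 1 (one_sub_neq0 (circ1 x)).
  have hx : h (circ r y) @[y --> x] --> h (circ r x).
    by move=> A /(cdiff_continuous hD) /circ_cvg.
  have kx : k (circ r y) @[y --> x] --> k (circ r x).
    by move=> A /(cdiff_continuous kD) /circ_cvg.
  have hk : (h (circ r y) * conjc (k (circ r y)) : C) @[y --> x] -->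
    (h (circ r x) * conjc (k (circ r x)) : C).
    by have := cvgM hx (cvg_conjc kx); apply.
  have GE : G = fun y => complex.Re (h (circ r y) * conjc (k (circ r y)) : C).
    by apply/funext => y; rewrite /G kE.
  by rewrite GE; exact: cvg_Re hk.
rewrite (uniform_mean GM cG) (cauchy_formula r01 (a1 ord0) dh).
rewrite mulKf ?gt_eqF ?two_pi_gt0//; congr (complex.Re (f _))%:E.
apply/rowP => i; rewrite !mxE; case: unliftP => [j ->|->]; by rewrite ?mxE.
Qed.

End torus_integral.

(** Needed because an extension by 0 agrees with the given function only on the polydisc. *)
Lemma near_eq_differentiable (K : numFieldType) (V W : normedModType K)
    (f g : V -> W) (x : V) :
  {near x, f =1 g} -> differentiable f x -> differentiable g x.
Proof.
move=> fg /[dup] df /diff_locallyP[dfc /eqaddoP fE].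
have e : g \o shift x = cst (g x) + 'd f x +o_ 0 id.
  apply/eqaddoP => eps eps0; have feps := fE eps eps0.
  have fg0 : \forall h \near (0 : V), f (x + h) = g (x + h) by exact: (proj1 (nbhs0P (fun y => f y = g y) x) fg).
  near=> h.
  have : `|f (h + x) - (f x + 'd f x h)| <= eps * `|h| by near: h.
  rewrite /= -[(_ - _) h]/(g (h + x) - (g x + 'd f x h)).
  have <- : f (h + x) = g (h + x) by rewrite addrC; near: h.
  by rewrite (nbhs_singleton fg).
by apply/diff_locallyP; rewrite (diff_unique dfc e).
Unshelve. all: by end_near. Qed.

(** * Building bounded holomorphic functions *)

Section Hinf_construction.
Context {R : realType} {n : nat}.
Notation C := (R[i]^o).
Implicit Types (z w v : 'rV[R[i]]_n).

Lemma polydiscE z : polydisc z <-> forall i, normc (z ord0 i) < 1.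
Proof.
by split=> zP i; have := zP i; rewrite normcEC -(rmorph1 (real_complex R)) ltcR.
Qed.

Lemma polydisc_open z : polydisc z -> \forall y \near (z : 'rV[R[i]]_n : normedModType R[i]), polydisc y.
Proof.
move=> /polydiscE zP.
have : \forall y \near (z : 'rV[R[i]]_n : normedModType R[i]),
      forall i, normc ((y : 'rV[R[i]]_n) ord0 i) < 1.
  apply: (@filter_forall _ _ (fun i (y : 'rV[R[i]]_n) => normc (y ord0 i) < 1)
    (nbhs (z : 'rV[R[i]]_n : normedModType R[i])) _) => i.
  have /cvg_normcP := @coord_continuous C 1 n ord0 i z.
  have e0 : 0 < (1 - normc (z ord0 i)) / 2 by rewrite divr_gt0// subr_gt0.
  move=> /(_ _ e0); apply: filterS => y.
  have := le_normcD (y ord0 i - z ord0 i) (z ord0 i); rewrite subrK.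
  by have := zP i; lra.
by apply: filterS => y /polydiscE.
Qed.

Lemma Hinf_extension (f : 'rV[R[i]]_n -> C) (M : R) :
  (forall z : 'rV[R[i]]_n : normedModType R[i], polydisc z -> differentiable f z) ->
  (forall z, polydisc z -> normc (f z) <= M) ->
  exists F : Hinf R n, forall z, polydisc z -> F z = f z.
Proof.
move=> df fM; pose F z : C := if `[< polydisc z >] then f z else 0.
have FE z : polydisc z -> F z = f z by rewrite /F => /asboolP ->.
have M0 : 0 <= M by apply: le_trans (fM _ (@polydisc0 R n)); exact: normc_ge0.
have FH : F \in @bounded_holomorphic R n.
  apply/asboolP; split; last first.
    exists M => z; rewrite /F; case: asboolP => [/fM//|_]; by rewrite normc0.
  split=> z zP; last by rewrite /F; case: asboolP.
  apply: near_eq_differentiable (df z zP).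
  by apply: filterS (polydisc_open zP) => y yP; rewrite FE.
by exists (MkHinf FH).
Qed.

Lemma Hinf_one : exists F : Hinf R n, forall z, polydisc z -> F z = 1.
Proof.
apply: (@Hinf_extension (cst 1) 1) => z zP; first exact: differentiable_cst.
by rewrite normc1.
Qed.

Lemma Hinf_differentiable (F : Hinf R n) (z : 'rV[R[i]]_n : normedModType R[i]) :
  polydisc z -> differentiable F z.
Proof. by have [+ _] := Hinf_holomorphic F; apply. Qed.

Lemma Hinf_rnorm (F : Hinf R n) : rnorm F = Hinf_norm F.
Proof. by []. Qed.

End Hinf_construction.

(** * Almost contractive multiples of [phi] close to 1 at a point *)

Section approximants.
Context {R : realType} {n : nat} (phi : Hinf R n).
Notation C := (R[i]^o).
Implicit Types (z w v : 'rV[R[i]]_n).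
Hypothesis Mphi : M_ideal (principal_ideal phi).

Lemma phi_in_ideal : principal_ideal phi phi.
Proof.
have [one oneE] := @Hinf_one R n; apply: subset_closure; exists one => //.
apply/val_inj/funext => z /=; have [zP|zP] := pselect (polydisc z).
  by rewrite oneE// mulr1.
by have [_ ->//] := Hinf_holomorphic phi; rewrite mul0r.
Qed.

Lemma normc_sqr (z : R[i]) : normc z ^+ 2 = complex.Re z ^+ 2 + complex.Im z ^+ 2.
Proof. by case: z => x y; rewrite /= sqr_sqrtr// addr_ge0// sqr_ge0. Qed.

Lemma normc_parallelogram (x y : R[i]) (M : R) :
  normc (x + y) <= M -> normc (x - y) <= M ->
  normc x ^+ 2 + normc y ^+ 2 <= M ^+ 2.
Proof.
move=> h1 h2; have M0 : 0 <= M by apply: le_trans h1; exact: normc_ge0.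
have : normc (x + y) ^+ 2 <= M ^+ 2 by rewrite lerXn2r ?nnegrE ?normc_ge0.
have : normc (x - y) ^+ 2 <= M ^+ 2 by rewrite lerXn2r ?nnegrE ?normc_ge0.
rewrite !normc_sqr; case: x y {h1 h2} => [a b] [c d] /=; nra.
Qed.

(* The two-ball property at the unit: [y] lies in the disc of centre 1 and
   radius [1 + e], and well inside it where [phi] is not small. *)
Lemma ideal_element (e : R) : phi != 0 -> 0 < e -> exists2 y : Hinf R n, principal_ideal phi y &
  forall z, polydisc z -> normc (1 - y z) ^+ 2 +
    (normc (phi z) / Hinf_norm phi) ^+ 2 <= (1 + e) ^+ 2.
Proof.
move=> phi0 e0; have [[cJ [J0 JZ]] _] := Mphi.
have [one oneE] := @Hinf_one R n.
have np0 : 0 < Hinf_norm phi.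
  rewrite lt_neqAle eq_sym; apply/andP; split.
    by apply: contra phi0 => /eqP h; apply/eqP/Hinf_norm_eq0; rewrite h.
  by apply: le_trans (Hinf_norm_ub phi 0); exact: normc_ge0.
pose psi := ((Hinf_norm phi)^-1)%:C *: phi.
have Jpsi : principal_ideal phi psi.
  by rewrite -[psi]addr0; apply: JZ => //; exact: phi_in_ideal.
have one1 : rnorm one <= 1.
  rewrite Hinf_rnorm; apply: Hinf_norm_le => z; have [zP|zP] := pselect (polydisc z).
    by rewrite oneE// normc1.
  by have [_ ->//] := Hinf_holomorphic one; rewrite normc0.
have psi1 : rnorm psi <= 1.
  by rewrite rnormZ normcR_ge0 ?invr_ge0 ?(ltW np0)// Hinf_rnorm mulVf ?gt_eqF//.
have [y Jy [y1 y2]] := M_ideal_two_ball Mphi Jpsi one1 psi1 e0.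
exists y => // z zP.
have -> : normc (phi z) / Hinf_norm phi = normc (psi z).
  rewrite [psi z]/(((Hinf_norm phi)^-1)%:C * phi z) normcM normcR_ge0 ?invr_ge0 ?ltW//.
  by rewrite mulrC.
apply: normc_parallelogram.
  apply: le_trans y1; rewrite Hinf_rnorm; apply: le_trans (Hinf_norm_ub _ z).
  rewrite [(one + psi - y) z]/(one z + psi z - y z) oneE//.
  by rewrite addrAC.
apply: le_trans y2; rewrite Hinf_rnorm; apply: le_trans (Hinf_norm_ub _ z).
rewrite [(one - psi - y) z]/(one z - psi z - y z) oneE//.
by rewrite addrAC.
Qed.

Lemma ideal_approx (y : Hinf R n) (t : R) : 0 < t -> principal_ideal phi y ->
  exists g : Hinf R n, forall z, normc (y z - phi z * g z) <= t.
Proof.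
move=> t0 /(_ (ball y t%:C)) []; first by apply: nbhsx_ballx; rewrite ltcR.
move=> _ [[g _ <-]]; rewrite -ball_normE /= => yg; exists g => z.
have : Hinf_norm (y - Hinf_mul phi g) <= t.
  by apply: ltW; rewrite -ltcR.
by apply: le_trans; exact: (Hinf_norm_ub (y - Hinf_mul phi g) z).
Qed.

(* [y / (y + eta)] is a contraction because [Re (1 / y) >= 1 / 2] when [y] is in
   the disc of centre and radius 1. *)
Lemma contraction_estimate (y : R[i]) (e eta : R) : 0 < eta -> 0 < e ->
  2 * e + e ^+ 2 <= eta / 2 -> normc (1 - y) ^+ 2 <= (1 + e) ^+ 2 ->
  normc y <= normc (y + eta%:C) /\ eta / 2 <= normc (y + eta%:C).
Proof.
move=> eta0 e0 he; rewrite normc_sqr => h.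
have sq (x : R) (w : R[i]) : 0 <= x -> x ^+ 2 <= normc w ^+ 2 -> x <= normc w.
  by move=> x0; rewrite ler_pXn2r ?nnegrE ?normc_ge0.
(* The hypotheses give [2 * Re y >= |y|^2 - eta / 2], hence [|y + eta|^2 >= |y|^2 + eta^2 / 2],
   which yields both claims. *)
split; apply: sq; rewrite ?divr_ge0 ?normc_ge0 ?(ltW eta0)// !normc_sqr; move: h;
  case: y => a b /= h; nra.
Qed.

Lemma approximant z0 (d : R) : phi z0 != 0 -> 0 < d -> exists u : Hinf R n,
  (forall z, normc (phi z * u z) <= 1 + d) /\ normc (1 - phi z0 * u z0) <= d.
Proof.
move=> phiz0 d0; have phi0 : phi != 0.
  by apply: contra phiz0 => /eqP ->.
have z0P : polydisc z0.
  have [//|zP] := pselect (polydisc z0).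
  by move: phiz0; have [_ ->//] := Hinf_holomorphic phi; rewrite eqxx.
have np0 : 0 < Hinf_norm phi.
  rewrite lt_neqAle eq_sym; apply/andP; split.
    by apply: contra phi0 => /eqP h; apply/eqP/Hinf_norm_eq0; rewrite h.
  by apply: le_trans (Hinf_norm_ub phi 0); exact: normc_ge0.
have nz0 : 0 < normc (phi z0) by rewrite -ltcR -normcEC normr_gt0.
pose s := normc (phi z0) / Hinf_norm phi; pose t := s ^+ 2.
have s0 : 0 < s by rewrite divr_gt0.
have t0 : 0 < t by rewrite exprn_gt0.
(* At [z0], [1 - y / (y + eta)] is [eta / (y + eta)]. Since [e <= t / 6], the bound of
   [ideal_element] gives [Re (y z0) >= t / 4], so this quotient is at most [4 * eta / t = d / 2] in
   modulus. The bound [e <= eta / 6] serves [contraction_estimate]. *)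
pose eta := d * t / 8; have eta0 : 0 < eta by rewrite divr_gt0 ?ltr0n// mulr_gt0.
pose e := Num.min 1 (Num.min (eta / 6) (t / 6)).
have e0 : 0 < e by rewrite !lt_min ltr01 (divr_gt0 eta0) ?(divr_gt0 t0) ?ltr0n.
have e1 : e <= 1 by rewrite ge_min lexx.
have e2 : e <= eta / 6 by rewrite !ge_min lexx orbT.
have e3 : e <= t / 6 by rewrite !ge_min lexx !orbT.
have esq : e ^+ 2 <= e by rewrite expr2 ler_piMl// ltW.
have [y Jy yE] := ideal_element phi0 e0.
have he : 2 * e + e ^+ 2 <= eta / 2 by clearbody e; lra.
have est z : polydisc z -> normc (y z) <= normc (y z + eta%:C) /\
    eta / 2 <= normc (y z + eta%:C).
  move=> zP; apply: (contraction_estimate eta0 e0 he).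
  by apply: le_trans (yE z zP); rewrite lerDl sqr_ge0.
have yn0 z : polydisc z -> y z + eta%:C != 0.
  move=> zP; apply/eqP => y0; have [_] := est z zP; rewrite y0 normc0.
  by rewrite leNgt divr_gt0.
have [h hE] : exists h : Hinf R n, forall z, polydisc z -> h z = (y z + eta%:C)^-1.
  apply: (@Hinf_extension _ _ (fun z => (y z + eta%:C)^-1 : C) (eta / 2)^-1) => z zP.
    apply: differentiableV; last exact: yn0.
    by apply: differentiableD; [exact: Hinf_differentiable|exact: differentiable_cst].
  have [_ hy] := est z zP; have h2 : 0 < eta / 2 by exact: divr_gt0.
  by rewrite normcV lef_pV2 ?posrE// (lt_le_trans h2).
pose N := Hinf_norm h + 1.
have N0 : 0 < N by rewrite ltr_wpDl// (le_trans _ (Hinf_norm_ub h 0))// normc_ge0.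
have hN z : normc (h z) <= N by rewrite (le_trans (Hinf_norm_ub h z))// lerDl.
(* The error in approximating [y] by [phi * g] is later multiplied by [h], of modulus at most [N];
   this leaves the other [d / 2] for the value at [z0]. *)
have dN : 0 < d / 2 / N by rewrite !divr_gt0//.
have [g gE] := ideal_approx dN Jy.
have close z : polydisc z -> normc (y z * h z - phi z * (Hinf_mul g h) z) <= d / 2.
  move=> zP; rewrite -[(Hinf_mul g h) z]/(g z * h z) mulrA -mulrBl normcM.
  by rewrite -[leRHS](divfK (lt0r_neq0 N0)); apply: ler_pM; rewrite ?normc_ge0 ?gE ?hN.
have yh z : polydisc z -> normc (y z * h z) <= 1.
  move=> zP; rewrite hE// normcM normcV ler_pdivrMr; first by rewrite mul1r; have [] := est z zP.
  by have [_] := est z zP; apply: lt_le_trans; rewrite divr_gt0.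
exists (Hinf_mul g h); split.
  move=> z; have [zP|zP] := pselect (polydisc z); last first.
    by have [_ ->//] := Hinf_holomorphic phi; rewrite mul0r normc0 addr_ge0// ltW.
  have := le_normcD (- (y z * h z - phi z * (Hinf_mul g h) z)) (y z * h z).
  rewrite normcN opprB subrK; have := close z zP; have := yh z zP; lra.
have k0 : normc (1 - y z0 * h z0) <= d / 2.
  rewrite hE//; have yn := yn0 _ z0P.
  have -> : 1 - y z0 * (y z0 + eta%:C)^-1 = eta%:C * (y z0 + eta%:C)^-1.
    by rewrite -[1](divff yn) -mulrBl addrAC subrr add0r.
  rewrite normcM normcV normcR_ge0 ?(ltW eta0)// ler_pdivrMr; last first.
    by have [_] := est z0 z0P; apply: lt_le_trans; rewrite divr_gt0.
  have := yE z0 z0P; rewrite -/s -/t normc_sqr => yt.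
  apply: (@le_trans _ _ (d / 2 * (t / 4))); first by rewrite /eta; lra.
  rewrite ler_pM2l ?divr_gt0//; apply: le_trans (normr_Re_le _).
  apply: le_trans (ler_norm _).
  move: yt; case: (y z0) => a b /=; have := sqr_ge0 a; have := sqr_ge0 b.
  by move: e1 e3 esq eta0 t0; clearbody e t eta; nra.
have := le_normcD (1 - y z0 * h z0) (y z0 * h z0 - phi z0 * (Hinf_mul g h) z0).
rewrite addrA subrK; have := close z0 z0P; move: k0; lra.
Qed.

End approximants.

(** * Mean-square bounds and point evaluations *)

Section mean_bounds.
Context {R : realType}.
Notation C := (R[i]^o).
Notation angles n := (n.-tuple (measurableTypeR R)).

Lemma Re_realMl (a : R) (y : R[i]) : complex.Re (a%:C * y) = a * complex.Re y.
Proof. by case: y => y1 y2 /=; rewrite mul0r subr0. Qed.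

Lemma szego0 n (z : 'rV[R[i]]_n) : szego 0 z = 1 :> C.
Proof. by rewrite /szego big1// => i _; rewrite mxE conjc0 mul0r subr0 invr1. Qed.

Lemma polydisc_le_torus n (r : R) (t : angles n) : 0 < r -> polydisc_le r (torus_point r t).
Proof. by move=> r0 i; rewrite mxE -[_ * _]/(circ r _) normc_circ. Qed.

Lemma torus_mean n (f : 'rV[R[i]]_n -> C) (r : R) : 0 < r < 1 -> line_holomorphic r f ->
  (\int[torus_measure n]_t (complex.Re (f (torus_point r t)))%:E = (complex.Re (f 0))%:E)%E.
Proof.
move=> r01 fh; have a1 (i : 'I_n) : normc ((0 : 'rV[R[i]]_n) ord0 i) <= 1 by rewrite mxE normc0.
have := torus_szego r01 a1 fh; rewrite scaler0 => <-.
by apply: eq_integral => t _; rewrite szego0 conjc1 mulr1.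
Qed.

Lemma Re_mul_conj (z : R[i]) : complex.Re (z * conjc z) = normc z ^+ 2.
Proof. by rewrite normc_sqr; case: z => x y /=; ring. Qed.

Lemma normc_sqr_integrable n (f : 'rV[R[i]]_n -> C) (r : R) : 0 < r -> line_holomorphic r f ->
  (torus_measure n).-integrable setT (fun t => (normc (f (torus_point r t)) ^+ 2)%:E).
Proof.
move=> r0 [_ [M fM] fc].
have fc' : seq_continuous (fun t => conjc (f (torus_point r t)) : C).
  by move=> s t st; apply: cvg_conjc; exact: fc.
have b t : normc (f (torus_point r t) * conjc (f (torus_point r t))) <= M * M.
  have fMt := fM _ (polydisc_le_torus t r0).
  by rewrite normcM normc_conj; apply: ler_pM; rewrite ?normc_ge0.
have := torus_integrable (seq_continuousM fc fc') b.
by under eq_fun do rewrite Re_mul_conj.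
Qed.

Lemma Re_integrable n (f : 'rV[R[i]]_n -> C) (r : R) : 0 < r -> line_holomorphic r f ->
  (torus_measure n).-integrable setT (fun t => (complex.Re (f (torus_point r t)))%:E).
Proof.
move=> r0 [_ [M fM] fc]; apply: torus_integrable fc _ => t.
by apply: fM; exact: polydisc_le_torus.
Qed.

Lemma Re_le_normc (z : R[i]) : complex.Re z <= normc z.
Proof. by apply: le_trans (ler_norm _) (normr_Re_le z). Qed.

Lemma le_AMGM (x s : R) : 0 < s -> x <= s + x ^+ 2 / s.
Proof.
move=> s0; rewrite -(ler_pM2r s0) mulrDl divfK ?gt_eqF//.
by have := sqr_ge0 (x - s); have := sqr_ge0 x; have := sqr_ge0 s; nra.
Qed.

(* The reproducing formula and the Cauchy-Schwarz inequality, in the form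
   [x <= s + x^2 / s]. *)
Lemma point_bound n (f : 'rV[R[i]]_n -> C) (a : 'rV[R[i]]_n) (r s B m : R) :
  0 < r < 1 -> (forall i, normc (a ord0 i) <= 1) -> line_holomorphic r f ->
  (forall t : angles n, normc (szego a (torus_point r t)) <= B) -> 0 < s ->
  (circular_mean f r <= m%:E)%E ->
  complex.Re (f ((r ^+ 2)%:C *: a)) <= B * (s + m / s).
Proof.
move=> r01 a1 fh sB s0 fm; have /andP[r0 r1] := r01.
have B0 : 0 <= B by apply: le_trans (sB [tuple of nseq n 0]); exact: normc_ge0.
rewrite -lee_fin -(torus_szego r01 a1 fh).
have iq := normc_sqr_integrable r0 fh.
have ic : (torus_measure n).-integrable setT (EFin \o cst (B * s)).
  exact: finite_measure_integrable_cst.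
apply: (@le_trans _ _ (\int[torus_measure n]_t ((B * s)%:E +
    (B / s)%:E * (normc (f (torus_point r t)) ^+ 2)%:E))%E).
  have [_ [M fM] fc] := fh.
  have [_ _ sc] := holomorphic_line (f := szego a) r01
    (fun z zP => szego_differentiable a1 zP).
  have sc' : seq_continuous (fun t => conjc (szego a (torus_point r t)) : C).
    by move=> u t ut; apply: cvg_conjc; exact: sc.
  apply: le_integral => //.
  - apply: (torus_integrable (seq_continuousM fc sc') (M := M * B)) => t.
    by rewrite normcM normc_conj; apply: ler_pM; rewrite ?normc_ge0//; apply: fM; exact: polydisc_le_torus.
  - by apply: integrableD => //; exact: integrableZl.
  move=> t _; rewrite -EFinM -EFinD lee_fin (le_trans (Re_le_normc _))//.
  rewrite normcM normc_conj mulrC.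
  apply: (@le_trans _ _ (B * normc (f (torus_point r t)))); first by rewrite ler_wpM2r ?normc_ge0.
  by rewrite -mulrA -mulrDr ler_wpM2l// [s^-1 * _]mulrC le_AMGM.
rewrite integralD//=; last exact: integrableZl.
rewrite integralZl// integral_cst// [X in ((B * s)%:E * X)%E]probability_setT mule1.
have -> : B * (s + m / s) = B * s + B / s * m by ring.
rewrite EFinD leeD2l// [(B / s * m)%:E]EFinM.
by rewrite lee_wpmul2l// lee_fin divr_ge0// ltW.
Qed.

Lemma mean_sq_bound n (f : 'rV[R[i]]_n -> C) (r d : R) : 0 < r < 1 -> 0 < d -> d <= 1 ->
  (forall z : 'rV[R[i]]_n : normedModType R[i], polydisc z -> differentiable f z) ->
  (forall z, polydisc z -> normc (1 - f z) <= 1 + d) ->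
  (circular_mean f r <= (2 * complex.Re (f 0) + 3 * d)%:E)%E.
Proof.
move=> r01 d0 d1 df f1; have /andP[r0 r1] := r01.
pose g z : C := 2%:C * f z + (3 * d)%:C.
have dg (z : 'rV[R[i]]_n : normedModType R[i]) : polydisc z -> differentiable g z.
  move=> zP; apply: differentiableD; last exact: differentiable_cst.
  by apply: differentiableM; [exact: differentiable_cst|exact: df].
have gE z : complex.Re (g z) = 2 * complex.Re (f z) + 3 * d.
  by rewrite /g ReD Re_realMl.
have gh := holomorphic_line r01 dg; have fh := holomorphic_line r01 df.
rewrite -gE -(torus_mean r01 gh); apply: le_integral => //.
- exact: normc_sqr_integrable.
- exact: Re_integrable.
move=> t _; rewrite lee_fin gE.
have tP := torus_point_in_polydisc t r01.
have : normc (1 - f (torus_point r t)) ^+ 2 <= (1 + d) ^+ 2.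
  by rewrite ler_pXn2r ?nnegrE ?normc_ge0 ?f1// addr_ge0// ltW.
rewrite !normc_sqr; case: (f _) => x y /=; nra.
Qed.

End mean_bounds.

(** * [phi] has no zero in the polydisc *)

Section nonvanishing.
Context {R : realType} {n : nat} (phi : Hinf R n).
Notation C := (R[i]^o).
Hypothesis Mphi : M_ideal (principal_ideal phi).

(** On the disc of points [w + x v], the function [1 - phi * u] is small at the centre and equals 1
    at the zeros of [phi]. The number [1 / 4] is [r ^+ 2] for the radius [r = 1 / 2] in
    [point_bound]. *)
Lemma nonvanishing_step (w v : 'rV[R[i]]_n) : polydisc w ->
  (forall i, normc (w ord0 i) + normc (v ord0 i) <= 1) ->
  phi w != 0 -> phi (w + (1 / 4)%:C *: v) != 0.
Proof.
move=> /polydiscE wP wv phiw.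
(* The mean square is at most [5 * d]. With the kernel bound 2 and [s = 1 / 4], [point_bound] gives
   [2 * (1 / 4 + 20 * d) = 3 / 4], which is less than 1. *)
pose d : R := 1 / 160; have d0 : 0 < d by rewrite /d; lra.
have [u [u1 uw]] := approximant Mphi phiw d0.
pose L (x : 'rV[R[i]]_1) := w + x ord0 ord0 *: v.
have LP x : polydisc x -> polydisc (L x).
  move=> /polydiscE /(_ ord0) x1; apply/polydiscE => i; rewrite !mxE.
  apply: (le_lt_trans (le_normcD _ _)); rewrite normcM.
  have := wP i; have := wv i; have := normc_ge0 (v ord0 i); have := normc_ge0 (x ord0 ord0).
  move: x1; move: (normc _) (normc _) (normc _) => p q s; nra.
have dL (x : 'rV[R[i]]_1 : normedModType R[i]) :
    differentiable (L : _ -> 'rV[R[i]]_n : normedModType R[i]) x.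
  apply: differentiableD; first exact: differentiable_cst.
  by apply: differentiableZl; exact: differentiable_coord.
pose f x : C := 1 - phi (L x) * u (L x).
have df (x : 'rV[R[i]]_1 : normedModType R[i]) : polydisc x -> differentiable f x.
  move=> xP; apply: differentiableB; first exact: differentiable_cst.
  by apply: differentiableM; apply: differentiable_comp => //;
    apply: Hinf_differentiable; exact: LP.
have f1 x : polydisc x -> normc (1 - f x) <= 1 + d.
  by move=> _; rewrite /f opprB addrC subrK.
have r01 : 0 < (1 / 2 : R) < 1 by apply/andP; split; lra.
have d1 : d <= 1 by rewrite /d; lra.
have ms := mean_sq_bound r01 d0 d1 df f1.
pose a : 'rV[R[i]]_1 := const_mx 1.
have a1 i : normc (a ord0 i) <= 1 by rewrite mxE normc1.
have sB (t : 1.-tuple (measurableTypeR R)) : normc (szego a (torus_point (1 / 2) t)) <= 2.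
  have tE : torus_point (1 / 2) t ord0 ord0 = circ (1 / 2) (tnth t ord0) by rewrite mxE.
  rewrite /szego big_ord1 tE mxE conjc1 (mul1r (circ _ _ : C)) normcV.
  have r0 : 0 < (1 / 2 : R) by lra.
  have := le_normcD (1 - circ (1 / 2) (tnth t ord0)) (circ (1 / 2) (tnth t ord0)).
  rewrite subrK normc1 normc_circ// => h.
  rewrite -[leRHS]invrK lef_pV2 ?posrE; lra.
have s0 : 0 < (4^-1 : R) by lra.
have := point_bound r01 a1 (holomorphic_line r01 df) sB s0 ms.
apply: contraTN => /eqP phi0.
have -> : f (((1 / 2) ^+ 2)%:C *: a) = 1.
  rewrite /f; have -> : L (((1 / 2) ^+ 2)%:C *: a) = w + (1 / 4)%:C *: v.
    rewrite /L !mxE mulr1; congr (_ + _%:C *: _).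
    by rewrite expr2; field.
  by rewrite phi0 mul0r subr0.
have L0 : L 0 = w by rewrite /L mxE scale0r addr0.
have : complex.Re (f 0) <= d by rewrite /f L0 (le_trans (Re_le_normc _)).
by rewrite -ltNge (_ : complex.Re 1 = 1 :> R)// invrK /d; lra.
Qed.

(** The segment from [p] to [q] stays in a smaller polydisc of radius [m], so it can be covered by
    equal steps short enough for [nonvanishing_step]. *)
Lemma nonvanishing (p q : 'rV[R[i]]_n) : polydisc p -> polydisc q ->
  phi p != 0 -> phi q != 0.
Proof.
move=> /polydiscE pP /polydiscE qP phip.
have [m m1 hm] : exists2 m : R, m < 1 & forall i, normc (p ord0 i) <= m /\ normc (q ord0 i) <= m.
  pose m := \big[Num.max/0]_i Num.max (normc (p ord0 i)) (normc (q ord0 i)).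
  exists m; first by apply/bigmax_ltP; split => // i _; rewrite gt_max pP qP.
  by move=> i; have := @le_bigmax _ _ _ 0 (fun i => Num.max (normc (p ord0 i)) (normc (q ord0 i))) i;
    rewrite ge_max => /andP.
(* [8] is [4 * 2]: the direction given to [nonvanishing_step] is four times the increment, and the
   coordinates of [q - p] have modulus at most 2. *)
have [N N8] : exists N : nat, 8 / (1 - m) <= N.+1%:R.
  exists (Num.truncn (8 / (1 - m))); exact/ltW/truncnS_gt.
have N0 : 0 < N.+1%:R :> R by [].
pose w (j : nat) := p + (j%:R / N.+1%:R)%:C *: (q - p).
have wm j i : (j <= N.+1)%N -> normc (w j ord0 i) <= m.
  move=> jN; rewrite !mxE.
  have t0 : 0 <= j%:R / N.+1%:R :> R by rewrite divr_ge0.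
  have t1 : j%:R / N.+1%:R <= 1 :> R by rewrite ler_pdivrMr// mul1r ler_nat.
  move: (j%:R / _) t0 t1 => t t0 t1.
  have -> : p ord0 i + t%:C * (q ord0 i - p ord0 i) = (1 - t)%:C * p ord0 i + t%:C * q ord0 i.
    by rewrite rmorphB rmorph1; ring.
  apply: (le_trans (le_normcD _ _)); rewrite !normcM !normcR_ge0 ?subr_ge0//.
  have [h1 h2] := hm i; nra.
suff H j : (j <= N.+1)%N -> phi (w j) != 0.
  by have := H N.+1 (leqnn _); rewrite /w (divff (lt0r_neq0 N0)) -[X in p + X]/((1 : R[i]) *: (q - p)) scale1r addrC subrK.
elim: j => [|j IH] jN; first by rewrite /w mul0r -[X in p + X]/((0 : R[i]) *: (q - p)) scale0r addr0.
have := @nonvanishing_step (w j) ((4 / N.+1%:R)%:C *: (q - p)).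
rewrite scalerA -rmorphM (_ : 1 / 4 * (4 / N.+1%:R) = N.+1%:R^-1); last by field; rewrite gt_eqF.
have -> : w j + (N.+1%:R^-1)%:C *: (q - p) = w j.+1.
  by rewrite /w -addrA -scalerDl -rmorphD -[j.+1%:R]natr1 mulrDl mul1r.
apply; last by apply: IH; exact: ltnW.
  by apply/polydiscE => i; apply: le_lt_trans m1; apply: wm; exact: ltnW.
move=> i; have wi := wm j i (ltnW jN).
have -> : ((4 / N.+1%:R)%:C *: (q - p)) ord0 i = (4 / N.+1%:R)%:C * (q ord0 i - p ord0 i).
  by rewrite !mxE.
rewrite normcM normcR_ge0 ?divr_ge0//.
have qp : normc (q ord0 i - p ord0 i) <= 2.
  apply: (le_trans (le_normcD _ _)); rewrite normcN.
  by have := ltW (pP i); have := ltW (qP i); lra.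
have step8 : 4 / N.+1%:R * 2 <= 1 - m.
  rewrite mulrAC -natrM ler_pdivrMr// -ler_pdivrMl ?subr_gt0// mulrC.
  exact: N8.
apply: le_trans (lerD wi (le_trans _ step8)) _; first by rewrite ler_wpM2l ?divr_ge0.
by rewrite addrC subrK.
Qed.

End nonvanishing.

(** * The norm of H^2 *)

Section H2_norm.
Context {R : realType} {n : nat}.
Notation C := (R[i]^o).
Implicit Types (f g : H2 R n) (r : R).

Lemma H2_holomorphic f : holomorphic f.
Proof. by have /asboolP[] := H2P f. Qed.

Lemma H2_differentiable f (z : 'rV[R[i]]_n : normedModType R[i]) :
  polydisc z -> differentiable f z.
Proof. by have [+ _] := H2_holomorphic f; apply. Qed.

Lemma H2_line f r : 0 < r < 1 -> line_holomorphic r f.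
Proof. by move=> r01; apply: holomorphic_line => // z; exact: H2_differentiable. Qed.

Lemma H2_supE f : H2_sup f = (H2_norm f ^+ 2)%:E.
Proof.
have /asboolP[_ fin] := H2P f.
have h0 : (0 <= H2_sup f)%E.
  apply: (@le_trans _ _ (circular_mean f (1 / 2))); first exact: circular_mean_ge0.
  by apply: ereal_sup_ubound; exists (1 / 2) => //=; apply/andP; split; lra.
by rewrite sqr_sqrtr ?fine_ge0// fineK// ge0_fin_numE.
Qed.

Lemma circular_mean_le f r : 0 < r < 1 -> (circular_mean f r <= (H2_norm f ^+ 2)%:E)%E.
Proof. by move=> r01; rewrite -H2_supE; apply: ereal_sup_ubound; exists r. Qed.

Lemma H2_norm_le f (c : R) : (forall r, 0 < r < 1 -> (circular_mean f r <= c%:E)%E) ->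
  H2_norm f ^+ 2 <= c.
Proof.
by move=> fc; rewrite -lee_fin -H2_supE; apply: ge_ereal_sup => _ [r r01 <-]; exact: fc.
Qed.

Lemma circular_meanE f r : 0 < r < 1 ->
  circular_mean f r = (fine (circular_mean f r))%:E.
Proof.
move=> r01; rewrite fineK// ge0_fin_numE ?circular_mean_ge0//.
by apply: le_lt_trans (circular_mean_le f r01) _; exact: ltry.
Qed.

Lemma H2_eqP f : (forall z, polydisc z -> f z = 0) -> f = 0.
Proof.
move=> f0; apply/val_inj/funext => z /=; have [/f0//|zP] := pselect (polydisc z).
by have [_ ->] := H2_holomorphic f.
Qed.

(** Puts a point in the form at which [torus_szego] evaluates. The choice [r = (1 + m) / 2] works
    because [((1 + m) / 2) ^+ 2 >= m]. *)
Lemma polydisc_dilate (z : 'rV[R[i]]_n) : polydisc z -> exists r (a : 'rV[R[i]]_n),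
  [/\ 0 < r < 1, forall i, normc (a ord0 i) <= 1 & z = (r ^+ 2)%:C *: a].
Proof.
move=> /polydiscE zP.
have [m /andP[m0 m1] zm] : exists2 m : R, 0 <= m < 1 & forall i, normc (z ord0 i) <= m.
  exists (\big[Num.max/0]_i normc (z ord0 i)).
    by apply/andP; split; [exact: bigmax_ge_id|apply/bigmax_ltP].
  by move=> i; exact: (@le_bigmax _ _ _ 0 (fun i => normc (z ord0 i))).
pose r := (1 + m) / 2; have r0 : 0 < r by rewrite /r; lra.
have r1 : r < 1 by rewrite /r; lra.
have rm : m <= r ^+ 2 by rewrite /r; have := sqr_ge0 (1 - m); nra.
have rr0 : 0 < r ^+ 2 by rewrite exprn_gt0.
exists r, (((r ^+ 2)^-1)%:C *: z); split; first by rewrite r0.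
  move=> i; rewrite mxE normcM normcR_ge0 ?invr_ge0 ?(ltW rr0)// ler_pdivrMl// mulr1.
  exact: le_trans rm.
by rewrite scalerA -rmorphM mulfV ?gt_eqF// rmorph1 scale1r.
Qed.

(** With mean square 0, [point_bound] bounds [|f z|^2] by [B * s] for every [s > 0]; the factor
    [conjc (f z)] makes the value real. *)
Lemma H2_norm_eq0 f : H2_norm f ^+ 2 = 0 -> f = 0.
Proof.
move=> nf0; apply: H2_eqP => z zP; have [r [a [r01 a1 zE]]] := polydisc_dilate zP.
have [_ [B sB] _] := holomorphic_line (f := szego a) r01
    (fun z zP => szego_differentiable a1 zP).
have /andP[r0 _] := r01.
have sB' t : normc (szego a (torus_point r t)) <= B by apply: sB; exact: polydisc_le_torus.
pose c := conjc (f z); pose h z : C := c * f z.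
have hh : line_holomorphic r h.
  apply: holomorphic_line => // y yP; apply: (@differentiableM _ _ (cst c) f); first exact: differentiable_cst.
  exact: H2_differentiable.
have h0 : (circular_mean h r <= 0%:E)%E.
  apply: le_trans (_ : (normc c ^+ 2)%:E * circular_mean f r <= _)%E; last first.
    apply: (@le_trans _ _ ((normc c ^+ 2)%:E * 0)%E); last by rewrite mule0.
    rewrite lee_wpmul2l ?lee_fin ?sqr_ge0//.
    by have := circular_mean_le f r01; rewrite nf0.
  rewrite /circular_mean -ge0_integralZl//; last 3 first.
  - by apply/measurable_EFinP; exact: measurable_torus (H2_holomorphic f) r01.
  - by move=> t _; rewrite lee_fin sqr_ge0.
  - by rewrite lee_fin sqr_ge0.
  rewrite le_eqVlt; apply/orP; left; apply/eqP; apply: eq_integral => t _.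
  by rewrite /h normcM exprMn EFinM.
have hz s : 0 < s -> normc (f z) ^+ 2 <= B * s.
  move=> s0; have := point_bound r01 a1 hh sB' s0 h0.
  by rewrite -zE mul0r addr0 /h /c mulrC Re_mul_conj.
have B0 : 0 <= B by apply: le_trans (sB' [tuple of nseq n 0]); exact: normc_ge0.
have : normc (f z) ^+ 2 <= 0.
  apply/ler_addgt0Pl => e e0; rewrite addr0.
  have B1 : 0 < B + 1 by rewrite ltr_wpDl.
  apply: (le_trans (hz (e / (B + 1)) _)); first by rewrite divr_gt0.
  by rewrite mulrCA ler_piMr ?(ltW e0)// ler_pdivrMr// mul1r lerDl.
by rewrite le_eqVlt ltNge sqr_ge0 orbF sqrf_eq0 => /eqP/eq0_normc.
Qed.

(** A weighted triangle inequality for squares: it holds pointwise, so it passes to integrals and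
    suprema directly, and its first constant can be taken close to 1. *)
Lemma H2_normD f g (e : R) : 0 < e ->
  H2_norm (f + g) ^+ 2 <= (1 + e) * H2_norm f ^+ 2 + (1 + e^-1) * H2_norm g ^+ 2.
Proof.
move=> e0; apply: H2_norm_le => r r01; have /andP[r0 r1] := r01.
have fi := normc_sqr_integrable r0 (H2_line f r01).
have gi := normc_sqr_integrable r0 (H2_line g r01).
apply: (@le_trans _ _ (\int[torus_measure n]_t (
   (1 + e)%:E * (normc (f (torus_point r t)) ^+ 2)%:E +
   (1 + e^-1)%:E * (normc (g (torus_point r t)) ^+ 2)%:E))%E).
  apply: le_integral => //.
  - exact: normc_sqr_integrable (H2_line (f + g) r01).
  - by apply: integrableD => //; exact: integrableZl.
  move=> t _; rewrite -!EFinM -EFinD lee_fin.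
  rewrite -[(f + g) _]/(f (torus_point r t) + g (torus_point r t)).
  apply: (@le_trans _ _ ((normc (f (torus_point r t)) + normc (g (torus_point r t))) ^+ 2)).
    by rewrite ler_pXn2r ?nnegrE ?addr_ge0 ?normc_ge0// le_normcD.
  move: (normc (f _)) (normc (g _)) => x y.
  have ee : e * e^-1 = 1 by rewrite mulfV// gt_eqF.
  rewrite -subr_ge0.
  (* The last summand collects the terms that cancel only through [e * e^-1 = 1]. *)
  have -> : (1 + e) * x ^+ 2 + (1 + e^-1) * y ^+ 2 - (x + y) ^+ 2 =
     e^-1 * (e * x - y) ^+ 2 + (e * e^-1 - 1) * (2 * x * y - e * x ^+ 2) by ring.
  by rewrite ee subrr mul0r addr0 mulr_ge0 ?sqr_ge0// invr_ge0 ltW.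
rewrite integralD//=; [|exact: integrableZl..].
have -> : ((1 + e) * H2_norm f ^+ 2 + (1 + e^-1) * H2_norm g ^+ 2)%:E =
    ((1 + e)%:E * (H2_norm f ^+ 2)%:E + (1 + e^-1)%:E * (H2_norm g ^+ 2)%:E)%E.
  by rewrite -!EFinM -EFinD.
rewrite !integralZl//; apply: leeD.
  by rewrite lee_wpmul2l ?lee_fin ?addr_ge0 ?(ltW e0)//; exact: circular_mean_le.
by rewrite lee_wpmul2l ?lee_fin ?addr_ge0 ?invr_ge0 ?(ltW e0)//; exact: circular_mean_le.
Qed.

Lemma polarization_Re (x0 x1 x2 x3 : R) :
  x0%:C + ('i * x1%:C + (-1 * x2%:C + (- 'i * x3%:C + 0))) = 0 :> R[i] -> x0 = x2.
Proof. by move=> /(congr1 (@complex.Re R)) /=; lra. Qed.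

(** In the polarization sum the terms [k = 1] and [k = 3] are purely imaginary, so the real part
    compares the terms [k = 0] and [k = 2]. *)
Lemma H2_dot_eq0 f g : H2_dot f g = 0 -> H2_norm (f + g) ^+ 2 = H2_norm (f - g) ^+ 2.
Proof.
have i2 : 'i ^+ 2 = -1 :> R[i] by exact: sqrCi.
rewrite /H2_dot !big_ord_recl big_ord0 /= => /eqP.
rewrite mulf_eq0 invr_eq0 pnatr_eq0 /= => /eqP.
rewrite expr0 scale1r mul1r expr1.
have -> : 'i ^+ bump 0 1 = -1 :> R[i] by exact: i2.
have -> : 'i ^+ bump 0 (bump 0 1) = - 'i :> R[i] by rewrite [LHS]exprS i2 mulrN1.
rewrite (scaleN1r g); exact: polarization_Re.
Qed.

End H2_norm.

(** * Symmetry of the norm for functions orthogonal to the range *)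

Section kernel_of_adjoint.
Context {R : realType} {n : nat}.
Notation C := (R[i]^o).
Implicit Types (f g : H2 R n) (p u : Hinf R n).

Lemma Hinf_circular_mean p r : 0 < r < 1 ->
  (circular_mean p r <= (Hinf_norm p ^+ 2)%:E)%E.
Proof.
move=> r01; have /andP[r0 r1] := r01.
have ph : line_holomorphic r p.
  by apply: holomorphic_line => // z; exact: Hinf_differentiable.
have ic : (torus_measure n).-integrable setT (EFin \o cst (Hinf_norm p ^+ 2)).
  exact: finite_measure_integrable_cst.
apply: (@le_trans _ _ (\int[torus_measure n]_t (Hinf_norm p ^+ 2)%:E)%E).
  apply: le_integral => //; first exact: normc_sqr_integrable.
  move=> t _; rewrite lee_fin ler_pXn2r ?nnegrE ?normc_ge0 ?Hinf_norm_ub//.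
  exact: le_trans (normc_ge0 _) (Hinf_norm_ub p 0).
by rewrite integral_cst// [X in (_ * X)%E]probability_setT mule1.
Qed.

Lemma Hinf_hardy2 p : (p : _ -> C) \in @hardy2 R n.
Proof.
apply/asboolP; split; first exact: Hinf_holomorphic.
apply: (@le_lt_trans _ _ (Hinf_norm p ^+ 2)%:E); last exact: ltry.
by apply: ge_ereal_sup => _ [r r01 <-]; exact: Hinf_circular_mean.
Qed.

Definition H2_of p : H2 R n := MkH2 (Hinf_hardy2 p).

Lemma H2_normN f : H2_norm (- f) = H2_norm f.
Proof.
congr (Num.sqrt (fine (ereal_sup _))); apply: eq_imagel => r _.
by apply: eq_integral => t _; rewrite [(- f) _]/(- (f _)) normcN.
Qed.

Section orthogonality.
Variables (phi : Hinf R n) (g : H2 R n).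
Hypotheses (Mphi : M_ideal (principal_ideal phi)) (phi0 : phi 0 != 0).
Hypothesis orth : forall f, H2_dot (toeplitz phi f) g = 0.

(** With [f = u p] the difference is [p * h] for [h = 1 - phi * u]. Since [|1 - h| <= 1 + d] and
    [|h 0| <= d], the mean square of [h] is at most [2 * d + 3 * d]. *)
Lemma approximate_in_range p (d : R) : 0 < d -> d <= 1 ->
  exists f, H2_norm (H2_of p - toeplitz phi f) ^+ 2 <= Hinf_norm p ^+ 2 * (5 * d).
Proof.
move=> d0 d1; have [u [u1 u0]] := approximant Mphi phi0 d0.
have [one oneE] := @Hinf_one R n.
pose h := one - Hinf_mul phi u.
have hE z : polydisc z -> h z = 1 - phi z * u z.
  by move=> zP; rewrite -(oneE z zP).
exists (toeplitz u (H2_of p)); apply: H2_norm_le => r r01.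
have pz z : (H2_of p - toeplitz phi (toeplitz u (H2_of p))) z = p z * h z.
  rewrite [LHS]/(p z - phi z * (u z * p z)); have [zP|zP] := pselect (polydisc z).
    by rewrite hE// mulrBr mulr1; congr (_ - _); rewrite mulrA mulrC.
  have [_ ->//] := Hinf_holomorphic p; rewrite !mulr0 mul0r.
  by change (0 - 0 = 0 :> R[i]); rewrite subrr.
rewrite /circular_mean; under eq_integral => t _ do rewrite pz.
apply: le_trans (circular_meanM (Hinf_holomorphic p) (Hinf_holomorphic h) r01 (Hinf_norm_ub p)) _.
rewrite [leRHS]EFinM lee_wpmul2l ?lee_fin ?sqr_ge0//.
have dh (z : 'rV[R[i]]_n : normedModType R[i]) : polydisc z -> differentiable h z.
  exact: Hinf_differentiable.
apply: le_trans (mean_sq_bound r01 d0 d1 dh _) _.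
  by move=> z zP; rewrite hE// opprB addrC subrK.
rewrite lee_fin hE; last exact: polydisc0.
have := Re_le_normc (1 - phi 0 * u 0); lra.
Qed.

(** On the range of the Toeplitz operator the two norms agree by orthogonality; [p] is exchanged for
    an element of the range by two uses of [H2_normD]. For fixed [e] the error [d] goes to 0 first,
    because of the factor [1 + e^-1]; then [e] goes to 0. *)
Lemma norm_sym_le p : H2_norm (H2_of p + g) ^+ 2 <= H2_norm (H2_of p - g) ^+ 2.
Proof.
set X := _ ^+ 2; set Y := _ ^+ 2.
have Y0 : 0 <= Y by exact: sqr_ge0.
pose N := Hinf_norm p ^+ 2; have N0 : 0 <= N by exact: sqr_ge0.
have bnd (e d : R) : 0 < e -> 0 < d -> d <= 1 ->
    X <= (1 + e) * ((1 + e) * Y + (1 + e^-1) * (N * (5 * d))) + (1 + e^-1) * (N * (5 * d)).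
  move=> e0 d0 d1; have [f fp] := approximate_in_range p d0 d1.
  have e1 : 0 <= 1 + e^-1 by rewrite addr_ge0// invr_ge0 ltW.
  have -> : X = H2_norm ((toeplitz phi f + g) + (H2_of p - toeplitz phi f)) ^+ 2.
    by rewrite /X; congr (H2_norm _ ^+ 2); rewrite [RHS]addrC addrA subrK.
  apply: (le_trans (H2_normD _ _ e0)); apply: lerD; last by rewrite ler_wpM2l.
  rewrite (H2_dot_eq0 (orth f)) ler_wpM2l ?addr_ge0 ?(ltW e0)//.
  have -> : toeplitz phi f - g = (H2_of p - g) + - (H2_of p - toeplitz phi f).
    by rewrite opprB [RHS]addrC addrA subrK.
  apply: (le_trans (H2_normD _ _ e0)); apply: lerD => //.
  by rewrite H2_normN ler_wpM2l.
have bnd2 (e : R) : 0 < e -> e <= 1 -> X <= Y + 3 * e * Y.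
  move=> e0 e1; apply/ler_addgt0Pl => t t0.
  (* The coefficient of [d] in [bnd], plus [t], so that [d = t / K] is at most 1 and costs at most
     [t]. The coefficient of [Y] is [(1 + e) ^+ 2], at most [1 + 3 * e]. *)
  pose K := (2 + e) * (1 + e^-1) * (N * 5) + t.
  have ei : 0 < e^-1 by rewrite invr_gt0.
  have K0 : 0 <= (2 + e) * (1 + e^-1) * (N * 5) by apply: mulr_ge0; apply: mulr_ge0 => //; apply: addr_ge0 => //; exact: ltW.
  have Kt : 0 < K by rewrite ltr_wpDl.
  have d0 : 0 < t / K by rewrite divr_gt0.
  have d1 : t / K <= 1 by rewrite ler_pdivrMr// mul1r lerDr.
  have := bnd e _ e0 d0 d1.
  have : (2 + e) * (1 + e^-1) * (N * 5) * (t / K) <= t.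
    by rewrite mulrCA ler_piMr ?(ltW t0)// ler_pdivrMr// mul1r lerDl ltW.
  have : e * e * Y <= e * Y by rewrite -mulrA; apply: ler_piMl => //; apply: mulr_ge0 => //; exact: ltW.
  move: (e^-1) (t / K) => i q; clearbody X Y N.
  lra.
apply/ler_addgt0Pl => t t0.
pose e := Num.min 1 (t / (3 * Y + 1)).
have Y1 : 0 < 3 * Y + 1 by lra.
have e0 : 0 < e by rewrite lt_min ltr01 divr_gt0.
have e1 : e <= 1 by rewrite ge_min lexx.
have et : e * (3 * Y + 1) <= t by rewrite -ler_pdivlMr// ge_min lexx orbT.
by have := bnd2 e e0 e1; clearbody e; lra.
Qed.

End orthogonality.
End kernel_of_adjoint.

(* As [s] grows, both suprema are governed by [r] near 1, where the linear term
   enters with the limit [K1]. *)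
Lemma boundary_push {R : realType} (A B K : R -> R) (A1 K1 b : R) :
  (forall r, 0 < r < 1 -> 0 <= B r <= b) ->
  (forall r, 0 < r < 1 -> 0 <= A r + B r + K r) ->
  (forall r1, r1 < 1 -> exists2 gap, 0 < gap & forall r, 0 < r <= r1 -> A r <= A1 - gap) ->
  A r @[r --> 1^'-] --> A1 -> K r @[r --> 1^'-] --> K1 ->
  (forall s Y, 0 < s ->
    (forall r, 0 < r < 1 -> s ^+ 2 * A r + B r - s * K r <= Y) ->
     forall r, 0 < r < 1 -> s ^+ 2 * A r + B r + s * K r <= Y) ->
  K1 <= 0.
Proof.
move=> Bb AK gap cA cK push; rewrite leNgt; apply/negP => K1_gt0.
have b0 : 0 <= b.
  by have /andP[] := Bb (1 / 2) ltac:(apply/andP; split; lra); exact: le_trans.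
have [d d0 dK] : exists2 d, 0 < d & forall r, r < 1 -> 1 - d < r -> K1 / 2 <= K r.
  have K2 : 0 < K1 / 2 by rewrite divr_gt0.
  have /cvgrPdist_le /(_ _ K2) [d /= d0 dK] := cK.
  exists d => // r r1 rd; have := dK r; rewrite /= ger0_norm ?subr_ge0 ?(ltW r1)// => /(_ _ r1).
  rewrite ltrBlDr addrC -ltrBlDr => /(_ rd); rewrite ler_norml => /andP[_]; lra.
have [e e0 eA] := gap (1 - d / 2) ltac:(lra).
have A1ge r : 0 < r < 1 -> A r <= A1.
  move=> /andP[r0 r1]; have [e' e'0 /(_ r)] := gap r r1; rewrite r0 lexx => /(_ isT); lra.
(* The summands ensure [s >= 1], [s * K1 > b] and [s * e >= |A1| + 2 * b]; the last two refute the
   two branches of [Y] below. *)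
pose s := 1 + b / K1 + (`|A1| + 2 * b) / e.
have s1 : 1 <= s by rewrite /s -addrA lerDl addr_ge0// divr_ge0// ?addr_ge0 ?mulr_ge0// ltW.
have s0 : 0 < s by apply: lt_le_trans s1.
have sK : b < s * K1.
  by rewrite -ltr_pdivrMr// /s addrAC ltr_pwDl// ltr_pwDl// divr_ge0// ?addr_ge0 ?mulr_ge0// ltW.
have se : `|A1| + 2 * b <= s * e.
  by rewrite -ler_pdivrMr// /s lerDr addr_ge0// divr_ge0// ltW.
clearbody s.
(* The first value covers the radii above [1 - d], where [K r >= K1 / 2]. The second covers the
   others, where [A r <= A1 - e] and positivity of [A + B + K] gives [- K r <= A1 + b]. *)
pose Y := Num.max (s ^+ 2 * A1 + b - s * (K1 / 2)) (s ^+ 2 * (A1 - e) + b + s * (A1 + b)).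
have sup_le r : 0 < r < 1 -> s ^+ 2 * A r + B r + s * K r <= Y.
  apply: push => // {}r r01.
  have /andP[r0 r1] := r01; have /andP[_ Brb] := Bb r r01.
  have ss : 0 <= s ^+ 2 by exact: sqr_ge0.
  rewrite /Y le_max; apply/orP; have [rd|rd] := ltP (1 - d) r.
    left; have Kr := dK r r1 rd.
    have : s ^+ 2 * A r <= s ^+ 2 * A1 by rewrite ler_wpM2l// A1ge.
    have : s * (K1 / 2) <= s * K r by rewrite ler_wpM2l// ltW.
    lra.
  right; have Ar : A r <= A1 - e by apply: eA; rewrite r0/=; lra.
  have : s ^+ 2 * A r <= s ^+ 2 * (A1 - e) by rewrite ler_wpM2l.
  have : s * - K r <= s * (A1 + b).
    rewrite ler_wpM2l ?(ltW s0)//; have := AK r r01; have := A1ge r r01; lra.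
  lra.
(* Let [r] tend to 1 in [sup_le], after dropping the nonnegative [B r]. *)
have key : s ^+ 2 * A1 + s * K1 <= Y.
  apply: (@cvgr_to_le _ (1^'-) _ R (fun r => s ^+ 2 * A r + s * K r)).
    by apply: cvgD; [exact: (cvgM (cvg_cst _) cA)|exact: (cvgM (cvg_cst _) cK)].
  near=> r.
  have r01 : 0 < r < 1 by apply/andP; split; near: r; [exact: nbhs_left_gt|exact: nbhs_left_lt].
  by have /andP[Br0 _] := Bb r r01; have := sup_le r r01; lra.
have sse : s * (`|A1| + 2 * b) <= s * (s * e) by apply: ler_wpM2l se; exact: ltW.
have sA : s * A1 <= s * `|A1| by apply: ler_wpM2l (ler_norm _); exact: ltW.
have sb : b <= s * b by rewrite ler_peMl.
have sK1 : 0 < s * K1 by exact: mulr_gt0.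
move: key; rewrite /Y le_max => /orP[]; lra.
Unshelve. all: by end_near. Qed.

(** * Testing the symmetry against Szego kernels *)

Section kernel_trivial.
Context {R : realType} {n : nat}.
Notation C := (R[i]^o).
Notation angles := (n.-tuple (measurableTypeR R)).

Lemma normc_sqrD (x y : R[i]) :
  normc (x + y) ^+ 2 = normc x ^+ 2 + normc y ^+ 2 + 2 * complex.Re (conjc x * y).
Proof. by rewrite !normc_sqr; case: x y => [a b] [c d] /=; ring. Qed.

(** Expanding the square, everything except [|g|^2] is the real part of [F] times the conjugate of
    [szego a], with [F] holomorphic, so [torus_szego] evaluates its mean. Only the modulus of [h]
    matters, so that [p - g] can be replaced by [g - p]. *)
Lemma circular_mean_szego (g h : 'rV[R[i]]_n -> C) (a : 'rV[R[i]]_n) (k : R[i]) (r : R) :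
  0 < r < 1 -> (forall i, normc (a ord0 i) <= 1) ->
  (forall z : 'rV[R[i]]_n : normedModType R[i], polydisc z -> differentiable g z) ->
  (forall t : angles, normc (h (torus_point r t)) =
     normc (k * szego a (torus_point r t) + g (torus_point r t))) ->
  (circular_mean h r = circular_mean g r +
    (normc k ^+ 2 * complex.Re (szego a ((r ^+ 2)%:C *: a)) +
     2 * complex.Re (conjc k * g ((r ^+ 2)%:C *: a)))%:E)%E.
Proof.
move=> r01 a1 dg hE; have /andP[r0 r1] := r01.
have dS (z : 'rV[R[i]]_n : normedModType R[i]) : polydisc z -> differentiable (szego a : _ -> C) z.
  exact: szego_differentiable.
pose F z : C := (normc k ^+ 2)%:C * szego a z + 2%:C * (conjc k * g z).
have dF (z : 'rV[R[i]]_n : normedModType R[i]) : polydisc z -> differentiable F z.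
  move=> zP; apply: differentiableD.
    by apply: differentiableM; [exact: differentiable_cst|exact: dS].
  apply: differentiableM; first exact: differentiable_cst.
  by apply: differentiableM; [exact: differentiable_cst|exact: dg].
have Fh := holomorphic_line r01 dF; have gh := holomorphic_line r01 dg.
have FE z : complex.Re (F z) = normc k ^+ 2 * complex.Re (szego a z) + 2 * complex.Re (conjc k * g z).
  by rewrite /F ReD !Re_realMl.
rewrite -FE -(torus_szego r01 a1 Fh) /circular_mean.
have sh := holomorphic_line r01 dS.
have [_ [MF FM] cF] := Fh; have [_ [MS SM] cS] := sh.
have cS' : seq_continuous (fun t => conjc (szego a (torus_point r t)) : C).
  by move=> u t ut; apply: cvg_conjc; exact: cS.
have iF : (torus_measure n).-integrable setT (fun t => (complex.Re
     (F (torus_point r t) * conjc (szego a (torus_point r t))))%:E).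
  apply: (torus_integrable (seq_continuousM cF cS') (M := MF * MS)) => t.
  by rewrite normcM normc_conj; apply: ler_pM; rewrite ?normc_ge0//; [apply: FM|apply: SM]; exact: polydisc_le_torus.
rewrite -integralD//; last exact: normc_sqr_integrable.
apply: eq_integral => t _; rewrite -EFinD hE normc_sqrD; congr EFin.
move: (torus_point r t) => z; rewrite /F.
rewrite normcM exprMn [X in X + _]addrC -addrA; congr (_ + _).
move: (g z) (szego a z) => y x {FE dF Fh iF cF cS cS' FM SM sh}.
rewrite !normc_sqr; case: k y x {hE F} => [k1 k2] [y1 y2] [x1 x2] /=. ring.
Qed.

Lemma szego_diag (a : 'rV[R[i]]_n) (r : R) :
  szego a ((r ^+ 2)%:C *: a) = (\prod_i (1 - r ^+ 2 * normc (a ord0 i) ^+ 2)^-1)%:C :> C.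
Proof.
rewrite /szego rmorph_prod; apply: eq_bigr => i _; rewrite mxE fmorphV; congr (_^-1).
rewrite rmorphB rmorph1; congr (_ - _); rewrite normc_sqr.
by case: (a ord0 i) => x y; apply/eqP; rewrite eq_complex /=; apply/andP; split; apply/eqP; ring.
Qed.

(** All factors are nondecreasing in the radius, and one belonging to a nonzero coordinate of [a] is
    strictly increasing. This provides the gap required by [boundary_push]. *)
Lemma szego_diag_lt (a : 'rV[R[i]]_n) (r s : R) : polydisc a -> a != 0 ->
  0 <= r -> r < s -> s <= 1 ->
  complex.Re (szego a ((r ^+ 2)%:C *: a)) < complex.Re (szego a ((s ^+ 2)%:C *: a)).
Proof.
move=> /polydiscE aP a0 r0 rs s1; rewrite !szego_diag /=.
have [j aj] : exists j, a ord0 j != 0.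
  apply/existsP; rewrite -negb_forall; apply: contra a0 => /forallP a0.
  by apply/eqP/rowP => i; rewrite mxE; apply/eqP.
have s0 : 0 < s by exact: le_lt_trans rs.
have rs2 : r ^+ 2 < s ^+ 2 by rewrite ltrXn2r// ?nnegrE// ltW.
have s2 : s ^+ 2 <= 1 by rewrite expr_le1// ltW.
have pos t i : t <= 1 -> 0 < 1 - t * normc (a ord0 i) ^+ 2.
  move=> t1; rewrite subr_gt0; apply: (@le_lt_trans _ _ (normc (a ord0 i) ^+ 2)).
    by rewrite ler_piMl// sqr_ge0.
  by rewrite expr_lt1// normc_ge0.
rewrite (bigD1 j)//= [ltRHS](bigD1 j)//=.
have r1 : r ^+ 2 <= 1 by apply: le_trans s2; exact: ltW.
apply: (@le_lt_trans _ _ ((1 - r ^+ 2 * normc (a ord0 j) ^+ 2)^-1 *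
   \prod_(i < n | i != j) (1 - s ^+ 2 * normc (a ord0 i) ^+ 2)^-1)).
  rewrite ler_pM2l ?invr_gt0 ?pos//; apply: ler_prod => i _.
  rewrite invr_ge0 ltW ?pos//= lef_pV2 ?posrE ?pos// lerD2l lerN2.
  by rewrite ler_wpM2r ?sqr_ge0// ltW.
rewrite ltr_pM2r; last by apply: prodr_gt0 => i _; rewrite invr_gt0 pos.
rewrite ltf_pV2 ?posrE ?pos// ltrD2l ltrN2 ltr_pM2r// exprn_gt0//.
by rewrite -ltcR -normcEC normr_gt0.
Qed.

Lemma radial_cvg (f : 'rV[R[i]]_n -> C) (a : 'rV[R[i]]_n) (k : C) :
  differentiable f (a : 'rV[R[i]]_n : normedModType R[i]) ->
  complex.Re (k * f ((r ^+ 2)%:C *: a)) @[r --> (1 : R)^'-] --> complex.Re (k * f a).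
Proof.
move=> df; apply: cvg_Re; apply: (cvgM (cvg_cst k)).
have cr : ((r ^+ 2)%:C : C) @[r --> (1 : R)^'-] --> (1 : C).
  apply: cvg_at_left_filter; rewrite -[X in _ --> X](rmorph1 (real_complex R)).
  apply: cvg_real_complex; rewrite -[X in _ --> X](expr1n _ 2).
  exact: exprn_continuous.
have ca : ((r ^+ 2)%:C *: a : 'rV[R[i]]_n : normedModType R[i]) @[r --> (1 : R)^'-] -->
    (a : 'rV[R[i]]_n : normedModType R[i]).
  rewrite -[X in _ --> X]scale1r; exact: cvgZl.
by move=> A /(differentiable_continuous df) /ca.
Qed.

Lemma symmetric_eq0 (g : H2 R n) : (0 < n)%N ->
  (forall p, H2_norm (H2_of p + g) ^+ 2 <= H2_norm (H2_of p - g) ^+ 2) -> g = 0.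
Proof.
move=> n0 sym.
have dg (z : 'rV[R[i]]_n : normedModType R[i]) : polydisc z -> differentiable g z.
  exact: H2_differentiable.
have ga0 a : polydisc a -> a != 0 -> g a = 0.
  move=> aP a0; have /polydiscE aP' := aP; have a1 i : normc (a ord0 i) <= 1 by exact: ltW.
  have dS (z : 'rV[R[i]]_n : normedModType R[i]) : polydisc z -> differentiable (szego a : _ -> C) z.
    exact: szego_differentiable.
  apply/eqP/negPn/negP => gan0; pose c : R[i] := g a.
  have nc0 : 0 < normc c by rewrite -ltcR -normcEC normr_gt0.
  have [P PE] : exists P : Hinf R n, forall z, polydisc z -> P z = szego a z.
    apply: (@Hinf_extension _ _ (szego a) (\prod_i (1 - normc (a ord0 i))^-1)) => // z /polydiscE zP.
    rewrite /szego -lecR -normcEC normr_prod rmorph_prod; apply: ler_prod => i _.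
    rewrite normr_ge0 normcEC lecR normcV.
    have h := le_normcD (1 - conjc (a ord0 i) * z ord0 i) (conjc (a ord0 i) * z ord0 i).
    have h2 : normc (conjc (a ord0 i) * z ord0 i) <= normc (a ord0 i).
      by rewrite normcM normc_conj ler_piMr ?normc_ge0// ltW.
    move: h; rewrite subrK normc1 => h; have := aP' i => h3.
    by rewrite lef_pV2 ?posrE; lra.
  (* [A], [K] and [B] are the coefficients of [s ^+ 2], [s] and 1 in the circular mean of
     [s c S_a + g] at radius [r]. *)
  pose A r := normc c ^+ 2 * complex.Re (szego a ((r ^+ 2)%:C *: a)).
  pose K r := 2 * complex.Re (conjc c * g ((r ^+ 2)%:C *: a)).
  pose B r := fine (circular_mean g r).
  have expand h (s : R) r : 0 < r < 1 -> (forall t : angles, normc (h (torus_point r t)) =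
     normc (s%:C * c * szego a (torus_point r t) + g (torus_point r t))) ->
     circular_mean h r = (s ^+ 2 * A r + B r + s * K r)%:E.
    move=> r01 /(circular_mean_szego r01 a1 dg) ->.
    rewrite circular_meanE// -EFinD; congr EFin.
    rewrite conjc_mul conjc_real -mulrA Re_realMl normcM exprMn normc_sqr /= /A /K /B; ring.
  have : 2 * normc c ^+ 2 <= 0.
    apply: (@boundary_push _ A B K (normc c ^+ 2 * complex.Re (szego a a)) _ (H2_norm g ^+ 2)).
    - move=> r r01; rewrite -!lee_fin /B -circular_meanE// circular_mean_ge0.
      exact: circular_mean_le.
    (* [A + B + K] is a circular mean, that for [s = 1], hence nonnegative. *)
    - move=> r r01; have := expand (fun z => c * szego a z + g z) 1 r r01.
      by rewrite expr1n !mul1r => E; rewrite -lee_fin -E ?circular_mean_ge0.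
    (* [r1] may be negative; [szego_diag_lt] compares nonnegative radii. *)
    - move=> r1 r11; pose m := Num.max r1 0.
      have m0 : 0 <= m by rewrite le_max lexx orbT.
      have m1 : m < 1 by rewrite gt_max r11 ltr01.
      have lt1 r : 0 <= r -> r < 1 ->
          complex.Re (szego a ((r ^+ 2)%:C *: a)) < complex.Re (szego a a).
        move=> r0 rlt1; have := szego_diag_lt aP a0 r0 rlt1 (lexx _).
        by rewrite expr1n rmorph1 scale1r.
      exists (normc c ^+ 2 * complex.Re (szego a a) - A m).
        by rewrite subr_gt0 ltr_pM2l ?exprn_gt0// lt1.
      move=> r /andP[r0 rr1]; rewrite opprB addrC subrK /A; apply: ler_wpM2l; first exact: sqr_ge0.
      have : r <= m by rewrite le_max rr1.
      rewrite le_eqVlt => /orP[/eqP ->//|rm]; apply/ltW/szego_diag_lt => //; exact: ltW.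
    - have := radial_cvg (k := 1) (dS a aP); under eq_fun do rewrite mul1r.
      by rewrite mul1r => h; exact: (cvgM (cvg_cst _) h).
    - have := radial_cvg (k := conjc c) (dg a aP).
      rewrite [conjc c * _]mulrC Re_mul_conj => h; exact: (cvgM (cvg_cst _) h).
    - move=> s Y s0 Yub r r01.
      pose p := (s%:C * c) *: P.
      have pE t : p (torus_point r t) = s%:C * c * szego a (torus_point r t).
        by rewrite -[p _]/(s%:C * c * P _) PE//; exact: torus_point_in_polydisc.
      have pg : circular_mean (H2_of p + g) r = (s ^+ 2 * A r + B r + s * K r)%:E.
        by apply: expand => // t; rewrite -pE.
      rewrite -lee_fin -pg; apply: le_trans (circular_mean_le _ r01) _.
      rewrite lee_fin; apply: (le_trans (sym p)).
      apply: H2_norm_le => u u01.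
      (* [p - g] has the modulus of [g - p], which is the case [- s] of [expand]. *)
      have -> : circular_mean (H2_of p - g) u = ((- s) ^+ 2 * A u + B u + (- s) * K u)%:E.
        apply: expand => // t; rewrite -normcN -[(H2_of p - g) _]/(p _ - g _) opprB.
        rewrite -[p _]/(s%:C * c * P _) PE; last exact: torus_point_in_polydisc.
        by rewrite rmorphN !mulNr addrC.
      by rewrite sqrrN mulNr lee_fin Yub.
  by rewrite leNgt mulr_gt0// exprn_gt0.
(* At 0, [g] is the mean of its values on the torus of radius [1 / 2]; as [0 < n], no point of that
   torus is 0, so these values vanish. *)
apply: H2_eqP => a aP; have [->|] := eqVneq a 0; last exact: ga0.
have r01 : 0 < (1 / 2 : R) < 1 by apply/andP; split; lra.
pose f z : C := conjc (g 0) * g z.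
have fh : line_holomorphic (1 / 2) f.
  apply: holomorphic_line => // z zP.
  by apply: differentiableM; [exact: differentiable_cst|exact: dg].
have := torus_mean r01 fh.
rewrite /f [conjc (g 0) * g 0]mulrC Re_mul_conj.
rewrite integral0_eq => [|t _].
  by move=> [] /esym/eqP; rewrite sqrf_eq0 => /eqP/eq0_normc.
have tP : polydisc (torus_point (1 / 2) t) by exact: torus_point_in_polydisc.
rewrite (ga0 _ tP) ?mulr0//; apply/eqP => /rowP /(_ (Ordinal n0)) /(congr1 (@normc R)).
by rewrite !mxE normc0 -[_ * _]/(circ _ _) normc_circ; lra.
Qed.

End kernel_trivial.

(** * The polarized inner product and the kernel of the adjoint *)

Section adjoint_kernel.
Context {R : realType} {n : nat}.
Implicit Types (f g : H2 R n).

(** The four norms coincide and the four powers of ['i] sum to 0. *)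
Lemma H2_dotf0 f : H2_dot f 0 = 0.
Proof.
rewrite /H2_dot; under eq_bigr do rewrite scaler0 addr0.
have i2 : 'i ^+ 2 = -1 :> R[i] by exact: sqrCi.
rewrite !big_ord_recl big_ord0 /= expr0 expr1.
have -> : 'i ^+ bump 0 1 = -1 :> R[i] by exact: i2.
have -> : 'i ^+ bump 0 (bump 0 1) = - 'i :> R[i] by rewrite [LHS]exprS i2 mulrN1.
move: (_%:C) => x; ring.
Qed.

Lemma H2_norm0 : H2_norm (0 : H2 R n) ^+ 2 = 0.
Proof.
apply/eqP; rewrite eq_le sqr_ge0 andbT; apply: H2_norm_le => r r01.
by rewrite circular_mean0.
Qed.

Lemma H2_dot_self_eq0 f : H2_dot f f = 0 -> f = 0.
Proof.
move=> /H2_dot_eq0; rewrite subrr H2_norm0 => /H2_norm_eq0 /eqP.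
by rewrite -mulr2n -scaler_nat scaler_eq0 pnatr_eq0 => /eqP.
Qed.

End adjoint_kernel.

Theorem corollary5p5 (R : realType) (n : nat) (hn : (1 <= n)%N)
    (phi : Hinf R n) (phi_neq0 : phi != 0) :
  M_ideal (principal_ideal phi) ->
  [set g : H2 R n | adjoint (toeplitz phi) g = 0] = [set 0].
Proof.
move=> Mphi.
have phiP z : polydisc z -> phi z != 0.
  (* By [nonvanishing], one zero in the polydisc would force [phi] to vanish on all of it. *)
  move=> zP; apply/negP => /eqP phiz; move/negP : phi_neq0; apply.
  apply/eqP/val_inj/funext => w /=; have [wP|wP] := pselect (polydisc w); last first.
    by have [_ ->] := Hinf_holomorphic phi.
  apply/eqP/negPn/negP => phiw; have := nonvanishing Mphi wP zP phiw.
  by rewrite phiz eqxx.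
rewrite /adjoint; case: xgetP => [S _ SE|noS].
  apply/seteqP; split=> [g /= Sg|_ -> /=]; last first.
    (* [S] is known only through the adjoint identity; applied to [S 0], this identity shows that
       [S 0] is orthogonal to itself. *)
    by apply: H2_dot_self_eq0; rewrite -SE H2_dotf0.
  apply: (symmetric_eq0 hn) => p; apply: (norm_sym_le Mphi).
    by apply: phiP; exact: polydisc0.
  by move=> f; rewrite SE Sg H2_dotf0.
apply/seteqP; split=> [g /= /(congr1 (@H2_fun R n)) Tg|_ -> /=]; apply: H2_eqP => z zP.
  have /eqP := congr1 (@^~ z) Tg; rewrite /= mulf_eq0 (negbTE (phiP z zP)) => /eqP //.
by rewrite /= mulr0.
Qed.
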